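(* Let $E$ be a directed graph and $K$ a field. Let $L_K(E)$ be the Leavitt path algebra of $E$ over $K$ with its natural $\mathbb{Z}$-grading, and let $\Gamma=\langle x\rangle$ be the infinite cyclic group generated by $x$. (i) The following conditions are equivalent. (1) The algebra $L_K(E)$ is a crossed product. (2) The graph $E$ is a finite no-exit graph without sinks such that Condition (EDL) holds. (3) $L_K(E)$ is graded isomorphic to an algebra of the form $$R=\bigoplus_{i=1}^n \mathbb{M}_{k_im_i}(K[x^{m_i},x^{-m_i}])(k_i(0),k_i(1),\ldots,k_i(m_i-1))$$ where $n$, $k_i$ and $m_i$ are positive integers for $i=1,\ldots,n$. (4) The algebra $L_K(E)$ is a skew group ring. (5) The set $E^0$ is finite and $$(G_E^\Gamma,1_E)\cong\bigoplus_{i=1}^n\Big(\mathbb{Z}[x_i]/(x_i^{m_i}=1),\ \sum_{j=0}^{m_i-1}k_ix_i^j\Big)$$ for some positive integers $n$, $k_i$ and $m_i$ for $i=1,\ldots,n$. (ii) The following conditions are equivalent. (1) The algebra $L_K(E)$ is a group ring. (2) The graph $E$ is a finite no-exit graph without sinks such that every cycle is of length one. (3) $L_K(E)$ is graded isomorphic to an algebra of the form $$\bigoplus_{i=1}^n \mathbb{M}_{k_i}(K[x,x^{-1}])(k_i(0))$$ where $n$ and $k_i$ are positive integers for $i=1,\ldots,n$. (4) The set $E^0$ is finite and $(G_E^\Gamma,1_E)\cong\bigoplus_{i=1}^n(\mathbb{Z},k_i)$ for some positive integers $n$ and $k_i$ for $i=1,\ldots,n$.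
   Context: **Graphs.** A directed graph $E$ has vertex set $E^0$, edge set $E^1$, source map $\mathbf{s}$ and range map $\mathbf{r}$. It is finite if $E^0$ and $E^1$ are finite. A vertex $v$ is a sink if $\mathbf{s}^{-1}(v)=\emptyset$, regular if $\mathbf{s}^{-1}(v)$ is finite and nonempty, and an infinite emitter if $\mathbf{s}^{-1}(v)$ is infinite. A cycle is a closed path such that different edges in the path have different sources. A cycle has an exit if a vertex on the cycle emits an edge outside of the cycle. $E$ is no-exit if no cycle has an exit. Paths include those of length $0$ (vertices). **Condition (EDL).** For every cycle of length $m$, the lengths, considered modulo $m$, of all paths which do not contain the cycle and which end in an arbitrary but fixed vertex of the cycle are $k(0),\ldots,k(m-1)$ for some positive integer $k$, i.e. each residue $0,\ldots,m-1$ modulo $m$ occurs exactly $k$ times. **Leavitt path algebra.** $L_K(E)$ is the free $K$-algebra generated by $E^0\cup E^1\cup\{e^*\mid e\in E^1\}$ subject to, for all vertices $v,w$ and edges $e,f$: $vw=0$ if $v\ne w$ and $vv=v$; $\mathbf{s}(e)e=e\mathbf{r}(e)=e$; $\mathbf{r}(e)e^*=e^*\mathbf{s}(e)=e^*$; $e^*f=0$ if $e\neq f$ and $e^*e=\mathbf{r}(e)$; $v=\sum_{e\in\mathbf{s}^{-1}(v)}ee^*$ for each regular vertex $v$. Its natural $\mathbb{Z}$-grading has $n$-component the $K$-span of all $pq^*$ with $p,q$ paths and $|p|-|q|=n$, where $|p|$ is the length of $p$. $L_K(E)$ is unital iff $E^0$ is finite. **Crossed products etc.** Let $R$ be a unital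 ring graded by a group $\Gamma$ with identity $\varepsilon$ ($R=\bigoplus_\gamma R_\gamma$, $R_\gamma R_\delta\subseteq R_{\gamma\delta}$). $R$ is a crossed product if each $R_\gamma$ contains an invertible element of $R$. A crossed product $R$ is a skew group ring if the exact sequence $1\to U(R_\varepsilon)\to \{\text{invertible homogeneous elements of }R\}\xrightarrow{\deg}\Gamma\to 1$ splits, i.e. there is a group homomorphism $\sigma$ from $\Gamma$ to the group of invertible homogeneous elements with $\sigma(\gamma)\in R_\gamma$; then $R\cong_{\mathrm{gr}}R_\varepsilon*_\phi\Gamma$, where $\phi(\gamma)$ is conjugation by $\sigma(\gamma)$ on $R_\varepsilon$, and $R_\varepsilon *_\phi\Gamma$ is the free $R_\varepsilon$-module with basis $\Gamma$ and multiplication $(r\gamma)(s\delta)=(r\phi(\gamma)(s))\gamma\delta$. A skew group ring is a group ring if such a splitting $\sigma$ can be chosen with $\phi$ trivial, so that $R\cong_{\mathrm{gr}}R_\varepsilon[\Gamma]$. For $L_K(E)$ these notions refer to the natural $\mathbb{Z}$-grading; in particular each of them includes that $L_K(E)$ is unital. **Graded matrix rings.** $K$ is trivially graded. $K[x^m,x^{-m}]$ is $\mathbb{Z}$-graded by $K[x^m,x^{-m}]_{mk}=Kx^{mk}$ and zero components in degrees not divisible by $m$. For a $\Gamma$-graded ring $R$ and $\gamma_1,\dots,\gamma_n\in\Gamma$, $\mathbb{M}_n(R)(\gamma_1,\ldots,\gamma_n)$ is the matrix ring $\mathbb{M}_n(R)$ graded so that $(r_{ij})$ is in the $\delta$-component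 iff $r_{ij}\in R_{\gamma_i^{-1}\delta\gamma_j}$ for all $i,j$. The notation $k(\gamma)$ in such a list means that $\gamma$ is repeated $k$ times. **Pre-ordered $\Gamma$-groups.** A pre-ordered $\Gamma$-group is an abelian group $G$ with a left action of $\Gamma$ by additive maps and a reflexive transitive relation $\geq$ compatible with addition and with the action; its positive cone is $G^+=\{g\mid g\ge 0\}$. An order-unit is $u\in G^+$ such that for any $g\in G$, $g\le au$ for some $0\neq a\in\mathbb{Z}^+[\Gamma]$ ($\mathbb{Z}^+$ denotes the nonnegative integers). $(G,u)\cong(H,v)$ means there is a $\Gamma$-equivariant group isomorphism $f$ with $f(G^+)=H^+$ and $f(u)=v$. Direct sums carry the componentwise structure and order-unit. On $\mathbb{Z}[x_i]/(x_i^{m_i}=1)$ the generator $x$ of $\Gamma$ acts as multiplication by $x_i$, and the positive cone consists of the elements with nonnegative coefficients in the basis $1,x_i,\dots,x_i^{m_i-1}$. On $\mathbb{Z}$ the group $\Gamma$ acts trivially and the order is the usual one. **The graph monoid and group.** $F_E^\Gamma$ is the free commutative $\Gamma$-monoid generated by the vertices $v\in E^0$ and elements $q_Z$ for each finite nonempty $Z\subseteq\mathbf{s}^{-1}(v)$ where $v$ is an infinite emitter. $M_E^\Gamma$ is the quotient of $F_E^\Gamma$ by the congruence generated by, for all $\gamma\in\Gamma$ and $a\in F_E^\Gamma$: (A1) $a+\gamma v\to_1 a+\sum_{e\in\mathbf{s}^{-1}(v)}\gamma x\,\mathbf{r}(e)$ for $v$ regular; (A2) $a+\gamma v\to_1 a+\gamma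 q_Z+\sum_{e\in Z}\gamma x\,\mathbf{r}(e)$ for $v$ an infinite emitter and $Z\subseteq\mathbf{s}^{-1}(v)$ finite nonempty; (A3) $a+\gamma q_Z\to_1 a+\gamma q_W+\sum_{e\in W-Z}\gamma x\,\mathbf{r}(e)$ for $v$ an infinite emitter and $Z\subsetneq W$ finite nonempty subsets of $\mathbf{s}^{-1}(v)$. $G_E^\Gamma$ is the Grothendieck group (group completion) of $M_E^\Gamma$ with the induced $\Gamma$-action and with positive cone the image of $M_E^\Gamma$ ($M_E^\Gamma$ is cancellative). If $E^0$ is finite, $1_E=\sum_{v\in E^0}[v]$, which is an order-unit. *)

(* Defs.v *)
From HB Require Import structures.
From Stdlib Require Import Relation_Operators.
From mathcomp Require Import all_boot all_order all_algebra generic_quotient.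
From mathcomp Require Import finmap multiset.
From mathcomp Require Import boolp classical_sets functions cardinality.

Set Implicit Arguments.
Unset Strict Implicit.
Unset Printing Implicit Defensive.

Import GRing.Theory.

Local Open Scope classical_set_scope.
Local Open Scope ring_scope.

(* Any number of vertices and edges: classically, every type is a choiceType. *)
Record graph := Graph {
  vertex : choiceType;
  edge : choiceType;
  src : edge -> vertex;
  rng : edge -> vertex }.

Section Graphs.
Variable E : graph.
Implicit Types (v : vertex E) (e : edge E) (s c : seq (edge E)).

Definition out v : set (edge E) := [set e | src e = v].

Definition sink v := out v = set0.
Definition regular v := finite_set (out v) /\ out v !=set0.
Definition infinite_emitter v := infinite_set (out v).

Definition finite_graph :=
  finite_set [set: vertex E] /\ finite_set [set: edge E].

(* A path is a pair (v, s) of its source v and its sequence of edges s, so that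
   (v, [::]) is the path of length 0 at v. *)
Fixpoint is_path v s : bool :=
  if s is e :: s' then (src e == v) && is_path (rng e) s' else true.

Definition path_end v s : vertex E := last v [seq rng e | e <- s].

Definition is_cycle c : bool :=
  [&& c != [::], cycle (fun e f => rng e == src f) c & uniq [seq src e | e <- c]].

Definition has_exit c :=
  exists e, src e \in [seq src f | f <- c] /\ e \notin c.

Definition no_exit := forall c, is_cycle c -> ~ has_exit c.

(* A cycle is considered up to the choice of its initial vertex: s contains c
   when s contains, as a block of consecutive edges, some rotation of c. *)
Definition contains_cycle s c : Prop := exists i : nat, infix (rot i c) s.

Definition paths_avoiding c v (r : nat) : set (vertex E * seq (edge E)) :=
  [set p | [/\ is_path p.1 p.2, path_end p.1 p.2 = v, ~ contains_cycle p.2 c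
             & (size p.2 = r %[mod size c])%N] ].

Definition EDL := forall c, is_cycle c -> exists2 k : nat, (0 < k)%N &
  forall v, v \in [seq src e | e <- c] ->
  forall r : nat, (r < size c)%N -> (paths_avoiding c v r #= `I_k)%card.

End Graphs.

(* Not necessarily unital algebras with homogeneous components indexed by Z;
   only the data are recorded, as the notions below depend on nothing else. *)
Record zgalg (K : fieldType) := ZGAlg {
  zg_sort :> lmodType K;
  zg_mul : zg_sort -> zg_sort -> zg_sort;
  zg_comp : int -> set zg_sort }.

Definition graded_iso (K : fieldType) (A B : zgalg K) :=
  exists f : {linear A -> B},
    [/\ bijective f,
        forall a b, f (zg_mul a b) = zg_mul (f a) (f b)
      & forall n, f @` zg_comp (z:=A) n = zg_comp n ].

Section CrossedProducts.
Variables (K : fieldType) (A : zgalg K).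

Definition is_one (u : A) := forall a, zg_mul u a = a /\ zg_mul a u = a.

Definition inverse_wrt (u a b : A) := zg_mul a b = u /\ zg_mul b a = u.

Definition crossed_product := exists2 u, is_one u &
  forall n, exists2 a, zg_comp n a & exists b, inverse_wrt u a b.

(* The group Gamma is int; a splitting of the degree map is a homomorphism from
   Gamma to the invertible homogeneous elements, with sigma n of degree n. *)
Definition splitting (u : A) (sigma : int -> A) :=
  (forall n, zg_comp n (sigma n) /\ exists b, inverse_wrt u (sigma n) b) /\
  (forall m n, sigma (m + n) = zg_mul (sigma m) (sigma n)).

Definition skew_group_ring := crossed_product /\
  exists u sigma, is_one u /\ splitting u sigma.

Definition group_ring := crossed_product /\
  exists u sigma, [/\ is_one u, splitting u sigma &
    forall n b r, inverse_wrt u (sigma n) b -> zg_comp 0 r ->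
      zg_mul (zg_mul (sigma n) r) b = r].

End CrossedProducts.

Definition dirprod (I : Type) (T : I -> Type) : Type := forall i, T i.

Section DirectProductZmod.
Variables (I : Type) (T : I -> zmodType).

HB.instance Definition _ := gen_eqMixin (dirprod T).
HB.instance Definition _ := gen_choiceMixin (dirprod T).

Let add (f g : dirprod T) : dirprod T := fun i => f i + g i.
Let opp (f : dirprod T) : dirprod T := fun i => - f i.
Let zero : dirprod T := fun i => 0.

Fact dirprod_addA : associative add.
Proof. by move=> f g h; apply/functional_extensionality_dep => i; exact: addrA. Qed.
Fact dirprod_addC : commutative add.
Proof. by move=> f g; apply/functional_extensionality_dep => i; exact: addrC. Qed.
Fact dirprod_add0 : left_id zero add.
Proof. by move=> f; apply/functional_extensionality_dep => i; exact: add0r. Qed.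
Fact dirprod_addN : left_inverse zero opp add.
Proof. by move=> f; apply/functional_extensionality_dep => i; exact: addNr. Qed.

HB.instance Definition _ := GRing.isZmodule.Build (dirprod T)
  dirprod_addA dirprod_addC dirprod_add0 dirprod_addN.

End DirectProductZmod.

Section DirectProductLmod.
Variables (K : fieldType) (I : Type) (T : I -> lmodType K).

Let scale (a : K) (f : dirprod T) : dirprod T := fun i => a *: f i.

Fact dirprod_scaleA a b f : scale a (scale b f) = scale (a * b) f.
Proof. by apply/functional_extensionality_dep => i; exact: scalerA. Qed.
Fact dirprod_scale1 : left_id 1 scale.
Proof. by move=> f; apply/functional_extensionality_dep => i; exact: scale1r. Qed.
Fact dirprod_scaleDr : right_distributive scale +%R.
Proof. by move=> a f g; apply/functional_extensionality_dep => i; exact: scalerDr. Qed.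
Fact dirprod_scaleDl f : {morph scale^~ f : a b / a + b}.
Proof. by move=> a b; apply/functional_extensionality_dep => i; exact: scalerDl. Qed.

HB.instance Definition _ := GRing.Zmodule_isLmodule.Build K (dirprod T)
  dirprod_scaleA dirprod_scale1 dirprod_scaleDr dirprod_scaleDl.

End DirectProductLmod.

Definition zgalg_sum (K : fieldType) (n : nat) (A : 'I_n -> zgalg K) : zgalg K :=
  @ZGAlg K (dirprod (fun i => A i : lmodType K))
    (fun f g i => zg_mul (f i) (g i))
    (fun d => [set f | forall i, zg_comp d (f i)]).

Section LPA.
Variables (K : fieldType) (E : graph).

Inductive lpa_term : Type :=
| LVertex of vertex E
| LEdge of edge E
| LGhost of edge E
| LZero
| LAdd of lpa_term & lpa_term
| LOpp of lpa_term
| LScale of K & lpa_term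
| LMul of lpa_term & lpa_term.

Definition lpa_sum (s : seq lpa_term) := foldr LAdd LZero s.

(* The least congruence for which the quotient of the terms is an associative
   K-algebra satisfying the defining relations: the quotient is the free
   (non-unital) K-algebra subject to these relations. *)
Inductive lpa_eqv : lpa_term -> lpa_term -> Prop :=
| LE_refl t : lpa_eqv t t
| LE_sym t u : lpa_eqv t u -> lpa_eqv u t
| LE_trans t u w : lpa_eqv t u -> lpa_eqv u w -> lpa_eqv t w
| LE_add t t' u u' : lpa_eqv t t' -> lpa_eqv u u' ->
    lpa_eqv (LAdd t u) (LAdd t' u')
| LE_opp t t' : lpa_eqv t t' -> lpa_eqv (LOpp t) (LOpp t')
| LE_scale a t t' : lpa_eqv t t' -> lpa_eqv (LScale a t) (LScale a t')
| LE_mul t t' u u' : lpa_eqv t t' -> lpa_eqv u u' ->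
    lpa_eqv (LMul t u) (LMul t' u')
| LE_addA t u w : lpa_eqv (LAdd t (LAdd u w)) (LAdd (LAdd t u) w)
| LE_addC t u : lpa_eqv (LAdd t u) (LAdd u t)
| LE_add0 t : lpa_eqv (LAdd LZero t) t
| LE_addN t : lpa_eqv (LAdd (LOpp t) t) LZero
| LE_scaleA a b t : lpa_eqv (LScale a (LScale b t)) (LScale (a * b) t)
| LE_scale1 t : lpa_eqv (LScale 1 t) t
| LE_scaleDr a t u :
    lpa_eqv (LScale a (LAdd t u)) (LAdd (LScale a t) (LScale a u))
| LE_scaleDl a b t :
    lpa_eqv (LScale (a + b) t) (LAdd (LScale a t) (LScale b t))
| LE_mulA t u w : lpa_eqv (LMul t (LMul u w)) (LMul (LMul t u) w)
| LE_mulDl t u w : lpa_eqv (LMul (LAdd t u) w) (LAdd (LMul t w) (LMul u w))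
| LE_mulDr t u w : lpa_eqv (LMul t (LAdd u w)) (LAdd (LMul t u) (LMul t w))
| LE_scaleAl a t u : lpa_eqv (LScale a (LMul t u)) (LMul (LScale a t) u)
| LE_scaleAr a t u : lpa_eqv (LScale a (LMul t u)) (LMul t (LScale a u))
| LE_vv v : lpa_eqv (LMul (LVertex v) (LVertex v)) (LVertex v)
| LE_vw v w : v <> w -> lpa_eqv (LMul (LVertex v) (LVertex w)) LZero
| LE_se e : lpa_eqv (LMul (LVertex (src e)) (LEdge e)) (LEdge e)
| LE_er e : lpa_eqv (LMul (LEdge e) (LVertex (rng e))) (LEdge e)
| LE_rg e : lpa_eqv (LMul (LVertex (rng e)) (LGhost e)) (LGhost e)
| LE_gs e : lpa_eqv (LMul (LGhost e) (LVertex (src e))) (LGhost e)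
| LE_ge e : lpa_eqv (LMul (LGhost e) (LEdge e)) (LVertex (rng e))
| LE_gf e f : e <> f -> lpa_eqv (LMul (LGhost e) (LEdge f)) LZero
| LE_ck v : regular v -> lpa_eqv (LVertex v)
    (lpa_sum [seq LMul (LEdge e) (LGhost e) | e <- fset_set (out v)]).

HB.instance Definition _ := gen_eqMixin lpa_term.
HB.instance Definition _ := gen_choiceMixin lpa_term.

Definition lpa_rel (t u : lpa_term) : bool := `[< lpa_eqv t u >].

Fact lpa_rel_refl : reflexive lpa_rel.
Proof. by move=> t; apply/asboolP; exact: LE_refl. Qed.
Fact lpa_rel_sym : symmetric lpa_rel.
Proof. by move=> t u; apply/asboolP/asboolP; exact: LE_sym. Qed.
Fact lpa_rel_trans : transitive lpa_rel.
Proof.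
by move=> u t w /asboolP tu /asboolP uw; apply/asboolP; exact: LE_trans tu uw.
Qed.

Canonical lpa_equiv := EquivRel lpa_rel lpa_rel_refl lpa_rel_sym lpa_rel_trans.

Definition lpa := {eq_quot lpa_equiv}%qT.
HB.instance Definition _ : EqQuotient _ lpa_equiv lpa := EqQuotient.on lpa.
HB.instance Definition _ := Choice.on lpa.

Definition lpa_pi (t : lpa_term) : lpa := (\pi_lpa t)%qT.

Lemma lpa_piP t u : lpa_pi t = lpa_pi u <-> lpa_eqv t u.
Proof. by split=> [/eqmodP/asboolP//|tu]; apply/eqmodP/asboolP. Qed.

Lemma lpa_reprK a : lpa_pi (repr a) = a.
Proof. exact: reprK. Qed.

Lemma lpa_piK t : lpa_eqv (repr (lpa_pi t)) t.
Proof. by apply/lpa_piP; rewrite lpa_reprK. Qed.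

Definition lpa_zero : lpa := lpa_pi LZero.
Definition lpa_add (a b : lpa) : lpa := lpa_pi (LAdd (repr a) (repr b)).
Definition lpa_opp (a : lpa) : lpa := lpa_pi (LOpp (repr a)).
Definition lpa_scale (c : K) (a : lpa) : lpa := lpa_pi (LScale c (repr a)).
Definition lpa_mul (a b : lpa) : lpa := lpa_pi (LMul (repr a) (repr b)).

Lemma lpa_addE t u : lpa_add (lpa_pi t) (lpa_pi u) = lpa_pi (LAdd t u).
Proof. by apply/lpa_piP; apply: LE_add; exact: lpa_piK. Qed.
Lemma lpa_oppE t : lpa_opp (lpa_pi t) = lpa_pi (LOpp t).
Proof. by apply/lpa_piP; apply: LE_opp; exact: lpa_piK. Qed.
Lemma lpa_scaleE c t : lpa_scale c (lpa_pi t) = lpa_pi (LScale c t).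
Proof. by apply/lpa_piP; apply: LE_scale; exact: lpa_piK. Qed.
Lemma lpa_mulE t u : lpa_mul (lpa_pi t) (lpa_pi u) = lpa_pi (LMul t u).
Proof. by apply/lpa_piP; apply: LE_mul; exact: lpa_piK. Qed.

Lemma lpa_ind (P : lpa -> Prop) : (forall t, P (lpa_pi t)) -> forall a, P a.
Proof. by move=> Ppi a; rewrite -[a]lpa_reprK. Qed.

Fact lpa_addA : associative lpa_add.
Proof.
elim/lpa_ind=> t; elim/lpa_ind=> u; elim/lpa_ind=> w.
by rewrite !lpa_addE; apply/lpa_piP; exact: LE_addA.
Qed.
Fact lpa_addC : commutative lpa_add.
Proof.
elim/lpa_ind=> t; elim/lpa_ind=> u.
by rewrite !lpa_addE; apply/lpa_piP; exact: LE_addC.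
Qed.
Fact lpa_add0 : left_id lpa_zero lpa_add.
Proof. by elim/lpa_ind=> t; rewrite lpa_addE; apply/lpa_piP; exact: LE_add0. Qed.
Fact lpa_addN : left_inverse lpa_zero lpa_opp lpa_add.
Proof.
elim/lpa_ind=> t.
by rewrite lpa_oppE lpa_addE; apply/lpa_piP; exact: LE_addN.
Qed.

HB.instance Definition _ := GRing.isZmodule.Build lpa
  lpa_addA lpa_addC lpa_add0 lpa_addN.

Fact lpa_scaleA a b x : lpa_scale a (lpa_scale b x) = lpa_scale (a * b) x.
Proof.
by elim/lpa_ind: x => t; rewrite !lpa_scaleE; apply/lpa_piP; exact: LE_scaleA.
Qed.
Fact lpa_scale1 : left_id 1 lpa_scale.
Proof. by elim/lpa_ind=> t; rewrite lpa_scaleE; apply/lpa_piP; exact: LE_scale1. Qed.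
Fact lpa_scaleDr : right_distributive lpa_scale lpa_add.
Proof.
move=> a; elim/lpa_ind=> t; elim/lpa_ind=> u.
by rewrite !(lpa_addE, lpa_scaleE); apply/lpa_piP; exact: LE_scaleDr.
Qed.
Fact lpa_scaleDl x a b : lpa_scale (a + b) x = lpa_add (lpa_scale a x) (lpa_scale b x).
Proof.
elim/lpa_ind: x => t.
by rewrite !(lpa_addE, lpa_scaleE); apply/lpa_piP; exact: LE_scaleDl.
Qed.

HB.instance Definition _ := GRing.Zmodule_isLmodule.Build K lpa
  lpa_scaleA lpa_scale1 lpa_scaleDr lpa_scaleDl.

Lemma lpa_mulA : associative lpa_mul.
Proof.
elim/lpa_ind=> t; elim/lpa_ind=> u; elim/lpa_ind=> w.
by rewrite !lpa_mulE; apply/lpa_piP; exact: LE_mulA.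
Qed.
Lemma lpa_mulDl : left_distributive lpa_mul +%R.
Proof.
change (left_distributive lpa_mul lpa_add).
elim/lpa_ind=> t; elim/lpa_ind=> u; elim/lpa_ind=> w.
by rewrite !(lpa_mulE, lpa_addE); apply/lpa_piP; exact: LE_mulDl.
Qed.
Lemma lpa_mulDr : right_distributive lpa_mul +%R.
Proof.
change (right_distributive lpa_mul lpa_add).
elim/lpa_ind=> t; elim/lpa_ind=> u; elim/lpa_ind=> w.
by rewrite !(lpa_mulE, lpa_addE); apply/lpa_piP; exact: LE_mulDr.
Qed.
Lemma lpa_scaleAl a x y : a *: lpa_mul x y = lpa_mul (a *: x) y.
Proof.
change (lpa_scale a (lpa_mul x y) = lpa_mul (lpa_scale a x) y).
elim/lpa_ind: x => t; elim/lpa_ind: y => u.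
by rewrite !(lpa_mulE, lpa_scaleE); apply/lpa_piP; exact: LE_scaleAl.
Qed.
Lemma lpa_scaleAr a x y : a *: lpa_mul x y = lpa_mul x (a *: y).
Proof.
change (lpa_scale a (lpa_mul x y) = lpa_mul x (lpa_scale a y)).
elim/lpa_ind: x => t; elim/lpa_ind: y => u.
by rewrite !(lpa_mulE, lpa_scaleE); apply/lpa_piP; exact: LE_scaleAr.
Qed.

Definition lpa_vertex v : lpa := lpa_pi (LVertex v).
Definition lpa_edge e : lpa := lpa_pi (LEdge e).
Definition lpa_ghost e : lpa := lpa_pi (LGhost e).

(* For a path p = (v, s) with s = [:: e1; ...; en]: p is e1 ... en r(en), and
   p^* is r(en) en^* ... e1^*. *)
Fixpoint lpa_path (v : vertex E) (s : seq (edge E)) : lpa :=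
  if s is e :: s' then lpa_mul (lpa_edge e) (lpa_path (rng e) s')
  else lpa_vertex v.
Fixpoint lpa_path_star (v : vertex E) (s : seq (edge E)) : lpa :=
  if s is e :: s' then lpa_mul (lpa_path_star (rng e) s') (lpa_ghost e)
  else lpa_vertex v.

Definition lpa_monomial (n : int) : set lpa :=
  [set a | exists v s w t,
     [/\ is_path v s, is_path w t, (size s)%:Z - (size t)%:Z = n
       & a = lpa_mul (lpa_path v s) (lpa_path_star w t)] ].

Definition lpa_comp (n : int) : set lpa :=
  [set a | exists2 l : seq (K * lpa),
     (forall x, x \in l -> lpa_monomial n x.2) & a = \sum_(x <- l) x.1 *: x.2].

Definition LPA : zgalg K := ZGAlg lpa_mul lpa_comp.

End LPA.

(* K(x); an alias, since a K-algebra structure is added to the field. *)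
Definition ratfun (K : fieldType) : Type := {fraction {poly K}}.

Section RationalFunctions.
Variable K : fieldType.

HB.instance Definition _ := GRing.Field.on (ratfun K).

Definition ratfunX : ratfun K := tofrac 'X.

Let scale (a : K) (f : ratfun K) : ratfun K := (tofrac a%:P : ratfun K) * f.

Fact ratfun_scaleA a b f : scale a (scale b f) = scale (a * b) f.
Proof. by rewrite /scale polyCM tofracM mulrA. Qed.
Fact ratfun_scale1 : left_id 1 scale.
Proof. by move=> f; rewrite /scale polyC1 tofrac1 mul1r. Qed.
Fact ratfun_scaleDr : right_distributive scale +%R.
Proof. by move=> a f g; rewrite /scale mulrDr. Qed.
Fact ratfun_scaleDl f : {morph scale^~ f : a b / a + b}.
Proof. by move=> a b; rewrite /scale polyCD tofracD mulrDl. Qed.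

HB.instance Definition _ := GRing.Zmodule_isLmodule.Build K (ratfun K)
  ratfun_scaleA ratfun_scale1 ratfun_scaleDr ratfun_scaleDl.

Fact ratfun_scaleAl (a : K) (f g : ratfun K) : a *: (f * g) = a *: f * g.
Proof. exact: mulrA. Qed.
HB.instance Definition _ :=
  GRing.Lmodule_isLalgebra.Build K (ratfun K) ratfun_scaleAl.

Fact ratfun_scaleAr (a : K) (f g : ratfun K) : a *: (f * g) = f * (a *: g).
Proof. exact: mulrCA. Qed.
HB.instance Definition _ :=
  GRing.Lalgebra_isAlgebra.Build K (ratfun K) ratfun_scaleAr.

Lemma ratfun_scaleE (a : K) (f : ratfun K) :
  a *: f = (tofrac a%:P : ratfun K) * f.
Proof. by []. Qed.

End RationalFunctions.

(* K[x^m, x^-m] is the set of the f = p(x^m) / x^(m n) in K(x), p a polynomial. *)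
Definition laurent_pred (K : fieldType) (m : nat) (f : ratfun K) : bool :=
  `[< exists (p : {poly K}) (n : nat),
        f * ratfunX K ^+ (m * n) = tofrac (p \Po 'X^m) >].

Section Laurent.
Variables (K : fieldType) (m : nat).

Fact laurent_subalg_closed : subalg_closed (@laurent_pred K m).
Proof.
have X0 : @tofrac {poly K} 'X != 0 by rewrite tofrac_eq0 polyX_eq0.
split.
- by apply/asboolP; exists 1, 0%N; rewrite muln0 expr0 mulr1 comp_polyC polyC1 tofrac1.
- move=> a f g /asboolP [p [i fp]] /asboolP [q [j gq]]; apply/asboolP.
  exists (a *: (p * 'X^j) + q * 'X^i), (i + j)%N.
  rewrite comp_polyD comp_polyZ !comp_polyM !comp_Xn_poly -!exprM.
  rewrite -mul_polyC tofracD !tofracM -fp -gq !tofracXn ratfun_scaleE mulrDl.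
  rewrite mulnDr exprD; congr (_ + _); first by rewrite -!mulrA.
  by rewrite -mulrA [ratfunX K ^+ (m * i) * _]mulrC.
- move=> f g /asboolP [p [i fp]] /asboolP [q [j gq]]; apply/asboolP.
  exists (p * q), (i + j)%N.
  by rewrite comp_polyM tofracM -fp -gq mulnDr exprD mulrACA.
Qed.

HB.instance Definition _ := GRing.isSubalgClosed.Build K (ratfun K)
  (@laurent_pred K m) laurent_subalg_closed.

Record laurent := Laurent {
  laurent_val :> ratfun K; _ : laurent_val \in @laurent_pred K m }.

HB.instance Definition _ := [isSub for laurent_val].
HB.instance Definition _ := [Choice of laurent by <:].
HB.instance Definition _ := [SubChoice_isSubAlgebra of laurent by <:].

Definition laurent_comp (d : int) : set laurent :=
  [set f | if (m%:Z %| d)%Z then exists a : K, laurent_val f = a *: ratfunX K ^ d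
           else f = 0].

End Laurent.

(* An alias of 'M[R]_n, whose module structure in the library is over R, not K. *)
Definition kmatrix (K : fieldType) (R : algType K) (n : nat) : Type := 'M[R]_n.

Section KMatrix.
Variables (K : fieldType) (R : algType K) (n : nat).

HB.instance Definition _ := GRing.Zmodule.on (kmatrix R n).

Let scale (a : K) (A : kmatrix R n) : kmatrix R n := map_mx (fun r => a *: r) A.

Fact kmatrix_scaleA a b A : scale a (scale b A) = scale (a * b) A.
Proof. by apply/matrixP => i j; rewrite !mxE scalerA. Qed.
Fact kmatrix_scale1 : left_id 1 scale.
Proof. by move=> A; apply/matrixP => i j; rewrite !mxE scale1r. Qed.
Fact kmatrix_scaleDr : right_distributive scale +%R.
Proof. by move=> a A B; apply/matrixP => i j; rewrite !mxE scalerDr. Qed.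
Fact kmatrix_scaleDl A : {morph scale^~ A : a b / a + b}.
Proof. by move=> a b; apply/matrixP => i j; rewrite !mxE scalerDl. Qed.

HB.instance Definition _ := GRing.Zmodule_isLmodule.Build K (kmatrix R n)
  kmatrix_scaleA kmatrix_scale1 kmatrix_scaleDr kmatrix_scaleDl.

End KMatrix.

(* M_n(R)(gamma_1, ..., gamma_n), where C gives the components of R *)
Definition graded_matrix (K : fieldType) (R : algType K) (C : int -> set R)
    (n : nat) (gamma : 'I_n -> int) : zgalg K :=
  @ZGAlg K (kmatrix R n : lmodType K)
    (fun A B => (A : 'M[R]_n) *m (B : 'M[R]_n))
    (fun d => [set A : 'M[R]_n | forall i j, C (- gamma i + d + gamma j) (A i j)]).

Definition laurent_matrix (K : fieldType) (m n : nat) (gamma : 'I_n -> int) :=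
  graded_matrix (@laurent_comp K m) gamma.

(* M_(k m)(K[x^m, x^-m])(k(0), k(1), ..., k(m-1)): each of 0, ..., m-1 occurs in
   k consecutive positions, i.e. position j carries j %/ k. *)
Definition crossed_block (K : fieldType) (k m : nat) : zgalg K :=
  laurent_matrix K m (fun j : 'I_(k * m) => (j %/ k)%N%:Z).

(* M_k(K[x, x^-1])(k(0)) *)
Definition group_block (K : fieldType) (k : nat) : zgalg K :=
  laurent_matrix K 1 (fun _ : 'I_k => 0).

(* Gamma is int, with generator x = 1; pog_act n is the action of x^n. *)
Record pogroup := POGroup {
  pog_sort :> zmodType;
  pog_act : int -> pog_sort -> pog_sort;
  pog_pos : set pog_sort;
  pog_unit : pog_sort }.

Definition pog_iso (G H : pogroup) :=
  exists f : {additive G -> H},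
    [/\ bijective f,
        forall n g, f (pog_act n g) = pog_act n (f g),
        f @` @pog_pos G = @pog_pos H
      & f (pog_unit G) = pog_unit H].

Definition pog_sum (n : nat) (G : 'I_n -> pogroup) : pogroup :=
  @POGroup (dirprod (fun i => G i : zmodType))
    (fun d g i => pog_act d (g i))
    [set g | forall i, pog_pos (g i)]
    (fun i => pog_unit (G i)).

(* (Z[x]/(x^m = 1), \sum_(j < m) k x^j), for m > 0; x^n acts as x^(n mod m). *)
Definition cyclic_pogroup (m k : nat) : pogroup :=
  @POGroup {poly %/ ('X^m - 1 : {poly int})}
    (fun n g => 'qX ^+ `|(n %% m)%Z|%N * g)
    [set g | forall i : nat, (0 <= (g : {poly int})`_i)%R]
    (\sum_(j < m) 'qX ^+ j *+ k).

Definition int_pogroup (k : nat) : pogroup :=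
  @POGroup int (fun _ a => a) [set a | (0 <= a)%R] k%:Z.

Section GraphMonoid.
Variable E : graph.
Local Open Scope mset_scope.

(* The index sets Z of the generators q_Z; the emitter v is determined by Z. *)
Definition qset_pred (Z : {fset edge E}) : bool :=
  `[< Z != fset0 /\
      exists v, infinite_emitter v /\ ([set` Z] `<=` out v)%classic >].
Definition qset := {Z : {fset edge E} | qset_pred Z}.

Definition gm_gen : choiceType := (vertex E + qset)%type.

(* The free commutative Gamma-monoid on gm_gen is the free commutative monoid
   on Gamma * gm_gen: (n, g) stands for x^n g. *)
Definition gm_free := {mset (int * gm_gen)}.

Definition gm_shift (n : int) (a : gm_free) : gm_free :=
  seq_mset [seq (n + y.1, y.2) | y <- enum_mset a].

Definition gm_ranges (n : int) (Z : {fset edge E}) : gm_free :=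
  seq_mset [seq (n, inl (rng e) : gm_gen) | e <- Z].

Inductive gm_step : gm_free -> gm_free -> Prop :=
| GM_A1 (n : int) (a : gm_free) (v : vertex E) : regular v ->
    gm_step (a `+` [mset (n, inl v : gm_gen)])
            (a `+` gm_ranges (n + 1) (fset_set (out v)))
| GM_A2 (n : int) (a : gm_free) (v : vertex E) (Z : qset) :
    infinite_emitter v -> ([set` val Z] `<=` out v)%classic ->
    gm_step (a `+` [mset (n, inl v : gm_gen)])
            (a `+` [mset (n, inr Z : gm_gen)] `+` gm_ranges (n + 1) (val Z))
| GM_A3 (n : int) (a : gm_free) (v : vertex E) (Z W : qset) :
    infinite_emitter v -> ([set` val W] `<=` out v)%classic -> (val Z `<` val W)%fset ->
    gm_step (a `+` [mset (n, inr Z : gm_gen)])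
            (a `+` [mset (n, inr W : gm_gen)]
               `+` gm_ranges (n + 1) (val W `\` val Z)%fset).

Definition gm_eqv := clos_refl_sym_trans gm_free gm_step.

Definition gm_rel (a b : gm_free) : bool := `[< gm_eqv a b >].

Fact gm_rel_refl : reflexive gm_rel.
Proof. by move=> a; apply/asboolP; exact: rst_refl. Qed.
Fact gm_rel_sym : symmetric gm_rel.
Proof. by move=> a b; apply/asboolP/asboolP; exact: rst_sym. Qed.
Fact gm_rel_trans : transitive gm_rel.
Proof.
by move=> b a c /asboolP ab /asboolP bc; apply/asboolP; exact: rst_trans ab bc.
Qed.

Canonical gm_equiv := EquivRel gm_rel gm_rel_refl gm_rel_sym gm_rel_trans.

Definition gmonoid := {eq_quot gm_equiv}%qT.
HB.instance Definition _ : EqQuotient _ gm_equiv gmonoid := EqQuotient.on gmonoid.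
HB.instance Definition _ := Choice.on gmonoid.


Definition gm_pi (a : gm_free) : gmonoid := (\pi_gmonoid a)%qT.

Lemma gm_piP a b : gm_pi a = gm_pi b <-> gm_eqv a b.
Proof. by split=> [/eqmodP/asboolP//|ab]; apply/eqmodP/asboolP. Qed.

Lemma gm_reprK x : gm_pi (repr x) = x.
Proof. exact: reprK. Qed.

Lemma gm_piK a : gm_eqv (repr (gm_pi a)) a.
Proof. by apply/gm_piP; rewrite gm_reprK. Qed.

Lemma gm_step_add c a b : gm_step a b -> gm_step (c `+` a) (c `+` b).
Proof.
by case=> *; rewrite !msetDA; [exact: GM_A1|apply: GM_A2|apply: GM_A3]; eauto.
Qed.

Lemma gm_eqv_add a a' b b' :
  gm_eqv a a' -> gm_eqv b b' -> gm_eqv (a `+` b) (a' `+` b').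
Proof.
have addl c x y : gm_eqv x y -> gm_eqv (c `+` x) (c `+` y).
  elim=> {x y} [x y xy|x|x y _ yx|x y z _ xy _ yz].
  - by apply: rst_step; exact: gm_step_add.
  - exact: rst_refl.
  - exact: rst_sym.
  - exact: rst_trans xy yz.
move=> aa' bb'; apply: (rst_trans _ _ _ (a `+` b')); first exact: addl.
by rewrite ![_ `+` b']msetDC; exact: addl.
Qed.

Definition gm_zero : gmonoid := gm_pi mset0.
Definition gm_add (x y : gmonoid) : gmonoid := gm_pi (repr x `+` repr y).

Lemma gm_addE a b : gm_add (gm_pi a) (gm_pi b) = gm_pi (a `+` b).
Proof. by apply/gm_piP; apply: gm_eqv_add; exact: gm_piK. Qed.

Lemma gm_ind (P : gmonoid -> Prop) : (forall a, P (gm_pi a)) -> forall x, P x.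
Proof. by move=> Ppi x; rewrite -[x]gm_reprK. Qed.

Fact gm_addA : associative gm_add.
Proof.
by elim/gm_ind=> a; elim/gm_ind=> b; elim/gm_ind=> c; rewrite !gm_addE msetDA.
Qed.
Fact gm_addC : commutative gm_add.
Proof. by elim/gm_ind=> a; elim/gm_ind=> b; rewrite !gm_addE msetDC. Qed.
Fact gm_add0 : left_id gm_zero gm_add.
Proof. by elim/gm_ind=> a; rewrite gm_addE mset0D. Qed.

HB.instance Definition _ := GRing.isNmodule.Build gmonoid gm_addA gm_addC gm_add0.

Lemma gm_shiftE n a g k : gm_shift n a (k, g) = a (k - n, g).
Proof.
rewrite /gm_shift mset_seqE count_map -count_mem_mset; apply: eq_count.
move=> [i h] /=; rewrite -!pair_eqE /= /pair_eq /= addrC.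
by rewrite eq_sym -subr_eq eq_sym.
Qed.

Lemma gm_shiftD n a b : gm_shift n (a `+` b) = gm_shift n a `+` gm_shift n b.
Proof. by apply/msetP=> -[k g]; rewrite !(msetE2, gm_shiftE). Qed.

Lemma gm_shift_seq n s : gm_shift n (seq_mset s) = seq_mset [seq (n + y.1, y.2) | y <- s].
Proof. by apply/eq_seq_msetP/perm_map/perm_eq_seq_mset. Qed.

Lemma gm_shift1 n k g : gm_shift n [mset (k, g)] = [mset (n + k, g)].
Proof.
have seq1 y : [mset y] = seq_mset [:: y] :> gm_free.
  by apply/msetP=> x; rewrite mset_seqE msetnE /= addn0 eq_sym; case: eqP.
by rewrite !seq1 gm_shift_seq.
Qed.

Lemma gm_shift_ranges n k Z : gm_shift n (gm_ranges k Z) = gm_ranges (n + k) Z.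
Proof. by rewrite /gm_ranges gm_shift_seq -map_comp. Qed.

Lemma gm_shift_step n a b : gm_step a b -> gm_step (gm_shift n a) (gm_shift n b).
Proof.
case=> *; rewrite !(gm_shiftD, gm_shift1, gm_shift_ranges) addrA.
- exact: GM_A1.
- by apply: GM_A2; eauto.
- by apply: GM_A3; eauto.
Qed.

Lemma gm_shift_eqv n a b : gm_eqv a b -> gm_eqv (gm_shift n a) (gm_shift n b).
Proof.
elim=> {a b} [x y xy|x|x y _ yx|x y z _ xy _ yz].
- by apply: rst_step; exact: gm_shift_step.
- exact: rst_refl.
- exact: rst_sym.
- exact: rst_trans xy yz.
Qed.

Definition gm_act (n : int) (x : gmonoid) : gmonoid := gm_pi (gm_shift n (repr x)).

Lemma gm_actE n a : gm_act n (gm_pi a) = gm_pi (gm_shift n a).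
Proof. by apply/gm_piP; apply: gm_shift_eqv; exact: gm_piK. Qed.

Lemma gm_actD n : {morph gm_act n : x y / x + y}.
Proof.
elim/gm_ind=> a; elim/gm_ind=> b.
rewrite -[gm_pi a + gm_pi b]/(gm_add (gm_pi a) (gm_pi b)) gm_addE !gm_actE.
by rewrite gm_shiftD -gm_addE.
Qed.

Definition gm_vertex (v : vertex E) : gmonoid :=
  gm_pi [mset (0%R, inl v : gm_gen)].

End GraphMonoid.

Section Grothendieck.
Variable M : nmodType.

(* The class of (a, b) stands for a - b. *)
Definition groth_rel (p q : M * M) : bool :=
  `[< exists c, p.1 + q.2 + c = q.1 + p.2 + c >].

Fact groth_rel_refl : reflexive groth_rel.
Proof. by move=> p; apply/asboolP; exists 0. Qed.
Fact groth_rel_sym : symmetric groth_rel.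
Proof. by move=> p q; apply/asboolP/asboolP=> -[c e]; exists c; rewrite e. Qed.
Fact groth_rel_trans : transitive groth_rel.
Proof.
move=> q p r /asboolP [c pq] /asboolP [d qr]; apply/asboolP.
exists (q.1 + q.2 + c + d).
rewrite [LHS](AC (2*4) ((1*4*5)*(3*2*6))) [RHS](AC (2*4) ((3*2*5)*(1*4*6))) /=.
by rewrite pq qr.
Qed.

Canonical groth_equiv :=
  EquivRel groth_rel groth_rel_refl groth_rel_sym groth_rel_trans.

Definition groth := {eq_quot groth_equiv}%qT.
HB.instance Definition _ : EqQuotient _ groth_equiv groth := EqQuotient.on groth.
HB.instance Definition _ := Choice.on groth.

Definition groth_pi (p : M * M) : groth := (\pi_groth p)%qT.

Lemma groth_piP p q :
  groth_pi p = groth_pi q <-> exists c, p.1 + q.2 + c = q.1 + p.2 + c.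
Proof. by split=> [/eqmodP/asboolP//|pq]; apply/eqmodP/asboolP. Qed.

Lemma groth_reprK x : groth_pi (repr x) = x.
Proof. exact: reprK. Qed.

Definition groth_zero : groth := groth_pi (0, 0).
Definition groth_add (x y : groth) : groth :=
  groth_pi ((repr x).1 + (repr y).1, (repr x).2 + (repr y).2).
Definition groth_opp (x : groth) : groth := groth_pi ((repr x).2, (repr x).1).

Lemma groth_addE p q :
  groth_add (groth_pi p) (groth_pi q) = groth_pi (p.1 + q.1, p.2 + q.2).
Proof.
have /groth_piP [c pc] := groth_reprK (groth_pi p).
have /groth_piP [d qd] := groth_reprK (groth_pi q).
apply/groth_piP; exists (c + d) => /=.
rewrite [LHS](AC (2*2*2) ((1*3*5)*(2*4*6))) [RHS](AC (2*2*2) ((1*3*5)*(2*4*6))) /=.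
by rewrite pc qd.
Qed.

Lemma groth_oppE p : groth_opp (groth_pi p) = groth_pi (p.2, p.1).
Proof.
have /groth_piP [c pc] := groth_reprK (groth_pi p).
by apply/groth_piP; exists c => /=; rewrite [_ + p.1]addrC -pc [p.2 + _]addrC.
Qed.

Lemma groth_ind (P : groth -> Prop) : (forall p, P (groth_pi p)) -> forall x, P x.
Proof. by move=> Ppi x; rewrite -[x]groth_reprK. Qed.

Fact groth_addA : associative groth_add.
Proof.
by elim/groth_ind=> p; elim/groth_ind=> q; elim/groth_ind=> r;
  rewrite !groth_addE /= !addrA.
Qed.
Fact groth_addC : commutative groth_add.
Proof.
by elim/groth_ind=> p; elim/groth_ind=> q;
  rewrite !groth_addE /= (addrC p.1) (addrC p.2).
Qed.
Fact groth_add0 : left_id groth_zero groth_add.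
Proof. by elim/groth_ind=> -[a b]; rewrite groth_addE /= !add0r. Qed.
Fact groth_addN : left_inverse groth_zero groth_opp groth_add.
Proof.
elim/groth_ind=> -[a b]; rewrite groth_oppE groth_addE /=.
by apply/groth_piP; exists 0; rewrite /= !addr0 add0r addrC.
Qed.

HB.instance Definition _ := GRing.isZmodule.Build groth
  groth_addA groth_addC groth_add0 groth_addN.

Definition groth_inj (a : M) : groth := groth_pi (a, 0).

End Grothendieck.

(* The map of Grothendieck groups induced by an additive f. *)
Definition groth_map (M N : nmodType) (f : M -> N) (x : groth M) : groth N :=
  groth_pi (f (repr x).1, f (repr x).2).

Lemma groth_mapE (M N : nmodType) (f : M -> N) p : {morph f : x y / x + y} ->
  groth_map f (groth_pi p) = groth_pi (f p.1, f p.2).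
Proof.
move=> fD; have /groth_piP [c pc] := groth_reprK (groth_pi p).
by apply/groth_piP; exists (f c); rewrite /= -!fD pc.
Qed.

(* (G_E^Gamma, 1_E); 1_E is meaningful when E has finitely many vertices. *)
Definition graph_pogroup (E : graph) : pogroup :=
  @POGroup (groth (gmonoid E))
    (fun n => groth_map (@gm_act E n))
    (range (@groth_inj (gmonoid E)))
    (\sum_(v <- fset_set [set: vertex E]) groth_inj (gm_vertex v)).

(* Main.v *)
From HB Require Import structures.
From Stdlib Require Import Relation_Operators.
Require Import Defs.
From mathcomp Require Import all_boot all_order all_algebra.
From mathcomp Require Import finmap multiset zify qpoly.
From mathcomp Require Import boolp classical_sets cardinality.

(** The numbers P(n, v) of paths of length n to a vertex v ([paths_to]) govern both the
    algebra and the group of E.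

    Suppose that E^0 is finite and all vertices are regular. An invertible element of
    degree one, expanded with respect to paths of lengths n + 1 and n for large n, is a
    family of invertible matrices, one for each v, of size P(n + 1, v) by P(n, v)
    ([crossed_constant]). On the other hand 1_E equals the sum over v of P(n, v) x^n v in
    the graph group, so that x 1_E = 1_E says again that P(n + 1, v) = P(n, v) for large n
    ([unit_fixed_constant]). Regularity is forced in both cases: an invertible element of
    degree one cannot exist in the presence of a sink or an infinite emitter
    ([crossed_finite_regular]), and the paths to vertices that are not regular give an
    invariant that separates x 1_E from 1_E ([unit_fixed_regular]).

    If the P(n, v) are eventually constant then no cycle has an exit, as every turn round
    a cycle with an exit adds a path ([constant_no_exit]). Without exits a path of large
    length N to a vertex v on a cycle c of length m is a path that avoids c, of length
    congruent to N modulo m, followed by turns round c ([card_paths_avoiding]); so the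
    constancy of P(N, v) is Condition (EDL) ([constant_EDL]).

    Conversely let E be finite without exits and sinks. Every long path ends on a cycle,
    where it has a unique continuation. So the finite set of paths of length N is a
    branching system: E^1 acts on it by prepending an edge and dropping the last one. Let L
    act on the functions on this set with values in K(x), each edge also multiplying by x.
    This representation is faithful ([act_faithful]), it is a sum of blocks, one for each
    cycle, and after conjugation by powers of x its image in the block of a cycle of
    length m is the full matrix ring over K[x^m, x^-m] ([lpa_blocks_iso]). Condition (EDL)
    says that each vertex of the cycle is the end of equally many of the paths, which makes
    the shifts of the grading those of the theorem. In these matrix rings the powers of a
    weighted cyclic shift split the degree map ([crossed_block_splitting]). In the graph
    monoid, likewise, every vertex is a sum of elements x^r w with w a base vertex of a
    cycle, and x^m w = w; the coefficients are numbers of long paths, which identifies the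
    ordered group ([graph_pog_iso]).

    For group rings, an element of degree one that commutes with the vertices has an
    invertible corner at each vertex of a cycle; but the degrees in this corner are the
    multiples of the length of the cycle, which is therefore one ([group_ring_loops]).
    Similarly x acts trivially on the class of a vertex on a cycle only if the cycle is a
    loop ([vertex_fixed_loop]). When all cycles are loops, scalar matrices x^n split the
    degree map ([group_block_splitting]). *)

Set Implicit Arguments.
Unset Strict Implicit.
Unset Printing Implicit Defensive.

Import GRing.Theory.

Local Open Scope classical_set_scope.
Local Open Scope ring_scope.

(** * Paths and their enumeration *)

Section Paths.
Variable E : graph.
Implicit Types (v w u : vertex E) (e : edge E) (s t c : seq (edge E)).

Lemma is_path_cat v s t :
  is_path v (s ++ t) = is_path v s && is_path (path_end v s) t.
Proof. by elim: s v => //= e s IH v; rewrite IH andbA. Qed.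

Lemma path_end_cat v s t : path_end v (s ++ t) = path_end (path_end v s) t.
Proof. by rewrite /path_end map_cat last_cat. Qed.

Lemma is_path_rcons v s e :
  is_path v (rcons s e) = is_path v s && (src e == path_end v s).
Proof. by rewrite -cats1 is_path_cat /= andbT. Qed.

Lemma path_end_rcons v s e : path_end v (rcons s e) = rng e.
Proof. by rewrite -cats1 path_end_cat. Qed.

Definition outs v : seq (edge E) := fset_set (out v).

Definition vertices : seq (vertex E) := fset_set [set: vertex E].

Lemma mem_vertices v : finite_set [set: vertex E] -> v \in vertices.
Proof. by move=> fV; rewrite in_fset_set // inE. Qed.

Lemma uniq_vertices : uniq vertices. Proof. exact: fset_uniq. Qed.

Lemma uniq_outs v : uniq (outs v). Proof. exact: fset_uniq. Qed.

Fixpoint paths n v : seq (seq (edge E)) :=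
  if n is n'.+1 then [seq e :: s | e <- outs v, s <- paths n' (rng e)]
  else [:: [::]].

Definition path_count n v w := count (fun s => path_end v s == w) (paths n v).

(** A path is recorded with its source, which its edges determine only if it has any. *)
Definition paths_to n w : seq (vertex E * seq (edge E)) :=
  [seq (v, s) | v <- vertices, s <- [seq s <- paths n v | path_end v s == w]].

Lemma path_countS n v w :
  path_count n.+1 v w = (\sum_(e <- outs v) path_count n (rng e) w)%N.
Proof.
rewrite /path_count /= count_flatten -map_comp sumnE big_map.
by apply: eq_bigr => e _; rewrite /= count_map.
Qed.

Lemma size_paths_to n w :
  size (paths_to n w) = (\sum_(v <- vertices) path_count n v w)%N.
Proof.
rewrite /paths_to size_allpairs_dep sumnE big_map.
by apply: eq_bigr => v _; rewrite size_filter.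
Qed.

Lemma uniq_paths n v : uniq (paths n v).
Proof.
elim: n v => //= n IH v; apply: allpairs_uniq_dep; first exact: uniq_outs.
  by move=> e _; exact: IH.
by move=> [e s] [e' s'] _ _ /= [<- <-].
Qed.

Lemma uniq_paths_to n w : uniq (paths_to n w).
Proof.
apply: allpairs_uniq_dep; first exact: uniq_vertices.
  by move=> v _; rewrite filter_uniq ?uniq_paths.
by move=> [v s] [v' s'] _ _ /= [<- <-].
Qed.

Section RowFinite.
Hypothesis out_fin : forall v, finite_set (out v).

Lemma mem_outs v e : (e \in outs v) = (src e == v).
Proof. by rewrite in_fset_set //; apply/idP/eqP; rewrite inE. Qed.

Lemma mem_paths n v s : (s \in paths n v) = is_path v s && (size s == n).
Proof.
elim: n v s => [|n IH] v [|e s] //=; first by rewrite andbF.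
  by apply/allpairsPdep => -[? [? []]].
apply/allpairsPdep/idP => [[e' [s' [Oe' Ps' [-> ->]]]]|].
  by move: Ps'; rewrite IH -mem_outs Oe' eqSS.
by case/andP=> /andP[se ps] sz; exists e, s; rewrite mem_outs IH se ps.
Qed.

Lemma mem_paths_to n w p : finite_set [set: vertex E] ->
  (p \in paths_to n w) =
    [&& is_path p.1 p.2, size p.2 == n & path_end p.1 p.2 == w].
Proof.
move=> fV; case: p => v s; apply/allpairsPdep/idP => /=.
  by case=> v' [s' [_ + [-> ->]]]; rewrite mem_filter mem_paths => /and3P[-> -> ->].
case/and3P=> ps sz es; exists v, s; split=> //; first exact: mem_vertices.
by rewrite mem_filter es mem_paths ps.
Qed.

End RowFinite.

(** On a cycle without exits the chosen edge is the only one, so there every path is a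
    walk. *)
Section Walk.
Variable nx : vertex E -> edge E.
Hypothesis nxP : forall v, src (nx v) = v.

Definition next v := rng (nx v).

Fixpoint walk v n : seq (edge E) :=
  if n is n'.+1 then nx v :: walk (next v) n' else [::].

Lemma size_walk v n : size (walk v n) = n.
Proof. by elim: n v => //= n IH v; rewrite IH. Qed.

Lemma is_path_walk v n : is_path v (walk v n).
Proof. by elim: n v => //= n IH v; rewrite nxP eqxx IH. Qed.

Lemma path_end_walk v n : path_end v (walk v n) = iter n next v.
Proof. by elim: n v => //= n IH v; rewrite -iterS iterSr -IH. Qed.

Lemma walkD v a b : walk v (a + b) = walk v a ++ walk (iter a next v) b.
Proof. by elim: a v => //= a IH v; rewrite IH -iterS iterSr. Qed.

Lemma src_walk v n : [seq src e | e <- walk v n] = traject next v n.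
Proof. by elim: n v => //= n IH v; rewrite nxP IH. Qed.

End Walk.

(** * Cycles in graphs in which no cycle has an exit *)

Definition cyclic v := exists2 c, is_cycle c & v \in [seq src e | e <- c].

Lemma is_cycle_rot i c : is_cycle (rot i c) = is_cycle c.
Proof.
rewrite /is_cycle rot_cycle map_rot rot_uniq; congr (_ && _).
by rewrite -!size_eq0 size_rot.
Qed.

Lemma chain_path e s :
  path (fun e f : edge E => rng e == src f) e s = is_path (rng e) s.
Proof. by elim: s e => //= f s IH e; rewrite IH eq_sym. Qed.

Lemma is_cycleE e c : is_cycle (e :: c) =
  [&& is_path (src e) (e :: c), path_end (src e) (e :: c) == src e
    & uniq [seq src f | f <- e :: c]].
Proof.
by rewrite /is_cycle /= chain_path is_path_rcons eqxx /= [src e == _]eq_sym -andbA.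
Qed.

(** The induction step in the search for a cycle: a closed path with a repeated source has
    a shorter closed part. *)
Lemma repeated_source v s : is_path v s -> ~~ uniq [seq src e | e <- s] ->
  exists s1 s2 s3, [/\ s = s1 ++ s2 ++ s3, s2 != [::], (size s2 < size s)%N
    & path_end (path_end v s1) s2 = path_end v s1].
Proof.
elim: s v => //= e s IH v /andP[/eqP sv ps]; rewrite negb_and negbK => /orP[|].
  case/mapP=> e' e's see'; case/splitPr: e's ps => a b.
  rewrite is_path_cat /= => /and3P[_ /eqP se' _].
  exists [::], (e :: a), (e' :: b); split=> //=; first by rewrite size_cat /=; lia.
  by rewrite /= -sv see' se'.
case/(IH _ ps) => s1 [s2 [s3 [-> n2 l2 e2]]].
by exists (e :: s1), s2, s3; split=> //; apply: ltnW.
Qed.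

Section NoExit.
Hypothesis ne : no_exit E.
Variable nx : vertex E -> edge E.
Hypothesis nxP : forall v, src (nx v) = v.
Local Notation next := (next nx).
Local Notation walk := (walk nx).

(** Another edge at [v] would be an exit of the cycle through [v]. *)
Lemma cyclic_nx v e : cyclic v -> src e = v -> e = nx v.
Proof.
case=> c cc vc sv; have [_ _ uc] := and3P cc.
have inc f : src f = v -> f \in c.
  move=> sf; apply/negPn/negP => fc; apply: (ne cc).
  by exists f; rewrite sf; split=> //; apply/negP.
have uniq_src x y : x \in c -> y \in c -> src x = src y -> x = y.
  move=> xc yc; case/splitPr: xc uc yc => a b.
  rewrite map_cat mem_cat inE [map _ (_ :: _)]/= -cat1s uniq_catCA cat1s cons_uniq.
  move=> /andP[nx_ab _].
  case/or3P=> [ya|/eqP->//|yb] sxy; case/negP: nx_ab; rewrite -map_cat sxy.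
    by rewrite map_f // mem_cat ya.
  by rewrite map_f // mem_cat yb orbT.
by apply: uniq_src; rewrite ?inc ?nxP.
Qed.

Lemma cycle_walk c v : is_cycle c -> v \in [seq src e | e <- c] ->
  exists i, rot i c = walk v (size c).
Proof.
move=> cc vc; case/mapP: (vc) => e ec ve; exists (index e c).
have walkE s u : is_path u s -> (forall f, f \in s -> f = nx (src f)) ->
    s = walk u (size s).
  elim: s u => //= f s IH u /andP[/eqP sf ps] nxf.
  have fE : f = nx u by rewrite -sf -nxf ?mem_head.
  rewrite -fE -[LHS]/(f :: s) {1}(IH _ ps) // ?{1}fE // => g gs.
  by apply: nxf; rewrite inE gs orbT.
rewrite -(size_rot (index e c) c); apply: walkE.
  move: cc; rewrite -(is_cycle_rot (index e c)) /rot (drop_nth e) ?index_mem //.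
  rewrite nth_index // cat_cons is_cycleE.
  by rewrite -ve => /and3P[].
move=> f; rewrite mem_rot => fc; apply: cyclic_nx => //.
by exists c => //; exact: map_f.
Qed.

Lemma cycle_walkE c v : is_cycle c -> v \in [seq src e | e <- c] ->
  is_cycle (walk v (size c)).
Proof. by move=> cc /(cycle_walk cc)[i <-]; rewrite is_cycle_rot. Qed.

Lemma cycle_iter c v n : is_cycle c -> v \in [seq src e | e <- c] ->
  (iter n next v == v) = (size c %| n)%N.
Proof.
move=> cc vc; have := cycle_walkE cc vc.
have: (0 < size c)%N by case: (c) cc.
case m_eq: (size c) => [|m] // _; set c' := walk v _.
have c'E : c' = nx v :: walk (next v) m by [].
rewrite c'E is_cycleE nxP -c'E src_walk // path_end_walk.
case/and3P=> _ /eqP im um.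
have iq q : iter (q * m.+1) next v = v.
  by elim: q => // q IH; rewrite mulSn iterD IH.
rewrite {1}(divn_eq n m.+1) addnC iterD iq /dvdn; set r := (_ %% _)%N.
have lr : (r < m.+1)%N by rewrite ltn_mod.
have := nth_uniq v _ _ um; rewrite size_traject => /(_ r 0%N lr isT).
by rewrite !nth_traject.
Qed.

Lemma cycle_mem_next c v : is_cycle c -> v \in [seq src e | e <- c] ->
  next v \in [seq src e | e <- c].
Proof.
move=> cc vc; have [i rE] := cycle_walk cc vc.
rewrite -(mem_rot i) -map_rot rE src_walk //.
have im : iter (size c) next v = v by apply/eqP; rewrite (cycle_iter _ cc vc).
case: (size c) im (cycle_walkE cc vc) => [|[|m]] //=; first by move=> ->; rewrite mem_head.
by rewrite !inE eqxx orbT.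
Qed.

Lemma cycle_mem_iter n c v : is_cycle c -> v \in [seq src e | e <- c] ->
  iter n next v \in [seq src e | e <- c].
Proof. by move=> cc vc; elim: n => //= n; exact: cycle_mem_next. Qed.

Lemma cyclic_next v : cyclic v -> cyclic (next v).
Proof. by case=> c cc vc; exists c => //; exact: cycle_mem_next. Qed.

Lemma cyclic_iter v n : cyclic v -> cyclic (iter n next v).
Proof. by move=> cv; elim: n => //= n; exact: cyclic_next. Qed.

Lemma cyclic_path v s : cyclic v -> is_path v s -> s = walk v (size s).
Proof.
elim: s v => //= e s IH v cv /andP[/eqP se ps].
have eE := cyclic_nx cv se; rewrite -eE; congr (_ :: _).
by rewrite {1}(IH _ _ ps) ?eE //; exact: cyclic_next.
Qed.

Lemma cyclic_path_end v s : cyclic v -> is_path v s -> cyclic (path_end v s).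
Proof.
by move=> cv /(cyclic_path cv)->; rewrite path_end_walk; exact: cyclic_iter.
Qed.

(** If [s] is not itself a cycle, a shorter closed part of it meets a cycle by induction,
    and the rest of [s] cannot leave that cycle before it returns to [v]. *)
Lemma closed_cyclic v s : is_path v s -> s != [::] -> path_end v s = v -> cyclic v.
Proof.
have [n] := ubnP (size s); elim: n v s => // n IH v s /ltnSE ln ps s0 es.
case us: (uniq [seq src e | e <- s]).
  case: s s0 ps es us {ln} => // e s _ ps es us.
  have ve : v = src e by case/andP: ps => /eqP.
  by exists (e :: s); [rewrite is_cycleE us -ve ps es eqxx | rewrite /= ve mem_head].
have [s1 [s2 [s3 [sE n2 l2 e2]]]] := repeated_source ps (negbT us).
move: ps es; rewrite sE !is_path_cat !path_end_cat e2 => /and3P[p1 p2 p3] <-.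
by apply: cyclic_path_end p3; apply: IH e2 => //; exact: leq_trans l2 ln.
Qed.

Lemma path_uniq_or_cyclic v s : is_path v s ->
  uniq (v :: [seq rng e | e <- s]) \/ cyclic (path_end v s).
Proof.
elim: s v => [|e s IH] v ps; first by left.
case vs: (v \in [seq rng e | e <- e :: s]); last first.
  case/andP: (ps) => _ /IH [us|]; [left|by right].
  by rewrite cons_uniq vs.
right; case/mapP: vs => f fs vf; case/splitPr: fs ps => a b.
rewrite -cat_rcons is_path_cat path_end_cat => /andP[pa pb].
have ea : path_end v (rcons a f) = v by rewrite path_end_rcons.
rewrite ea in pb *; apply: cyclic_path_end pb; apply: closed_cyclic pa _ ea.
by case: (a).
Qed.

Section FiniteVertices.
Hypothesis fV : finite_set [set: vertex E].

(** By the pigeonhole principle a long path repeats a vertex, hence meets a cycle, which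
    it cannot leave. *)
Lemma long_path_cyclic v s :
  is_path v s -> (size (vertices) <= size s)%N -> cyclic (path_end v s).
Proof.
move=> /path_uniq_or_cyclic[us|//] ls.
have /(uniq_leq_size us) : {subset v :: [seq rng e | e <- s] <= vertices}.
  by move=> w _; exact: mem_vertices.
by rewrite /= size_map ltnNge ls.
Qed.

(** Both cycles are followed for a common multiple of their lengths. *)
Lemma next_inj v w : cyclic v -> cyclic w -> next v = next w -> v = w.
Proof.
move=> [c cc vc] [d cd wd] nvw.
have pc : (0 < size c)%N by case: (c) cc.
have pd : (0 < size d)%N by case: (d) cd.
have /eqP <- : iter (size c * size d) next v == v by rewrite (cycle_iter _ cc vc) dvdn_mulr.
have /eqP <- : iter (size c * size d) next w == w by rewrite (cycle_iter _ cd wd) dvdn_mull.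
by rewrite -(prednK pc) -(prednK pd) mulSn addSn !iterSr nvw.
Qed.

Lemma paths_cyclic n v : (forall u, finite_set (out u)) -> cyclic v ->
  paths n v = [:: walk v n].
Proof.
move=> out_fin cv; apply/perm_small_eq => //.
apply: uniq_perm => // [|s]; first exact: uniq_paths.
rewrite mem_paths // inE; apply/andP/eqP => [[ps /eqP <-]|->].
  exact: cyclic_path.
by rewrite is_path_walk // size_walk.
Qed.

Lemma path_count_cyclic n v w : (forall u, finite_set (out u)) -> cyclic v ->
  path_count n v w = (iter n next v == w).
Proof.
by move=> out_fin cv; rewrite /path_count paths_cyclic //= path_end_walk addn0.
Qed.

Lemma iter_next_inj n v w :
  cyclic v -> cyclic w -> iter n next v = iter n next w -> v = w.
Proof.
move=> cv cw; elim: n => // n IH /= /next_inj nvw; apply: IH.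
by apply: nvw; exact: cyclic_iter.
Qed.

Hypothesis out_fin : forall v, finite_set (out v).

(** Past the length |E^0| every path ends on a cycle, where [w] is the only vertex
    with an edge to [next w]; so these paths are extended by that edge. *)
Lemma path_count_next n v w : cyclic w -> (size vertices <= n)%N ->
  path_count n.+1 v (next w) = path_count n v w.
Proof.
move=> cw ln; rewrite /path_count -!size_filter.
rewrite -(size_map (rcons^~ (nx w)) (filter _ (paths n v))).
apply/perm_size/uniq_perm.
- by rewrite filter_uniq ?uniq_paths.
- by rewrite map_inj_uniq ?filter_uniq ?uniq_paths // => s t /rcons_inj[].
move=> s; rewrite mem_filter mem_paths //; apply/idP/mapP.
  case/lastP: s => [|s e]; first by rewrite andbF.
  rewrite path_end_rcons is_path_rcons size_rcons eqSS => /and3P[/eqP re].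
  case/andP=> ps /eqP se sz.
  have cs : cyclic (path_end v s) by apply: long_path_cyclic; rewrite ?(eqP sz).
  have eE := cyclic_nx cs se; exists s; last first.
    by rewrite eE; congr (rcons _ (nx _)); apply: next_inj => //; rewrite -re eE.
  rewrite mem_filter mem_paths // ps sz !andbT; apply/eqP.
  by apply: next_inj => //; rewrite -re eE.
case=> t; rewrite mem_filter mem_paths // => /and3P[/eqP et pt /eqP zt] ->.
by rewrite path_end_rcons is_path_rcons size_rcons et nxP pt zt !eqxx.
Qed.

Lemma size_paths_to_next n w : cyclic w -> (size vertices <= n)%N ->
  size (paths_to n.+1 (next w)) = size (paths_to n w).
Proof.
move=> cw ln; rewrite !size_paths_to.
by apply: eq_bigr => v _; exact: path_count_next.
Qed.

Lemma path_count_iter k n v w : cyclic w -> (size vertices <= n)%N ->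
  path_count (k + n) v (iter k next w) = path_count n v w.
Proof.
move=> cw ln; elim: k => // k IH; rewrite addSn iterS path_count_next //.
  exact: cyclic_iter.
exact: leq_trans ln (leq_addl _ _).
Qed.

Section Avoiding.
Variables (c : seq (edge E)) (v : vertex E).
Hypotheses (cc : is_cycle c) (vc : v \in [seq src e | e <- c]).
Local Notation m := (size c).

Let cv : cyclic v. Proof. by exists c. Qed.

Let m_gt0 : (0 < m)%N. Proof. by case: (c) cc. Qed.

Lemma iter_cycle q : iter (q * m) next v = v.
Proof. by apply/eqP; rewrite (cycle_iter _ cc vc) dvdn_mull. Qed.

Lemma contains_cycle_walk s t : contains_cycle (s ++ walk v m ++ t) c.
Proof.
have [i ri] := cycle_walk cc vc; exists i; rewrite ri.
by apply/infixP; exists s, t.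
Qed.

(** After |E^0| edges the path is on the cycle; the edges that remain go round it. *)
Lemma long_path_contains w s : is_path w s -> path_end w s = v ->
  (size vertices + m <= size s)%N -> contains_cycle s c.
Proof.
move=> ps es ls; set j := (size s - m)%N.
move: ps es; rewrite -(cat_take_drop j s) is_path_cat path_end_cat => /andP[p1 p2].
set u := path_end w _ in p2 *.
have cu : cyclic u.
  apply: long_path_cyclic => //; rewrite size_takel ?leq_subr //; rewrite /j; lia.
have -> : drop j s = walk u m.
  by rewrite (cyclic_path cu p2) size_drop; congr (walk _ _); rewrite /j; lia.
rewrite path_end_walk => iu; have -> : u = v.
  by apply: (@iter_next_inj m) => //; rewrite iu -{1}(iter_cycle 1) mul1n.
by rewrite -[walk v m]cats0; exact: contains_cycle_walk.
Qed.

(** Every path of length [N] to [v] is obtained from exactly one path avoiding the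
    cycle by going round the cycle at its end. *)
Lemma card_paths_avoiding r N : (size vertices + m <= N)%N -> (N = r %[mod m])%N ->
  (paths_avoiding c v r #= `I_(size (paths_to N v)))%card.
Proof.
move=> lN Nr; pose g (p : vertex E * seq (edge E)) := (p.1, p.2 ++ walk v (N - size p.2)).
have short p : paths_avoiding c v r p -> (size p.2 <= N)%N.
  case=> pp ep av _; rewrite leqNgt; apply/negP => lp; apply: av.
  by apply: long_path_contains pp ep _; lia.
have g_inj : {in paths_avoiding c v r &, injective g}.
  have gle p q : paths_avoiding c v r p -> paths_avoiding c v r q -> g p = g q ->
      (size p.2 <= size q.2)%N -> p = q.
    move=> Ap Aq + lpq; have := short _ Aq; case: p q Ap Aq lpq => [w s] [w' t] /=.
    move=> [/= _ _ _ sr] [/= _ _ at_ tr] lst ltN [<- st].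
    set d := (size t - size s)%N.
    have tE : t = s ++ walk v d.
      move/(congr1 (take (size t))): st; rewrite (take_size_cat _ (erefl (size t))) => <-.
      rewrite take_cat ltnNge lst /= -/d; congr (_ ++ _).
      have -> : (N - size s = d + (N - size t))%N by rewrite /d; lia.
      by rewrite walkD take_size_cat ?size_walk.
    have dm : (m %| d)%N by rewrite -eqn_mod_dvd // tr sr.
    case: (posnP d) => [d0|d_gt0]; first by rewrite tE d0 /= cats0.
    case: at_; rewrite tE -(subnKC (dvdn_leq d_gt0 dm)) walkD.
    exact: contains_cycle_walk.
  move=> p q; rewrite !inE => Ap Aq gpq.
  case/orP: (leq_total (size p.2) (size q.2)) => lpq; first exact: gle.
  by symmetry; exact: gle.
have gE : g @` paths_avoiding c v r = [set` paths_to N v].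
  apply/seteqP; split=> [_ [p Ap <-]|[w p]] /=.
    have lp := short _ Ap; case: Ap => pp ep _ pr.
    rewrite mem_paths_to //= is_path_cat pp ep is_path_walk // size_cat size_walk.
    rewrite subnKC // eqxx path_end_cat ep path_end_walk.
    by rewrite (cycle_iter _ cc vc) -eqn_mod_dvd // Nr pr !eqxx.
  rewrite mem_paths_to //= => /and3P[pp /eqP zp /eqP ep].
  (* The shortest prefix to [v] of the right residue avoids the cycle: a turn inside it
     could be cut out, the rest being forced. *)
  have [|j /and3P[jN /eqP ej /eqP jm] jmin] :=
      @ex_minnP (fun j => [&& (j <= N)%N, path_end w (take j p) == v & j == N %[mod m]]).
    by exists N; rewrite leqnn -zp take_size ep !eqxx.
  have szj : size (take j p) = j by rewrite size_takel ?zp.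
  move: (pp); rewrite -{1}(cat_take_drop j p) is_path_cat ej => /andP[p1 p2].
  exists (w, take j p); last first.
    rewrite /g /= szj; congr (_, _); rewrite -[RHS](cat_take_drop j p).
    by congr (_ ++ _); rewrite (cyclic_path cv p2) size_drop zp.
  split=> //=; last by rewrite szj jm Nr.
  case=> i; move rE: (rot i c) => rc /infixP[s1 [s3 sE]].
  have zrc : size rc = m by rewrite -rE size_rot.
  move: p1 ej szj; rewrite sE !is_path_cat !path_end_cat !size_cat zrc.
  set u := path_end w s1 => /and3P[ps1 pc ps3].
  have uc : u \in [seq src e | e <- c].
    case: rc rE zrc pc {sE ps3} => [_ m0|e s2 rE _ /andP[/eqP <- _]].
      by move: m_gt0; rewrite -m0.
    by rewrite map_f // -(mem_rot i) rE mem_head.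
  have cu : cyclic u by exists c.
  rewrite (cyclic_path cu pc) zrc path_end_walk in ps3 *.
  have iu : iter m next u = u by apply/eqP; rewrite (cycle_iter _ cc uc).
  rewrite iu in ps3 * => e3 sz3.
  suff : (j <= size s1 + size s3)%N.
    by rewrite -sz3 addnCA -{2}[(size s1 + size s3)%N]add0n leq_add2r leqNgt m_gt0.
  have l13 : (size s1 + size s3 <= N)%N.
    by apply: leq_trans jN; rewrite -sz3 leq_add2l leq_addl.
  apply: jmin; apply/and3P; split=> //.
    have pE : p = s1 ++ drop (size s1) p.
      rewrite -[LHS](cat_take_drop (size s1)); congr (_ ++ _).
      by rewrite -[p](cat_take_drop j) sE -catA take_size_cat.
    move: pp; rewrite pE is_path_cat -/u => /andP[_ /(cyclic_path cu) ->].
    rewrite -e3 (cyclic_path cu ps3) size_drop zp.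
    have -> : (N - size s1 = size s3 + (N - size s1 - size s3))%N.
      by move: l13; clear; lia.
    by rewrite walkD catA take_size_cat ?size_cat ?size_walk // path_end_cat.
  by apply/eqP; rewrite -jm -sz3 (addnCA (size s1)) modnDl.
apply: card_eq_trans (_ : _ #= [set` paths_to N v])%card _.
  by rewrite -gE card_eq_sym inj_card_eq.
have -> : [set` paths_to N v] = [set` [fset p in paths_to N v]%fset].
  by apply/seteqP; split=> p /=; rewrite !inE.
apply/card_eq_fsetP; rewrite card_fseq undup_id //; exact: uniq_paths_to.
Qed.

End Avoiding.

End FiniteVertices.
End NoExit.
End Paths.

(** * Eventually constant numbers of paths *)

Section Constancy.
Variable E : graph.
Implicit Types (v w u : vertex E) (e : edge E) (s t c : seq (edge E)).

Hypothesis fV : finite_set [set: vertex E].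
Hypothesis out_fin : forall v, finite_set (out v).
Variable nx : vertex E -> edge E.
Hypothesis nxP : forall v, src (nx v) = v.
Local Notation next := (next nx).
Local Notation walk := (walk nx).

Lemma size_paths_le n v :
  (size (paths n v) <= \sum_(w <- vertices E) size (paths_to n w))%N.
Proof.
have -> : size (paths n v) = (\sum_(w <- vertices E) path_count n v w)%N.
  rewrite -sum1_size; under [RHS]eq_bigr do rewrite /path_count -sum1_count.
  rewrite (exchange_big_dep xpredT) //=; apply: eq_bigr => s _.
  rewrite -big_filter (eq_filter (a2 := pred1 (path_end v s))); last first.
    by move=> w; rewrite /= eq_sym.
  by rewrite filter_pred1_uniq ?uniq_vertices ?mem_vertices // big_seq1.
apply: leq_sum => w _; rewrite size_paths_to.
by rewrite (big_rem v) ?mem_vertices //= leq_addr.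
Qed.

Section Constant.
Variable n0 : nat.
Hypothesis const : forall n v, (n0 <= n)%N -> size (paths_to n.+1 v) = size (paths_to n v).

Lemma constant_size n v : (n0 <= n)%N -> size (paths_to n v) = size (paths_to n0 v).
Proof. by move=> /subnK <-; elim: (n - n0)%N => // k IH; rewrite addSn const ?leq_addl. Qed.

(** If a cycle based at [v] has an exit, each turn round it adds a path from [v], so
    the number of paths from [v] is unbounded. *)
Lemma constant_no_exit : no_exit E.
Proof.
move=> c0 cc0 [e [ec enc]]; set v := src e in ec.
have [c [c0n pc ec' en]] :
    exists c, [/\ c != [::], is_path v c, path_end v c = v & e \notin c].
  case/mapP: ec => f fc vf; exists (rot (index f c0) c0).
  have := cc0; rewrite -(is_cycle_rot (index f c0)).
  move: enc => /negP; rewrite -(mem_rot (index f c0)).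
  rewrite /rot (drop_nth f) ?index_mem // nth_index // cat_cons is_cycleE -vf.
  by move=> en /and3P[-> /eqP -> _]; split=> //; apply/negP.
(* Besides the turns [c] followed by a path, there is a path that starts with the exit. *)
have grows n : (size (paths n v) < size (paths (size c + n) v))%N.
  rewrite -(size_map (cat c)).
  pose e' := e :: walk (rng e) (size c + n).-1.
  apply: (@uniq_leq_size _ (e' :: map (cat c) (paths n v))).
    rewrite cons_uniq map_inj_uniq ?uniq_paths ?andbT; last first.
      by move=> s t /eqP; rewrite eqseq_cat // eqxx => /eqP.
    apply/negP => /mapP[s _]; case: (c) c0n en => // f c' _; rewrite inE => en [ef _].
    by rewrite ef eqxx in en.
  move=> s; rewrite inE mem_paths // => /orP[/eqP->|/mapP[t + ->]].
    rewrite /= eqxx is_path_walk // size_walk prednK ?eqxx //.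
    by case: (c) c0n.
  by rewrite mem_paths // is_path_cat pc ec' size_cat => /andP[-> /eqP ->] /=.
have large k : (k <= size (paths (k * size c + n0) v))%N.
  by elim: k => // k IH; rewrite mulSn -addnA; apply: leq_ltn_trans IH (grows _).
set K := (\sum_(w <- vertices E) size (paths_to n0 w))%N.
have := leq_trans (large K.+1) (size_paths_le _ _).
rewrite (eq_bigr (fun w => size (paths_to n0 w))) ?ltnn // => w _.
by apply: constant_size; rewrite leq_addl.
Qed.

(** Being constant, the number of paths to a vertex of a cycle does not depend on the
    residue of their length; and extending them by an edge of the cycle shows that it
    does not depend on the vertex either. *)
Lemma constant_EDL : EDL E.
Proof.
have ne := constant_no_exit.
move=> c cc; case cE: c (cc) => [//|e0 c'] _; rewrite -cE; set v0 := src e0.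
have m_gt0 : (0 < size c)%N by rewrite cE.
have v0c : v0 \in [seq src e | e <- c] by rewrite cE mem_head.
pose N0 := (n0 + size (vertices E) + size c)%N.
have same v : v \in [seq src e | e <- c] -> forall N, (N0 <= N)%N ->
    size (paths_to N v) = size (paths_to N0 v0).
  move=> vc N lN; rewrite constant_size; last by rewrite /N0 in lN; lia.
  rewrite -(@constant_size N0 v); last by rewrite /N0; lia.
  have [i rE] := cycle_walk ne nxP cc v0c.
  move: vc; rewrite -(mem_rot i) -map_rot rE src_walk // => /trajectP[j _ ->].
  have cv j' : cyclic (iter j' next v0) by apply: cyclic_iter => //; exists c.
  elim: j => // j <-; rewrite iterS -(size_paths_to_next ne nxP fV out_fin (cv j)).
    by rewrite const // /N0; lia.
  by rewrite /N0; lia.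
exists (size (paths_to N0 v0)).
  have pos q : (0 < size (paths_to (q * size c) v0))%N.
    suff: (v0, walk v0 (q * size c)) \in paths_to (q * size c) v0 by case: paths_to.
    by rewrite mem_paths_to //= is_path_walk // size_walk path_end_walk
      (cycle_iter ne nxP _ cc v0c) dvdn_mull ?eqxx.
  by have := pos N0; rewrite same // leq_pmulr.
move=> v vc r rc; pose N := (N0 * size c + r)%N.
have lN : (N0 <= N)%N by rewrite (leq_trans (leq_pmulr N0 m_gt0)) // leq_addr.
rewrite -(same _ vc _ lN); apply: (@card_paths_avoiding _ ne nx) => //.
  by rewrite /N0 in lN; lia.
by rewrite /N modnMDl.
Qed.

End Constant.

Hypothesis ne : no_exit E.

Lemma EDL_size c : EDL E -> is_cycle c -> exists2 k, (0 < k)%N &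
  forall v N, v \in [seq src e | e <- c] -> (size (vertices E) + size c <= N)%N ->
    size (paths_to N v) = k.
Proof.
move=> edl cc; have [k k_gt0 ck] := edl c cc; exists k => // v N vc lN.
have m_gt0 : (0 < size c)%N by case: (c) cc.
have := ck v vc (N %% size c)%N; rewrite ltn_mod => /(_ m_gt0).
rewrite card_eq_sym => kA; have Ac := card_paths_avoiding ne nxP fV out_fin cc vc lN.
have := card_eq_trans kA (Ac (N %% size c)%N (esym (modn_mod _ _))).
by move/card_eq_II ->.
Qed.

(** The base vertices are canonical representatives of the orbits of [next]; a vertex
    determines the base vertex that it reaches, even if it is not on a cycle. *)
Lemma cycle_bases : exists n (base : 'I_n -> vertex E) (m : 'I_n -> nat),
  [/\ forall i, exists c, [/\ is_cycle c, base i \in [seq src e | e <- c] & size c = m i],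
      forall v, cyclic v -> exists i (r : nat), (r < m i)%N /\ iter r next v = base i
    & forall v i j (r s : nat), iter r next v = base i -> iter s next v = base j -> i = j].
Proof.
pose reach v : pred (vertex E) := fun w => `[< exists r : nat, iter r next v = w >].
have reach_refl v : reach v v by apply/asboolP; exists 0%N.
pose rep v := choose (reach v) v.
have repP v : exists r : nat, iter r next v = rep v.
  by apply/asboolP; exact: (chooseP (reach_refl v)).
have back v (r : nat) : cyclic v -> exists s : nat, iter s next (iter r next v) = v.
  case=> c cc vc; exists (r * size c - r)%N.
  have m_gt0 : (0 < size c)%N by case: (c) cc.
  rewrite -iterD subnK ?leq_pmulr //; apply/eqP.
  by rewrite (cycle_iter ne nxP _ cc vc) dvdn_mull.
have rep_iter v (r : nat) : cyclic v -> rep (iter r next v) = rep v.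
  move=> cv; rewrite /rep; set w := iter r next v.
  have rw : reach v =1 reach w.
    move=> u; apply/asboolP/asboolP => -[s us].
      by have [t tv] := back v r cv; exists (s + t)%N; rewrite iterD tv.
    by exists (s + r)%N; rewrite iterD.
  rewrite (eq_choose rw v); apply: choose_id; first exact: reach_refl.
  by rewrite -rw.
pose reps := undup [seq rep v | v <- vertices E & `[< cyclic v >]].
have repsP u : u \in reps -> cyclic u /\ rep u = u.
  rewrite mem_undup => /mapP[v]; rewrite mem_filter => /andP[/asboolP cv _] ->.
  have [r rE] := repP v; rewrite -rE; split; first exact: cyclic_iter.
  by rewrite rep_iter.
have repsC v : cyclic v -> rep v \in reps.
  move=> cv; rewrite mem_undup map_f // mem_filter mem_vertices // andbT.
  exact/asboolP.
pose base i := tnth (in_tuple reps) i.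
have baseP i : cyclic (base i) /\ rep (base i) = base i by apply: repsP; exact: mem_tnth.
have /boolp.choice[m mP] (i : 'I_(size reps)) : exists k, exists c,
    [/\ is_cycle c, base i \in [seq src e | e <- c] & size c = k].
  by have [[c cc bc] _] := baseP i; exists (size c), c.
exists (size reps), base, m; split=> // [v cv|v i j r s vi vj].
  have /tnthP[i vi] : rep v \in in_tuple reps by exact: repsC.
  have [c [cc bc zc]] := mP i; have [r rE] := repP v; exists i, (r %% m i)%N.
  have m_gt0 : (0 < m i)%N by rewrite -zc; case: (c) cc.
  rewrite ltn_mod m_gt0; split=> //; rewrite vi in rE.
  apply: (iter_next_inj ne nxP (n := (r %/ m i * m i)%N)).
  - exact: cyclic_iter.
  - by case: (baseP i).
  rewrite -iterD -divn_eq rE; apply/esym/eqP.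
  by rewrite (cycle_iter ne nxP _ cc bc) zc dvdn_mull.
wlog rs : i j r s vi vj / (r <= s)%N => [hw|].
  by case/orP: (leq_total r s) => h; [exact: hw vi vj h | symmetry; exact: hw vj vi h].
have [ci ri] := baseP i; have [cj rj] := baseP j.
have /tuple_uniqP : uniq (in_tuple reps) by exact: undup_uniq.
apply; rewrite -/(base i) -/(base j) -ri -rj -vj -(subnK rs) iterD vi.
by rewrite rep_iter.
Qed.

End Constancy.

(** * Calculus in Leavitt path algebras *)

Section Calculus.
Variables (K : fieldType) (E : graph).
Local Notation L := (lpa K E).
Implicit Types (v w u : vertex E) (e f : edge E) (s t : seq (edge E)) (x y z : L).
Local Notation "x ** y" := (lpa_mul x y) (at level 40, left associativity).
Local Notation V := (@lpa_vertex K E).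
Local Notation Ed := (@lpa_edge K E).
Local Notation Gh := (@lpa_ghost K E).

Lemma lpa_mul0l x : 0 ** x = 0.
Proof. by apply: (addrI (0 ** x)); rewrite -lpa_mulDl !addr0. Qed.

Lemma lpa_mul0r x : x ** 0 = 0.
Proof. by apply: (addrI (x ** 0)); rewrite -lpa_mulDr !addr0. Qed.

Lemma lpa_mul_suml (I : Type) (r : seq I) (F : I -> L) x :
  (\sum_(i <- r) F i) ** x = \sum_(i <- r) F i ** x.
Proof.
by apply: (big_morph (fun y => y ** x)) => [y z|]; [exact: lpa_mulDl | exact: lpa_mul0l].
Qed.

Lemma lpa_mul_sumr (I : Type) (r : seq I) (F : I -> L) x :
  x ** (\sum_(i <- r) F i) = \sum_(i <- r) x ** F i.
Proof.
by apply: (big_morph (fun y => x ** y)) => [y z|]; [exact: lpa_mulDr | exact: lpa_mul0r].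
Qed.

Lemma lpa_gen_ind (P : L -> Prop) :
  (forall v, P (V v)) -> (forall e, P (Ed e)) -> (forall e, P (Gh e)) ->
  P 0 -> (forall x y, P x -> P y -> P (x + y)) -> (forall a x, P x -> P (a *: x)) ->
  (forall x y, P x -> P y -> P (x ** y)) -> forall x, P x.
Proof.
move=> Pv Pe Pg P0 Pa Ps Pm; elim/lpa_ind; elim=> //.
- by move=> t Pt u Pu; rewrite -lpa_addE; exact: Pa.
- move=> t Pt; rewrite -lpa_oppE; change (P (- lpa_pi t : L)).
  by rewrite -scaleN1r; exact: Ps.
- by move=> a t Pt; rewrite -lpa_scaleE; exact: Ps.
- by move=> t Pt u Pu; rewrite -lpa_mulE; exact: Pm.
Qed.

Lemma lpa_vv v w : V v ** V w = if v == w then V v else 0.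
Proof.
rewrite lpa_mulE; case: eqP => [<-|nvw]; apply/lpa_piP; first exact: LE_vv.
exact: LE_vw.
Qed.

Lemma lpa_ve v e : V v ** Ed e = if src e == v then Ed e else 0.
Proof.
have se : V (src e) ** Ed e = Ed e by rewrite lpa_mulE; apply/lpa_piP/LE_se.
by case: eqP => [<- //|nve]; rewrite -se lpa_mulA lpa_vv eq_sym; case: eqP; rewrite ?lpa_mul0l.
Qed.

Lemma lpa_ev e v : Ed e ** V v = if rng e == v then Ed e else 0.
Proof.
have er : Ed e ** V (rng e) = Ed e by rewrite lpa_mulE; apply/lpa_piP/LE_er.
by case: eqP => [<- //|nve]; rewrite -er -lpa_mulA lpa_vv; case: eqP; rewrite ?lpa_mul0r.
Qed.

Lemma lpa_vg v e : V v ** Gh e = if rng e == v then Gh e else 0.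
Proof.
have rg : V (rng e) ** Gh e = Gh e by rewrite lpa_mulE; apply/lpa_piP/LE_rg.
by case: eqP => [<- //|nve]; rewrite -rg lpa_mulA lpa_vv eq_sym; case: eqP; rewrite ?lpa_mul0l.
Qed.

Lemma lpa_gv e v : Gh e ** V v = if src e == v then Gh e else 0.
Proof.
have gs : Gh e ** V (src e) = Gh e by rewrite lpa_mulE; apply/lpa_piP/LE_gs.
by case: eqP => [<- //|nve]; rewrite -gs -lpa_mulA lpa_vv; case: eqP; rewrite ?lpa_mul0r.
Qed.

Lemma lpa_ge e f : Gh e ** Ed f = if e == f then V (rng e) else 0.
Proof.
rewrite lpa_mulE; case: eqP => [<-|nef]; apply/lpa_piP; first exact: LE_ge.
exact: LE_gf.
Qed.

Lemma lpa_ck v : regular v -> V v = \sum_(e <- outs v) Ed e ** Gh e.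
Proof.
move=> rv; have /lpa_piP := LE_ck K rv; rewrite -/(V v) -/(outs v) => ->.
elim: (outs v) => [|e s IH]; first by rewrite big_nil.
by rewrite big_cons -IH lpa_mulE -[RHS]/(lpa_add _ _) lpa_addE.
Qed.

Local Notation P := (@lpa_path K E).
Local Notation S := (@lpa_path_star K E).

Lemma lpa_vertex_path v s : is_path v s -> V v ** P v s = P v s.
Proof.
case: s => [_|e s /= /andP[/eqP se _]]; first by rewrite lpa_vv eqxx.
by rewrite lpa_mulA lpa_ve se eqxx.
Qed.

Lemma lpa_star_vertex v s : is_path v s -> S v s ** V v = S v s.
Proof.
case: s => [_|e s /= /andP[/eqP se _]]; first by rewrite lpa_vv eqxx.
by rewrite -lpa_mulA lpa_gv se eqxx.
Qed.

Lemma lpa_vertex_path_ne v w s : is_path w s -> v != w -> V v ** P w s = 0.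
Proof.
move=> pw nvw; rewrite -(lpa_vertex_path pw) lpa_mulA lpa_vv (negPf nvw).
by rewrite lpa_mul0l.
Qed.

Lemma lpa_star_vertex_ne v w s : is_path w s -> v != w -> S w s ** V v = 0.
Proof.
move=> pw nvw; rewrite -(lpa_star_vertex pw) -lpa_mulA lpa_vv eq_sym (negPf nvw).
by rewrite lpa_mul0r.
Qed.

Lemma lpa_path_cat v s t : is_path v (s ++ t) ->
  P v (s ++ t) = P v s ** P (path_end v s) t.
Proof.
elim: s v => [|e s IH] v /=; first by move=> pt; rewrite lpa_vertex_path.
by case/andP=> _ pst; rewrite IH // lpa_mulA.
Qed.

Lemma lpa_star_cat v s t : is_path v (s ++ t) ->
  S v (s ++ t) = S (path_end v s) t ** S v s.
Proof.
elim: s v => [|e s IH] v /=; first by move=> pt; rewrite lpa_star_vertex.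
by case/andP=> _ pst; rewrite IH // -lpa_mulA.
Qed.

Lemma lpa_path_end v s : is_path v s -> P v s ** V (path_end v s) = P v s.
Proof. by move=> ps; rewrite -[in RHS](cats0 s) lpa_path_cat ?cats0. Qed.

Lemma lpa_end_star v s : is_path v s -> V (path_end v s) ** S v s = S v s.
Proof. by move=> ps; rewrite -[in RHS](cats0 s) lpa_star_cat ?cats0. Qed.

(** This relation and the next one reduce a product of monomials to a monomial. *)
Lemma lpa_star_path v w s t : is_path v s -> is_path w t -> (size s <= size t)%N ->
  S v s ** P w t = if (v == w) && (take (size s) t == s)
                   then P (path_end v s) (drop (size s) t) else 0.
Proof.
elim: s v w t => [|e s IH] v w t.
  move=> _ pt _; rewrite take0 drop0 eqxx andbT.
  by case: eqVneq => [->|nvw]; [exact: lpa_vertex_path | exact: lpa_vertex_path_ne].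
case: t => // f t /andP[/eqP <- ps] /andP[/eqP <- pt] lst.
rewrite /= -lpa_mulA (lpa_mulA (Gh e)) lpa_ge eqseq_cons [f == e]eq_sym.
case: eqVneq => [ef|nef]; last by rewrite andbF lpa_mul0l lpa_mul0r.
by subst f; rewrite eqxx /= lpa_vertex_path // IH // eqxx.
Qed.

Lemma lpa_star_path_ge v w s t : is_path v s -> is_path w t -> (size t <= size s)%N ->
  S v s ** P w t = if (v == w) && (take (size t) s == t)
                   then S (path_end w t) (drop (size t) s) else 0.
Proof.
elim: t v w s => [|e t IH] v w s.
  move=> ps _ _; rewrite take0 drop0 eqxx andbT.
  case: eqVneq => [<-|nvw]; first exact: lpa_star_vertex.
  by rewrite lpa_star_vertex_ne // eq_sym.
case: s => // f s /andP[/eqP <- ps] /andP[/eqP <- pt] lst.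
rewrite /= -lpa_mulA (lpa_mulA (Gh f)) lpa_ge eqseq_cons.
case: eqVneq => [ef|nef]; last by rewrite andbF lpa_mul0l lpa_mul0r.
by subst f; rewrite eqxx /= lpa_vertex_path // IH // eqxx.
Qed.

Lemma lpa_star_path_eq v w s t : is_path v s -> is_path w t -> size s = size t ->
  S v s ** P w t = if (v == w) && (s == t) then V (path_end v s) else 0.
Proof.
move=> ps pt zst; rewrite lpa_star_path ?zst // take_size drop_size eq_sym.
by rewrite [t == s]eq_sym [w == v]eq_sym.
Qed.

(** The Cuntz-Krieger relation, iterated. *)
Lemma lpa_vertex_paths n v : (forall u, regular u) ->
  V v = \sum_(s <- paths n v) P v s ** S v s.
Proof.
move=> reg; elim: n v => [|n IH] v; first by rewrite big_seq1 /= lpa_vv eqxx.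
rewrite (lpa_ck (reg v)) /= big_allpairs_dep /=; apply: eq_bigr => e _.
have er : Ed e = Ed e ** V (rng e) by rewrite lpa_ev eqxx.
rewrite {1}er (IH (rng e)) lpa_mul_sumr lpa_mul_suml.
by apply: eq_bigr => s _; rewrite !lpa_mulA.
Qed.

Lemma lpa_one : finite_set [set: vertex E] ->
  is_one (A := LPA K E) (\sum_(v <- vertices E) V v).
Proof.
move=> fV.
have one_l v : (\sum_(w <- vertices E) V w) ** V v = V v.
  rewrite lpa_mul_suml (bigD1_seq v) ?mem_vertices ?uniq_vertices //= lpa_vv eqxx.
  by rewrite big1 ?addr0 // => w nwv; rewrite lpa_vv (negPf nwv).
have one_r v : V v ** (\sum_(w <- vertices E) V w) = V v.
  rewrite lpa_mul_sumr (bigD1_seq v) ?mem_vertices ?uniq_vertices //= lpa_vv eqxx.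
  by rewrite big1 ?addr0 // => w nwv; rewrite lpa_vv eq_sym (negPf nwv).
set u := \sum_(v <- _) V v in one_l one_r *.
rewrite /is_one /=; elim/lpa_gen_ind => //=.
- move=> e; split.
    have -> : Ed e = V (src e) ** Ed e by rewrite lpa_ve eqxx.
    by rewrite lpa_mulA one_l.
  have -> : Ed e = Ed e ** V (rng e) by rewrite lpa_ev eqxx.
  by rewrite -lpa_mulA one_r.
- move=> e; split.
    have -> : Gh e = V (rng e) ** Gh e by rewrite lpa_vg eqxx.
    by rewrite lpa_mulA one_l.
  have -> : Gh e = Gh e ** V (src e) by rewrite lpa_gv eqxx.
  by rewrite -lpa_mulA one_r.
- by rewrite lpa_mul0l lpa_mul0r.
- by move=> x y [ux xu] [uy yu]; rewrite lpa_mulDl lpa_mulDr ux xu uy yu.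
- by move=> a x [ux xu]; rewrite -lpa_scaleAl -lpa_scaleAr ux xu.
- by move=> x y [ux xu] [uy yu]; rewrite lpa_mulA ux -lpa_mulA yu.
Qed.

End Calculus.

(** * Representations from branching systems *)

(** Each edge [e] gives a bijection [cs e] from the points at its range onto the points
    whose head is [e], and the points at a regular vertex are exhausted by the heads. So
    edges act by transport along these bijections, up to the weight [z], and the
    Cuntz-Krieger relations hold. *)
Section Representation.
Variables (K : fieldType) (E : graph) (X : Type).
Local Notation F := (ratfun K).
Variables (st : X -> vertex E) (hd : X -> option (edge E)) (tl : X -> X).
Variable cs : edge E -> X -> X.
Variable z : F.
Hypothesis z0 : z != 0.
Hypothesis hdP : forall p e, hd p = Some e ->
  [/\ st p = src e, st (tl p) = rng e & cs e (tl p) = p].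
Hypothesis csP : forall p e, st p = rng e -> hd (cs e p) = Some e /\ tl (cs e p) = p.
Hypothesis hd_regular : forall p, regular (st p) -> hd p != None.

Fixpoint term_act (t : lpa_term K E) (g : X -> F) (p : X) : F :=
  match t with
  | LVertex v => if st p == v then g p else 0
  | LEdge e => if hd p == Some e then z * g (tl p) else 0
  | LGhost e => if st p == rng e then z^-1 * g (cs e p) else 0
  | LZero => 0
  | LAdd t u => term_act t g p + term_act u g p
  | LOpp t => - term_act t g p
  | LScale a t => a *: term_act t g p
  | LMul t u => term_act t (term_act u g) p
  end.

Lemma term_actD t g h p :
  term_act t (fun q => g q + h q) p = term_act t g p + term_act t h p.
Proof.
elim: t g h p => /= [v|e|e||t IHt u IHu|t IH|a t IH|t IHt u IHu] g h p.
- by case: ifP; rewrite ?addr0.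
- by case: ifP; rewrite ?addr0 ?mulrDr.
- by case: ifP; rewrite ?addr0 ?mulrDr.
- by rewrite addr0.
- by rewrite IHt IHu addrACA.
- by rewrite IH opprD.
- by rewrite IH scalerDr.
- by rewrite -IHt; congr term_act; apply/funext => q.
Qed.

Lemma term_actZ t c g p : term_act t (fun q => c * g q) p = c * term_act t g p.
Proof.
elim: t g p => /= [v|e|e||t IHt u IHu|t IH|a t IH|t IHt u IHu] g p.
- by case: ifP; rewrite ?mulr0.
- by case: ifP; rewrite ?mulr0 // mulrCA.
- by case: ifP; rewrite ?mulr0 // mulrCA.
- by rewrite mulr0.
- by rewrite IHt IHu mulrDr.
- by rewrite IH mulrN.
- by rewrite IH scalerAr.
- by rewrite -IHt; congr term_act; apply/funext => q.
Qed.

Lemma term_act_ck v g p : regular v -> (if st p == v then g p else 0) =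
  term_act (lpa_sum [seq LMul (LEdge K e) (LGhost K e) | e <- outs v]) g p.
Proof.
move=> rv; have fv := rv.1.
have -> : forall s, term_act (lpa_sum [seq LMul (LEdge K e) (LGhost K e) | e <- s]) g p =
    \sum_(e <- s) if hd p == Some e then g p else 0.
  elim=> [|e s IH]; rewrite ?big_nil // big_cons -IH /=; congr (_ + _).
  case: (hd p =P Some e) => // /hdP[_ sr cp].
  by rewrite sr eqxx cp mulrA mulfV // mul1r.
case: (st p =P v) => [sv|nsv]; last first.
  rewrite big1_seq // => e /andP[_]; rewrite in_fset_set // inE => se.
  by case: (hd p =P Some e) => // /hdP[sp]; case: nsv; rewrite sp.
have := hd_regular (p := p); rewrite sv => /(_ rv); case hp: (hd p) => [e|] // _.
have [se _ _] := hdP hp.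
rewrite (bigD1_seq e) ?uniq_outs //=; last by rewrite in_fset_set // inE /out /= -sv se.
rewrite eqxx big1 ?addr0 // => f nef; case: eqP => // -[ef].
by rewrite ef eqxx in nef.
Qed.

Lemma term_act_eqv t u : lpa_eqv t u -> term_act t = term_act u.
Proof.
elim=> {t u}; try (by move=> *; congruence);
  try (by move=> *; apply/funext => g; apply/funext => p; rewrite /=; congruence).
- by move=> t u w; apply/funext => g; apply/funext => p /=; rewrite addrA.
- by move=> t u; apply/funext => g; apply/funext => p /=; rewrite addrC.
- by move=> t; apply/funext => g; apply/funext => p /=; rewrite add0r.
- by move=> t; apply/funext => g; apply/funext => p /=; rewrite addNr.
- by move=> a b t; apply/funext => g; apply/funext => p /=; rewrite scalerA.
- by move=> t; apply/funext => g; apply/funext => p /=; rewrite scale1r.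
- by move=> a t u; apply/funext => g; apply/funext => p /=; rewrite scalerDr.
- by move=> a b t; apply/funext => g; apply/funext => p /=; rewrite scalerDl.
- by move=> t u w; apply/funext => g; apply/funext => p.
- by move=> t u w; apply/funext => g; apply/funext => p /=; rewrite -term_actD.
- move=> a t u; apply/funext => g; apply/funext => p /=.
  by rewrite ratfun_scaleE -term_actZ.
- by move=> v; apply/funext => g; apply/funext => p /=; case: eqP.
- move=> v w nvw; apply/funext => g; apply/funext => p /=.
  by case: eqP => // ->; case: eqP.
- move=> e; apply/funext => g; apply/funext => p /=.
  by case: (hd p =P Some e) => [/hdP[-> _ _]|]; rewrite ?eqxx ?if_same.
- move=> e; apply/funext => g; apply/funext => p /=.
  by case: (hd p =P Some e) => // /hdP[_ -> _]; rewrite eqxx.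
- by move=> e; apply/funext => g; apply/funext => p /=; case: eqP.
- move=> e; apply/funext => g; apply/funext => p /=.
  by case: eqP => // /csP[/hdP[-> _ _] _]; rewrite eqxx.
- move=> e; apply/funext => g; apply/funext => p /=.
  by case: eqP => // /csP[-> ->]; rewrite eqxx mulrA mulVf // mul1r.
- move=> e f nef; apply/funext => g; apply/funext => p /=.
  by case: eqP => // /csP[-> _]; case: eqP => [[/nef]|]; rewrite ?mulr0.
- move=> v rv; apply/funext => g; apply/funext => p.
  exact: (@term_act_ck v g p rv).
Qed.

Local Notation L := (lpa K E).

Definition lpa_act (x : L) : (X -> F) -> X -> F := term_act (repr x).

Lemma lpa_act_pi t : lpa_act (lpa_pi t) = term_act t.
Proof. exact/term_act_eqv/lpa_piK. Qed.

Lemma lpa_actD x y g p : lpa_act (x + y) g p = lpa_act x g p + lpa_act y g p.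
Proof. by rewrite -[x + y]/(lpa_add x y) /lpa_add lpa_act_pi. Qed.

Lemma lpa_act0 g p : lpa_act 0 g p = 0.
Proof. by rewrite -[0]/(lpa_zero K E) /lpa_zero lpa_act_pi. Qed.

Lemma lpa_actZ a x g p : lpa_act (a *: x) g p = a *: lpa_act x g p.
Proof. by rewrite -[a *: x]/(lpa_scale a x) /lpa_scale lpa_act_pi. Qed.

Lemma lpa_actM x y g : lpa_act (lpa_mul x y) g = lpa_act x (lpa_act y g).
Proof. by rewrite /lpa_mul lpa_act_pi. Qed.

Lemma lpa_act_sum (I : Type) (r : seq I) (x : I -> L) g p :
  lpa_act (\sum_(i <- r) x i) g p = \sum_(i <- r) lpa_act (x i) g p.
Proof.
by apply: (big_morph (fun y => lpa_act y g p)) => [y y'|];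
  [exact: lpa_actD | exact: lpa_act0].
Qed.

Lemma lpa_act_sumr x (I : Type) (r : seq I) (c : I -> F) (g : I -> X -> F) p :
  lpa_act x (fun q => \sum_(i <- r) c i * g i q) p = \sum_(i <- r) c i * lpa_act x (g i) p.
Proof.
elim: r => [|i r IH].
  rewrite big_nil; under eq_fun do rewrite big_nil -(mul0r 0).
  by rewrite /lpa_act term_actZ mul0r.
rewrite big_cons -IH -term_actZ -term_actD; congr term_act.
by apply/funext => q; rewrite big_cons.
Qed.

Fixpoint follows p s : bool :=
  if s is e :: s' then (hd p == Some e) && follows (tl p) s' else true.

Lemma lpa_act_path v s g p : is_path v s ->
  lpa_act (lpa_path K v s) g p =
    if (st p == v) && follows p s then z ^+ size s * g (iter (size s) tl p) else 0.
Proof.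
elim: s v g p => [|e s IH] v g p /=.
  by move=> _; rewrite lpa_act_pi /= andbT expr0 mul1r.
case/andP=> /eqP <- ps; rewrite lpa_actM lpa_act_pi /= IH //.
case: (hd p =P Some e) => [/hdP[-> -> _]|_]; rewrite ?andbF //= !eqxx /= -iterS iterSr.
by case: ifP; rewrite ?mulr0 // exprS mulrA.
Qed.

(** Prepending a path leads to the only point that starts with it and continues with
    [p]. *)
Lemma follows_cs s v p : is_path v s -> st p = path_end v s ->
  [/\ st (foldr cs p s) = v, follows (foldr cs p s) s &
      iter (size s) tl (foldr cs p s) = p].
Proof.
elim: s v => [|e s IH] v //= /andP[/eqP <- ps] ep.
have [sr fs it] := IH _ ps ep; have [hc tc] := csP sr.
have [sc _ _] := hdP hc.
by rewrite -iterS iterSr tc hc eqxx.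
Qed.

Lemma lpa_act_star v s g p : is_path v s ->
  lpa_act (lpa_path_star K v s) g p =
    if st p == path_end v s then z^-1 ^+ size s * g (foldr cs p s) else 0.
Proof.
elim: s v g p => [|e s IH] v g p /=.
  by move=> _; rewrite lpa_act_pi /= expr0 mul1r.
case/andP=> _ ps; rewrite lpa_actM IH // -[path_end v (e :: s)]/(path_end (rng e) s).
case: eqP => // ep; have [sr _ _] := follows_cs ps ep.
by rewrite lpa_act_pi /= sr eqxx exprSr mulrA.
Qed.

End Representation.

(** Every vertex is nonzero, for it acts as a nonzero operator. The points are triples of
    a vertex, a word in the edges and a natural number: the word makes room for a copy of
    the points at the range of each edge when there are infinitely many edges, and the
    number does so, by division with remainder, when the edges at a regular vertex must
    exhaust its points. *)
Lemma lpa_functional (K : fieldType) (E : graph) (v : vertex E) :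
  exists phi : lpa K E -> ratfun K, linear phi /\ phi (lpa_vertex K v) = 1.
Proof.
pose X := (vertex E * seq (edge E) * nat)%type.
pose reg (w : vertex E) := `[< regular w >].
pose hd (p : X) : option (edge E) :=
  if reg p.1.1 then ohead (drop (p.2 %% size (outs p.1.1)) (outs p.1.1))
  else if p.1.2 is e :: _ then if src e == p.1.1 then Some e else None else None.
pose tl (p : X) : X :=
  if hd p is Some e then
    if reg p.1.1 then ((rng e, p.1.2), (p.2 %/ size (outs p.1.1))%N)
    else ((rng e, behead p.1.2), p.2)
  else p.
pose cs (e : edge E) (p : X) : X :=
  if reg (src e) then
    ((src e, p.1.2), (p.2 * size (outs (src e)) + index e (outs (src e)))%N)
  else ((src e, e :: p.1.2), p.2).
pose st (p : X) : vertex E := p.1.1.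
have out_reg w e : regular w -> (e \in outs w) = (src e == w).
  by case=> fw _; rewrite in_fset_set //; apply/idP/eqP; rewrite inE.
have hdP p e : hd p = Some e ->
    [/\ st p = src e, st (tl p) = rng e & cs e (tl p) = p].
  case: p => [[w l] n] hp; have tE : tl (w, l, n) =
      if reg w then ((rng e, l), (n %/ size (outs w))%N) else ((rng e, behead l), n).
    by rewrite /tl hp.
  move: hp; rewrite tE /hd /cs /= {tE}; case: ifPn => [rw|nrw].
    have /asboolP rw' := rw; set i := (n %% _)%N => hp.
    have li : (i < size (outs w))%N.
      by rewrite ltnNge; apply/negP => /drop_oversize d; rewrite d in hp.
    have [eE] : Some (nth e (outs w) i) = Some e by rewrite -hp (drop_nth e).
    have sw : src e = w by apply/eqP; rewrite -out_reg // -eE mem_nth.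
    have ie : index e (outs w) = i by rewrite -eE index_uniq ?uniq_outs.
    by rewrite sw rw ie -divn_eq.
  case: l => // e' l /=; case: (src e' =P w) => // sw [ee']; subst e'.
  by rewrite sw (negPf nrw).
have csP p e : st p = rng e -> hd (cs e p) = Some e /\ tl (cs e p) = p.
  case: p => [[w l] n]; rewrite /st /= => ->; suff hc : hd (cs e (rng e, l, n)) = Some e.
    split=> //; rewrite /tl hc /cs; case: (boolP (reg (src e))) => re /=; last first.
      by rewrite (negPf re).
    have /asboolP re' := re; have eo : e \in outs (src e) by rewrite out_reg.
    have k_gt0 : (0 < size (outs (src e)))%N by case: (outs _) eo.
    by rewrite re /= divnMDl // divn_small ?addn0 // index_mem.
  rewrite /cs /hd; case: (boolP (reg (src e))) => re /=; last first.
    by rewrite (negPf re) eqxx.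
  have /asboolP re' := re; have eo : e \in outs (src e) by rewrite out_reg.
  by rewrite re /= modnMDl modn_small ?index_mem // (drop_nth e) ?index_mem //= nth_index.
have hd_reg p : regular (st p) -> hd p != None.
  case: p => [[w l] n]; rewrite /st /= => rw; rewrite /hd /= /reg asboolT //.
  have [e sw] := rw.2; have eo : e \in outs w by rewrite out_reg // sw.
  have k_gt0 : (0 < size (outs w))%N by case: (outs _) eo.
  by rewrite (drop_nth e) ?ltn_mod.
pose phi (x : lpa K E) : ratfun K := lpa_act st hd tl cs 1 x (fun=> 1) ((v, [::]), 0%N).
exists phi; split=> [a x y|].
  by rewrite /phi (lpa_actD (oner_neq0 _) hdP csP hd_reg)
             (lpa_actZ (oner_neq0 _) hdP csP hd_reg).
by rewrite /phi (lpa_act_pi (oner_neq0 _) hdP csP hd_reg) /= eqxx.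
Qed.

(** * Invertible elements of degree one *)

Section DegreeOne.
Variables (K : fieldType) (E : graph).
Local Notation L := (lpa K E).
Implicit Types (v w u : vertex E) (e f : edge E) (s t : seq (edge E)) (x y z : L).
Local Notation "x ** y" := (lpa_mul x y) (at level 40, left associativity).
Local Notation V := (@lpa_vertex K E).
Local Notation Ed := (@lpa_edge K E).
Local Notation Gh := (@lpa_ghost K E).
Local Notation P := (@lpa_path K E).
Local Notation S := (@lpa_path_star K E).

Lemma lpa_vertex_neq0 v : V v != 0.
Proof.
have [phi [phiL phiv]] := lpa_functional K v; apply/eqP => v0.
have := phiL (-1) 0 0; rewrite scaler0 addr0 scaleN1r addNr -v0 phiv => /eqP.
by rewrite oner_eq0.
Qed.

Lemma lpa_comp_ind n (Q : L -> Prop) : Q 0 -> (forall x y, Q x -> Q y -> Q (x + y)) ->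
  (forall a x, Q x -> Q (a *: x)) -> (forall x, lpa_monomial n x -> Q x) ->
  forall x, lpa_comp n x -> Q x.
Proof.
move=> Q0 QD QZ Qm x [l lm ->]; rewrite big_seq_cond.
by apply: (big_ind Q) => // y /andP[/lm/Qm/QZ].
Qed.

Lemma lpa_comp_sum d (I : Type) (r : seq I) (y : I -> L) :
  (forall i, lpa_comp d (y i)) -> lpa_comp d (\sum_(i <- r) y i).
Proof.
move=> yd; elim: r => [|i r [l ld lE]]; first by rewrite big_nil; exists [::]; rewrite ?big_nil.
have [l' ld' lE'] := yd i; exists (l' ++ l); last by rewrite big_cons big_cat lE lE'.
by move=> x; rewrite mem_cat => /orP[/ld'|/ld].
Qed.

Lemma lpa_compZ d (c : K) (y : L) : lpa_comp d y -> lpa_comp d (c *: y).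
Proof.
case=> l ld ->; exists [seq (c * k.1, k.2) | k <- l]; last first.
  by rewrite big_map scaler_sumr; apply: eq_bigr => k _; rewrite scalerA.
by move=> _ /mapP[k /ld kd ->].
Qed.

Lemma lpa_left_support x : exists l : seq (vertex E), forall w, w \notin l -> V w ** x = 0.
Proof.
elim/lpa_gen_ind: x => [v|e|e||x y [lx Ix] [ly Iy]|a x [l Il]|x y [l Il] _].
- by exists [:: v] => w; rewrite inE lpa_vv => /negPf->.
- by exists [:: src e] => w; rewrite inE lpa_ve eq_sym => /negPf->.
- by exists [:: rng e] => w; rewrite inE lpa_vg eq_sym => /negPf->.
- by exists [::] => w _; rewrite lpa_mul0r.
- exists (lx ++ ly) => w; rewrite mem_cat negb_or => /andP[/Ix wx /Iy wy].
  by rewrite lpa_mulDr wx wy addr0.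
- by exists l => w /Il wx; rewrite -lpa_scaleAr wx scaler0.
- by exists l => w /Il wx; rewrite lpa_mulA wx lpa_mul0l.
Qed.

(** A monomial of positive degree starts with an edge. *)
Lemma lpa_comp1_sink v x : sink v -> lpa_comp 1 x -> V v ** x = 0.
Proof.
move=> sv; elim/lpa_comp_ind.
- by rewrite lpa_mul0r.
- by move=> y z vy vz; rewrite lpa_mulDr vy vz addr0.
- by move=> a y vy; rewrite -lpa_scaleAr vy scaler0.
move=> _ [u [s [w [t [_ _ st ->]]]]]; case: s st => [|e s] /= st; first by lia.
rewrite !lpa_mulA lpa_ve; case: eqP => [se|_]; last by rewrite !lpa_mul0l.
by have : out v e by []; rewrite sv.
Qed.

Lemma lpa_comp1_ghost x : lpa_comp 1 x ->
  exists l : seq (edge E), forall e, e \notin l -> Gh e ** x = 0.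
Proof.
elim/lpa_comp_ind.
- by exists [::] => e _; rewrite lpa_mul0r.
- move=> y z [ly Iy] [lz Iz]; exists (ly ++ lz) => e.
  by rewrite mem_cat negb_or lpa_mulDr => /andP[/Iy -> /Iz ->]; rewrite addr0.
- by move=> a y [l Il]; exists l => e /Il ey; rewrite -lpa_scaleAr ey scaler0.
move=> _ [u [s [w [t [_ _ st ->]]]]]; case: s st => [|f s] /= st; first by lia.
exists [:: f] => e; rewrite inE => /negPf nef.
by rewrite !lpa_mulA lpa_ge nef !lpa_mul0l.
Qed.

(** The unit is a finite combination of monomials, so it kills almost all vertices if
    there are infinitely many. An invertible element [a] of degree one satisfies [v a = 0]
    at a sink [v], and [e^* a = 0] for all but finitely many edges [e]; neither a vertex
    nor a ghost edge is zero. *)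
Lemma crossed_finite_regular : crossed_product (LPA K E) ->
  finite_set [set: vertex E] /\ forall v, regular v.
Proof.
move=> [u u1 cp]; have [a /= a1 [b [/= ab _]]] := cp 1.
have ux x : x ** u = x := (u1 x).2.
have nz x : x ** a ** b = x by rewrite -lpa_mulA ab.
split.
  have [l Il] := lpa_left_support u.
  apply: (@sub_finite_set _ _ [set` l]); last exact: finite_seq.
  move=> v _ /=; apply/negPn/negP => /Il vu; have := lpa_vertex_neq0 v.
  by rewrite -[V v]ux vu eqxx.
move=> v; split; last first.
  apply/set0P/negP => /eqP sv; have := lpa_vertex_neq0 v.
  by rewrite -[V v]nz lpa_comp1_sink // lpa_mul0l eqxx.
apply: contrapT => iv; have [l Il] := lpa_comp1_ghost a1.
have [e [ve /negP el]] : (out v `\` [set` l]) !=set0.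
  by apply: infinite_setN0; apply: infinite_setD => //; exact: finite_seq.
have := lpa_vertex_neq0 (rng e); have := lpa_ge K e e; rewrite eqxx => <-.
by rewrite -[Gh e]nz Il // !lpa_mul0l eqxx.
Qed.

(** For [N >= size t] a monomial [s t^*] of degree one turns into [p1^* q1] with paths [p1]
    and [q1] of equal length, which is a vertex or zero. *)
Lemma lpa_comp1_coef x : lpa_comp 1 x -> exists N0, forall N, (N0 <= N)%N ->
  forall v p w q, is_path v p -> is_path w q -> size p = N.+1 -> size q = N ->
  exists2 c : K, S v p ** x ** P w q = c *: V (path_end v p)
    & path_end v p <> path_end w q -> c = 0.
Proof.
elim/lpa_comp_ind.
- exists 0%N => N _ v p w q _ _ _ _; exists 0 => //.
  by rewrite lpa_mul0r lpa_mul0l scale0r.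
- move=> y z [Ny Iy] [Nz Iz]; exists (maxn Ny Nz) => N; rewrite geq_max.
  case/andP=> /Iy + /Iz + v p w q pp pq zp zq.
  case/(_ v p w q pp pq zp zq) => c yc c0 /(_ v p w q pp pq zp zq)[d zd d0].
  exists (c + d); first by rewrite lpa_mulDr lpa_mulDl yc zd scalerDl.
  by move=> ne; rewrite c0 // d0 // addr0.
- move=> a y [Ny Iy]; exists Ny => N lN v p w q pp pq zp zq.
  have [c yc c0] := Iy N lN v p w q pp pq zp zq; exists (a * c).
    by rewrite -lpa_scaleAr -lpa_scaleAl yc scalerA.
  by move=> /c0 ->; rewrite mulr0.
move=> _ [v0 [s [w0 [t [ps pt st ->]]]]]; exists (size t) => N lN v p w q pp pq zp zq.
have zs : size s = (size t).+1 by lia.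
rewrite lpa_mulA -lpa_mulA lpa_star_path_ge ?zs ?zp // lpa_star_path ?zq //.
case: (v =P v0) => [vE|_] /=; last by exists 0; rewrite ?scale0r ?lpa_mul0l.
case: eqP => [ts|_] /=; last by exists 0; rewrite ?scale0r ?lpa_mul0l.
case: (w0 =P w) => [wE|_] /=; last by exists 0; rewrite ?scale0r ?lpa_mul0r.
case: eqP => [tt|_] /=; last by exists 0; rewrite ?scale0r ?lpa_mul0r.
subst v0 w0; set p1 := drop _ p; set q1 := drop _ q.
have pE : p = s ++ p1 by rewrite -ts cat_take_drop.
have qE : q = t ++ q1 by rewrite -tt cat_take_drop.
move: pp pq; rewrite pE qE !is_path_cat !path_end_cat => /andP[_ pp1] /andP[_ pq1].
rewrite lpa_star_path_eq //; last first.
  by move: zp zq; rewrite pE qE !size_cat zs; lia.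
case: ifP => [/andP[/eqP -> /eqP ->]|_]; first by exists 1; rewrite ?scale1r.
by exists 0; rewrite ?scale0r.
Qed.

Lemma lpa_mul_paths N x y : finite_set [set: vertex E] -> (forall v, regular v) ->
  x ** y = \sum_(w <- vertices E) \sum_(q <- paths N w) (x ** P w q) ** (S w q ** y).
Proof.
move=> fV reg; have x1 : x ** \sum_(v <- vertices E) V v = x := (@lpa_one K E fV x).2.
rewrite -{1}x1 lpa_mul_sumr lpa_mul_suml.
apply: eq_bigr => w _; rewrite (lpa_vertex_paths K N w reg) lpa_mul_sumr lpa_mul_suml.
by apply: eq_bigr => q _; rewrite !lpa_mulA.
Qed.

(** An invertible element of degree one gives, for each [v], mutually inverse matrices
    indexed by the paths to [v] of two consecutive lengths. The entries of the inverse
    are read off by a functional that is 1 on [v], so it need not be homogeneous. *)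
Lemma crossed_constant : crossed_product (LPA K E) ->
  exists n0, forall n v, (n0 <= n)%N -> size (paths_to n.+1 v) = size (paths_to n v).
Proof.
move=> cp; have [fV reg] := crossed_finite_regular cp.
have out_fin v : finite_set (out v) := (reg v).1.
have [u u1 /(_ 1) [a /= a1 [b [/= ab ba]]]] := cp.
have [n0 coef] := lpa_comp1_coef a1; exists n0 => N v /coef {}coef.
have [phi [phiL phiv]] := lpa_functional K v.
have phi0 : phi 0 = 0.
  by have := phiL (-1) 0 0; rewrite scaler0 addr0 scaleN1r addNr.
have phiD x y : phi (x + y) = phi x + phi y by have := phiL 1 x y; rewrite !scale1r.
have phiZ c x : phi (c *: x) = c *: phi x by have := phiL c x 0; rewrite phi0 !addr0.
have phi_sum (I : Type) (r : seq I) (F : I -> L) :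
    phi (\sum_(i <- r) F i) = \sum_(i <- r) phi (F i).
  exact: (big_morph phi phiD phi0).
pose p1 (i : 'I_(size (paths_to N.+1 v))) := tnth (in_tuple (paths_to N.+1 v)) i.
pose p0 (j : 'I_(size (paths_to N v))) := tnth (in_tuple (paths_to N v)) j.
have p1P i : [/\ is_path (p1 i).1 (p1 i).2, size (p1 i).2 = N.+1
                & path_end (p1 i).1 (p1 i).2 = v].
  have := mem_tnth i (in_tuple (paths_to N.+1 v)).
  by rewrite mem_paths_to // => /and3P[? /eqP ? /eqP].
have p0P j : [/\ is_path (p0 j).1 (p0 j).2, size (p0 j).2 = N
                & path_end (p0 j).1 (p0 j).2 = v].
  have := mem_tnth j (in_tuple (paths_to N v)).
  by rewrite mem_paths_to // => /and3P[? /eqP ? /eqP].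
have ux x : u ** x = x := (u1 x).1.
have S0 j : V v ** S (p0 j).1 (p0 j).2 = S (p0 j).1 (p0 j).2.
  by have [pp _ <-] := p0P j; exact: lpa_end_star.
have P1 i : P (p1 i).1 (p1 i).2 ** V v = P (p1 i).1 (p1 i).2.
  by have [pp _ <-] := p1P i; exact: lpa_path_end.
have delta n w p w' p' : (w, p) \in paths_to n v -> (w', p') \in paths_to n v ->
    phi (S w p ** P w' p') = ((w, p) == (w', p'))%:R.
  rewrite !mem_paths_to //= => /and3P[pp /eqP zp /eqP ep] /and3P[pp' /eqP zp' /eqP ep'].
  by rewrite lpa_star_path_eq ?zp ?zp' // xpair_eqE ep; case: ifP.
have /boolp.choice[cf cfP] (ij : 'I_(size (paths_to N.+1 v)) * 'I_(size (paths_to N v))) :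
    exists c : K, S (p1 ij.1).1 (p1 ij.1).2 ** a ** P (p0 ij.2).1 (p0 ij.2).2 = c *: V v.
  have [pp zp ep] := p1P ij.1; have [pq zq _] := p0P ij.2.
  by have [c cE _] := coef _ _ _ _ pp pq zp zq; exists c; rewrite cE ep.
pose C := \matrix_(i, j) ((cf (i, j))%:A : ratfun K).
pose B := \matrix_(j, i) phi (S (p0 j).1 (p0 j).2 ** b ** P (p1 i).1 (p1 i).2).
have sum_ends n x y : (forall w q, is_path w q -> size q = n -> path_end w q <> v ->
      (x ** P w q) ** (S w q ** y) = 0) ->
    x ** y = \sum_(q <- paths_to n v) (x ** P q.1 q.2) ** (S q.1 q.2 ** y).
  move=> other; rewrite (lpa_mul_paths n x y fV reg) /paths_to [RHS]big_allpairs_dep /=.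
  apply: eq_bigr => w _.
  rewrite big_filter [RHS]big_mkcond; apply: eq_big_seq => q.
  rewrite mem_paths // => /andP[pq /eqP zq]; case: eqP => // nv.
  exact: other.
have CB : C *m B = 1%:M.
  apply/matrixP => i i'; rewrite !mxE.
  have [pp zp ep] := p1P i; have [pp' zp' ep'] := p1P i'.
  have -> : (i == i')%:R = phi (S (p1 i).1 (p1 i).2 ** a ** (b ** P (p1 i').1 (p1 i').2)).
    rewrite -lpa_mulA (lpa_mulA a) ab ux (@delta N.+1); last 2 first.
    - by have := mem_tnth i (in_tuple (paths_to N.+1 v)); rewrite -/(p1 i); case: (p1 i).
    - by have := mem_tnth i' (in_tuple (paths_to N.+1 v)); rewrite -/(p1 i'); case: (p1 i').
    rewrite -!surjective_pairing; congr (nat_of_bool _)%:R; apply/eqP/eqP => [->//|].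
    by have /tuple_uniqP := uniq_paths_to N.+1 v : uniq (in_tuple _); exact.
  rewrite (sum_ends N); last first.
    move=> w q pq zq nv; have [c cE c0] := coef _ _ _ _ pp pq zp zq.
    by rewrite cE c0 ?scale0r ?lpa_mul0l // ep => /esym.
  rewrite phi_sum [RHS]big_tnth; apply: eq_bigr => j _.
  rewrite !mxE -/(p0 j) (cfP (i, j)) -lpa_scaleAl phiZ mulr_algl.
  by rewrite !lpa_mulA S0.
have BC : B *m C = 1%:M.
  apply/matrixP => j j'; rewrite !mxE.
  have [pp zp ep] := p0P j; have [pp' zp' ep'] := p0P j'.
  have -> : (j == j')%:R = phi (S (p0 j).1 (p0 j).2 ** b ** (a ** P (p0 j').1 (p0 j').2)).
    rewrite -lpa_mulA (lpa_mulA b) ba ux (@delta N); last 2 first.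
    - by have := mem_tnth j (in_tuple (paths_to N v)); rewrite -/(p0 j); case: (p0 j).
    - by have := mem_tnth j' (in_tuple (paths_to N v)); rewrite -/(p0 j'); case: (p0 j').
    rewrite -!surjective_pairing; congr (nat_of_bool _)%:R; apply/eqP/eqP => [->//|].
    by have /tuple_uniqP := uniq_paths_to N v : uniq (in_tuple _); exact.
  rewrite (sum_ends N.+1); last first.
    move=> w q pq zq nv; have [c cE c0] := coef _ _ _ _ pq pp' zq zp'.
    by rewrite (lpa_mulA (S w q)) cE c0 ?scale0r ?lpa_mul0r // ep'.
  rewrite phi_sum [RHS]big_tnth; apply: eq_bigr => i _.
  rewrite !mxE -/(p1 i) (lpa_mulA (S _ _) a) (cfP (i, j')) -lpa_scaleAr phiZ mulr_algr.
  by rewrite -!lpa_mulA P1.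
by apply/eqP; rewrite eqn_leq (mulmx1_min CB) (mulmx1_min BC).
Qed.

Section Central.
Hypothesis ne : no_exit E.
Variable nx : vertex E -> edge E.
Hypothesis nxP : forall v, src (nx v) = v.
Local Notation next := (next nx).

(** Two paths out of [v] with the same end have lengths that agree modulo the length of
    the cycle, so there is nothing in degree one. *)
Lemma lpa_comp1_corner c v x : is_cycle c -> v \in [seq src e | e <- c] ->
  size c != 1%N -> lpa_comp 1 x -> V v ** x ** V v = 0.
Proof.
move=> cc vc c1; elim/lpa_comp_ind.
- by rewrite lpa_mul0r lpa_mul0l.
- by move=> y z vy vz; rewrite lpa_mulDr lpa_mulDl vy vz addr0.
- by move=> a y vy; rewrite -lpa_scaleAr -lpa_scaleAl vy scaler0.
move=> _ [w [s [w' [t [ps pt st ->]]]]]; rewrite -!lpa_mulA (lpa_mulA (V v)).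
case: (eqVneq v w) => [vw|nvw]; last by rewrite lpa_vertex_path_ne // lpa_mul0l.
case: (eqVneq v w') => [vw'|nvw']; last by rewrite lpa_star_vertex_ne // lpa_mul0r.
subst w w'; rewrite lpa_vertex_path // lpa_star_vertex //.
rewrite -(lpa_path_end K ps) -(lpa_end_star K pt) lpa_mulA -(lpa_mulA (P _ _) (V _) (V _)) lpa_vv.
case: eqP => [ee|_]; last by rewrite lpa_mul0r lpa_mul0l.
have cv : cyclic v by exists c.
move: ee; rewrite (cyclic_path ne nxP cv ps) (cyclic_path ne nxP cv pt) !path_end_walk.
have -> : size s = (size t).+1 by lia.
rewrite iterSr => /(iter_next_inj ne nxP (cyclic_next ne nxP cv) cv)/eqP.
by rewrite -[next v]/(iter 1 next v) (cycle_iter ne nxP _ cc vc) dvdn1 (negPf c1).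
Qed.

(** The image of 1 under the splitting commutes with the vertices, which have degree 0, so
    its corner at [v] is invertible there and cannot vanish. *)
Lemma group_ring_loops (c : seq (edge E)) : group_ring (LPA K E) -> is_cycle c -> size c = 1%N.
Proof.
move=> [_ [u [sigma [u1 [sig_inv _] central]]]] cc; apply/eqP/negPn/negP => c1.
case cE: c (cc) => [//|e c'] _; set v := src e.
have vc : v \in [seq src e | e <- c] by rewrite cE mem_head.
have [s1 [b [/= sb bs]]] := sig_inv 1.
have v0 : lpa_comp 0 (V v).
  exists [:: (1, V v)]; last by rewrite big_seq1 scale1r.
  move=> x; rewrite inE => /eqP ->; exists v, [::], v, [::]; split=> //=.
  by rewrite lpa_vv eqxx.
have vs : V v ** sigma 1 = sigma 1 ** V v.
  rewrite -{1}(central 1 b _ (conj sb bs) v0) /= -!lpa_mulA bs; congr (_ ** _).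
  exact: (u1 _).2.
have := lpa_vertex_neq0 v; rewrite -[V v](u1 _).2 /= -sb lpa_mulA.
have -> : V v ** sigma 1 = V v ** sigma 1 ** V v.
  by rewrite -lpa_mulA -vs lpa_mulA lpa_vv eqxx.
by rewrite (lpa_comp1_corner cc vc) // lpa_mul0l eqxx.
Qed.

End Central.

End DegreeOne.

(** * Invariants of the graph monoid *)

Section MonoidInvariants.
Variable E : graph.
Implicit Types (v w : vertex E) (e : edge E).
Local Open Scope mset_scope.
Local Notation gen := (gm_gen E).

Section Weight.
Variable A : nmodType.
Variable f : int * gen -> A.

Definition weight (a : gm_free E) : A := \sum_(y <- enum_mset a) f y.

Lemma weight_seq s : weight (seq_mset s) = \sum_(y <- s) f y.
Proof. exact/perm_big/perm_eq_seq_mset. Qed.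

Lemma seq_msetD (a b : gm_free E) : a `+` b = seq_mset (enum_mset a ++ enum_mset b).
Proof. by apply/msetP => y; rewrite mset_seqE count_cat !count_mem_mset msetE2. Qed.

Lemma weightD a b : weight (a `+` b) = weight a + weight b.
Proof. by rewrite seq_msetD weight_seq big_cat. Qed.

Lemma weight1 y : weight [mset y] = f y.
Proof. by rewrite /weight enum_msetn big_seq1. Qed.

Lemma weight_ranges n Z :
  weight (gm_ranges n Z) = \sum_(e <- Z) f (n, inl (rng e)).
Proof. by rewrite weight_seq big_map. Qed.

End Weight.

Lemma weight_shift (A : nmodType) (f : int * gen -> A) n a :
  weight f (gm_shift n a) = weight (fun y => f (n + y.1, y.2)) a.
Proof. by rewrite weight_seq big_map. Qed.

Lemma weight_eqv (A : nmodType) (f : int * gen -> A) a b :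
  (forall c d, gm_step c d -> weight f c = weight f d) -> gm_eqv a b ->
  weight f a = weight f b.
Proof.
move=> fs; elim=> {a b} [a b /fs|a|a b _ IH|a b c _ IHab _ IHbc] //.
by rewrite IHab.
Qed.

(** The solution of the recurrence that the defining relations of the graph monoid
    impose on an additive function that is 1, in degree 0, at each vertex that is not
    regular. *)
Fixpoint exit_count k v : nat :=
  if `[< regular v >] then
    if k is k'.+1 then (\sum_(e <- outs v) exit_count k' (rng e))%N else 0%N
  else (k == 0)%N.

Definition exit_weight_vertex (n : int) v : int :=
  if n is Posz n'.+1 then 0 else (exit_count (absz n) v)%:Z.

Definition exit_weight (y : int * gen) : int :=
  match y.2 with
  | inl v => exit_weight_vertex y.1 v
  | inr Z => (y.1 == 0)%:Z - \sum_(e <- val Z) exit_weight_vertex (y.1 + 1) (rng e)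
  end.

Lemma exit_weight_irregular n v : ~ regular v ->
  exit_weight_vertex n v = (n == 0)%:Z.
Proof.
by case: n => [[|n]|n] rv //=; rewrite asboolF.
Qed.

Lemma exit_weight_regular n v : regular v ->
  exit_weight_vertex n v = \sum_(e <- outs v) exit_weight_vertex (n + 1) (rng e).
Proof.
case: n => [[|n]|n] rv /=.
- by rewrite asboolT // big1 // => e _.
- by rewrite big1 // => e _; rewrite addn1.
rewrite asboolT // (big_morph Posz PoszD (erefl _)); apply: eq_bigr => e _.
by case: n => // n; have -> : (Negz n.+1 + 1 = Negz n)%R by lia.
Qed.

Lemma exit_weight_step a b : gm_step a b -> weight exit_weight a = weight exit_weight b.
Proof.
have irreg v : infinite_emitter v -> ~ regular v by move=> iv [].
case=> [n c v rv|n c v Z iv Zv|n c v Z W iv Wv ZW].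
- rewrite !weightD weight1 weight_ranges; congr (_ + _).
  exact: exit_weight_regular.
- rewrite !weightD !weight1 weight_ranges -addrA; congr (_ + _).
  by rewrite /exit_weight /= exit_weight_irregular ?subrK //; exact: irreg.
- rewrite !weightD !weight1 weight_ranges -addrA; congr (_ + _).
  rewrite /exit_weight /= -addrA; congr (_ + _).
  have sZW := fproper_sub ZW.
  have : \sum_(e <- val W) exit_weight_vertex (n + 1) (rng e) =
    \sum_(e <- val Z) exit_weight_vertex (n + 1) (rng e) +
    \sum_(e <- (val W `\` val Z)%fset) exit_weight_vertex (n + 1) (rng e).
    rewrite (big_fsetID _ (mem (val Z))) /=; congr (_ + _).
      apply: eq_fbigl => e; rewrite !inE /= andb_idl //; exact: (fsubsetP sZW).
    by apply: eq_fbigl => e; rewrite !inE /= andbC.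
  by move=> ->; rewrite opprD addrNK.
Qed.

(** The relations let every generator be moved on to any higher degree [N], where it
    becomes a sum of vertices; the multiplicity of [w] in it is an invariant once [N]
    exceeds the degrees that occur. *)
Definition count_weight w (N : nat) (y : int * gen) : nat :=
  if y.2 is inl v then path_count (absz (N%:Z - y.1)%R) v w else 0%N.

Lemma count_weight_eqv a b : (forall v, regular v) -> gm_eqv a b ->
  exists N0, forall N w, (N0 <= N)%N ->
    weight (count_weight w N) a = weight (count_weight w N) b.
Proof.
move=> reg; have irreg v : ~ infinite_emitter v by move=> iv; case: (reg v).
elim=> {a b} [a b|a|a b _ [N0 IH]|a b c _ [M IHM] _ [N IHN]].
- case=> [n c v rv|n c v Z /irreg|n c v Z W /irreg] //.
  exists (absz n).+1 => N w lN; rewrite !weightD weight1 weight_ranges; congr (_ + _).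
  rewrite /count_weight /=.
  have -> : absz (N%:Z - n)%R = (absz (N%:Z - (n + 1))%R).+1 by lia.
  exact: path_countS.
- by exists 0%N.
- by exists N0 => N w /IH ->.
- by exists (maxn M N) => k w; rewrite geq_max => /andP[/IHM-> /IHN->].
Qed.

Lemma gm_pi_seq s : gm_pi (seq_mset s) = \sum_(y <- s) gm_pi [mset y] :> gmonoid E.
Proof.
elim: s => [|y s IH]; first by rewrite big_nil -[RHS]/(gm_pi mset0); congr gm_pi;
    apply/msetP => y; rewrite mset_seqE mset0E.
rewrite big_cons -IH -[RHS]/(gm_add _ _) gm_addE; congr gm_pi; apply/msetP => x.
by rewrite mset_seqE /= msetE2 msetnE mset_seqE eq_sym; case: eqP.
Qed.

Lemma groth_injD (M : nmodType) (x y : M) : groth_inj (x + y) = groth_inj x + groth_inj y.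
Proof. by rewrite -[RHS]/(groth_add _ _) groth_addE /= addr0. Qed.

Lemma groth_inj_sum (M : nmodType) (I : Type) (s : seq I) (F : I -> M) :
  \sum_(i <- s) groth_inj (F i) = groth_inj (\sum_(i <- s) F i).
Proof. by symmetry; apply: (big_morph (@groth_inj M) (@groth_injD M)). Qed.

Lemma gm_act0 n : gm_act n 0 = 0 :> gmonoid E.
Proof.
rewrite -[0]/(gm_pi mset0) gm_actE; congr gm_pi; apply/msetP => -[k g].
by rewrite gm_shiftE !mset0E.
Qed.

Lemma groth_act_inj n (x : gmonoid E) :
  groth_map (@gm_act E n) (groth_inj x) = groth_inj (gm_act n x).
Proof. by rewrite groth_mapE /= ?gm_act0 //; exact: gm_actD. Qed.

Definition unit_mset : gm_free E := seq_mset [seq (0, inl v : gen) | v <- vertices E].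

Lemma graph_unitE : pog_unit (graph_pogroup E) = groth_inj (gm_pi unit_mset).
Proof. by rewrite gm_pi_seq big_map -groth_inj_sum. Qed.

Lemma shift_fixed_eqv a :
  pog_act (p := graph_pogroup E) 1 (groth_inj (gm_pi a)) = groth_inj (gm_pi a) ->
  exists d, gm_eqv (gm_shift 1 a `+` d) (a `+` d).
Proof.
rewrite /= groth_act_inj => /groth_piP[c /=]; elim/gm_ind: c => d; rewrite !addr0.
rewrite gm_actE -[LHS]/(gm_add _ _) -[RHS]/(gm_add _ _) !gm_addE => /gm_piP.
by exists d.
Qed.

Section UnitFixed.
Hypothesis fV : finite_set [set: vertex E].
Hypothesis fix1 :
  pog_act (p := graph_pogroup E) 1 (pog_unit (graph_pogroup E)) = pog_unit (graph_pogroup E).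

(** The invariant [exit_weight] vanishes on [x 1_E] and counts the vertices that are
    not regular on [1_E]. *)
Lemma unit_fixed_regular v : regular v.
Proof.
have := fix1; rewrite graph_unitE => /shift_fixed_eqv[d].
move=> /(weight_eqv exit_weight_step); rewrite !weightD => /addIr.
rewrite weight_shift !weight_seq !big_map /exit_weight /=.
rewrite big1 // -(big_morph Posz PoszD (erefl _)) => -[/esym/eqP].
rewrite sum_nat_seq_eq0 => /allP/(_ v (mem_vertices v fV)) /=.
by case: asboolP.
Qed.

Lemma unit_fixed_constant : exists n0, forall n v, (n0 <= n)%N ->
  size (paths_to n.+1 v) = size (paths_to n v).
Proof.
have := fix1; rewrite graph_unitE => /shift_fixed_eqv[d].
move=> /(count_weight_eqv unit_fixed_regular)[N0 cw]; exists N0 => n v ln.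
have := cw n.+1 v (leqW ln); rewrite !weightD => /addIn.
rewrite weight_shift !weight_seq !big_map /count_weight /= !size_paths_to => cE.
by apply: etrans (etrans _ (esym cE)) _; apply: eq_bigr => w _; congr path_count; lia.
Qed.

End UnitFixed.

(** For large [N] the invariants compare the vertices reached after [N - 1] and [N] steps,
    and [next] is injective on cycles. *)
Lemma vertex_fixed_loop (ne : no_exit E) nx (nxP : forall v, src (nx v) = v)
    (c : seq (edge E)) v : (forall w, regular w) ->
  is_cycle c -> v \in [seq src e | e <- c] ->
  pog_act (p := graph_pogroup E) 1 (groth_inj (gm_vertex v)) = groth_inj (gm_vertex v) ->
  size c = 1%N.
Proof.
move=> reg cc vc /shift_fixed_eqv[d] /(count_weight_eqv reg)[N0 cw].
have cv : cyclic v by exists c.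
have count1 := path_count_cyclic ne nxP _ _ (fun u => (reg u).1) cv.
have := cw N0.+1 (iter N0 (next nx) v) (leqnSn _); rewrite !weightD => /addIn.
rewrite weight_shift !weight1.
have -> : count_weight (iter N0 (next nx) v) N0.+1 (1 + (0 : int), inl v) =
    path_count N0 v (iter N0 (next nx) v).
  by rewrite /count_weight /=; congr path_count; lia.
have -> : count_weight (iter N0 (next nx) v) N0.+1 (0, inl v) =
    path_count N0.+1 v (iter N0 (next nx) v).
  by rewrite /count_weight /=; congr path_count; lia.
rewrite !count1 eqxx iterSr; case: eqP => // /(iter_next_inj ne nxP).
move=> /(_ (cyclic_next ne nxP cv) cv)/eqP.
by rewrite -[next nx v]/(iter 1 (next nx) v) (cycle_iter ne nxP _ cc vc) dvdn1 => /eqP.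
Qed.

End MonoidInvariants.

(** * The ring of polynomials modulo X^m - 1 *)

Section CyclicPoly.
Variable m : nat.
Hypothesis m_gt0 : (0 < m)%N.
Local Notation h := ('X^m - 1 : {poly int}).
Local Notation R := {poly %/ h}.
Local Notation X := ('qX : R).

Lemma mk_monic_Xn1 : mk_monic h = h.
Proof. by rewrite /mk_monic -[1]/(1%:P) size_XnsubC // ltnS m_gt0 monicXnsubC. Qed.

Lemma size_mk_monic_Xn1 : size (mk_monic h) = m.+1.
Proof. by rewrite mk_monic_Xn1 -[1]/(1%:P) size_XnsubC. Qed.

Lemma qX_order : X ^+ m = 1.
Proof.
have -> : X ^+ m = in_qpoly h 'X^m by rewrite rmorphXn.
have -> : in_qpoly h 'X^m = in_qpoly h (h + 1) by rewrite subrK.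
rewrite in_qpolyD in_qpoly1 -[RHS]add0r; congr (_ + _); apply/val_inj.
have hm := monic_mk_monic h; rewrite mk_monic_Xn1 in hm.
by rewrite /= mk_monic_Xn1 Pdiv.RingMonic.rmodpp.
Qed.

Lemma qX_mod a : X ^+ (a %% m) = X ^+ a.
Proof. by rewrite {2}(divn_eq a m) exprD mulnC exprM qX_order expr1n mul1r. Qed.

Lemma coef_qX r j : (r < m)%N -> (X ^+ r : {poly int})`_j = (j == r)%:R.
Proof.
move=> rm; have -> : X ^+ r = in_qpoly h 'X^r by rewrite rmorphXn.
by rewrite in_qpoly_small ?size_mk_monic_Xn1 ?size_polyXn // coefXn.
Qed.

Lemma coef_qX_sum (c : nat -> int) j : (j < m)%N ->
  ((\sum_(r < m) X ^+ r *~ c r : R) : {poly int})`_j = c j.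
Proof.
move=> jm; rewrite poly_of_qpoly_sum coef_sum (bigD1 (Ordinal jm)) //=.
have cE (r : 'I_m) : (X ^+ r *~ c r : {poly int})`_j = (j == r)%:R *~ c r.
  rewrite -(coef_qX j (ltn_ord r)).
  have -> : (X ^+ r *~ c r : {poly int}) = (X ^+ r : {poly int}) *~ c r.
    by rewrite -(raddfMz (@polyn _ _)).
  by rewrite -!scaler_int coefZ mulrzl.
rewrite big1 ?addr0 => [|r nr]; first by rewrite (cE (Ordinal jm)) eqxx intz.
have jr : (j == r) = false.
  by apply/negP => /eqP jr; case/eqP: nr; exact/val_inj.
by rewrite cE jr mul0rz.
Qed.

Lemma qX_sumE (g : R) : g = \sum_(r < m) X ^+ r *~ (g : {poly int})`_r.
Proof.
apply/npolyP => j; case: (ltnP j m) => jm; first by rewrite coef_qX_sum.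
by rewrite !big_coef_npoly // size_mk_monic_Xn1.
Qed.

Definition qX_int (d : int) : R := X ^+ absz (d %% m)%Z.

Lemma qX_intD d e : qX_int (d + e) = qX_int d * qX_int e.
Proof.
have m0 : m%:Z != 0 by lia.
rewrite /qX_int -exprD -[RHS]qX_mod; congr (_ ^+ _).
apply/eqP; rewrite -eqz_nat -modz_nat PoszD !gez0_abs ?modz_ge0 //.
by rewrite modzDm.
Qed.

Lemma qX_int_nat (r : nat) : qX_int r = X ^+ r.
Proof. by rewrite /qX_int modz_nat absz_nat qX_mod. Qed.

End CyclicPoly.

(** * The group of the graph *)

Lemma inj_surj_bijective (A B : Type) (f : A -> B) :
  injective f -> (forall b, exists a, f a = b) -> bijective f.
Proof.
move=> fI /boolp.choice[g gK]; exists g => // a.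
exact/fI/gK.
Qed.

(** The extension of [Phi] to differences is injective because [Phi] is; that the monoid is
    cancellative is a consequence. *)
Lemma groth_pog_iso (E : graph) (H : pogroup) (Phi : gmonoid E -> H) :
  {morph Phi : x y / x + y} -> injective Phi ->
  (forall h, exists x y, h = Phi x - Phi y) -> range Phi = @pog_pos H ->
  (forall d, {morph pog_act (p := H) d : x y / x - y}) ->
  (forall d x, Phi (gm_act d x) = pog_act d (Phi x)) ->
  Phi (gm_pi (unit_mset E)) = pog_unit H -> pog_iso (graph_pogroup E) H.
Proof.
move=> PhiD Phi_inj Phi_gen Phi_pos actB Phi_act Phi_unit.
have Phi0 : Phi 0 = 0 by apply: (addrI (Phi 0)); rewrite -PhiD !addr0.
pose F (x : groth (gmonoid E)) : H := Phi (repr x).1 - Phi (repr x).2.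
have FE p : F (groth_pi p) = Phi p.1 - Phi p.2.
  have /groth_piP[c /(congr1 Phi)] := groth_reprK (groth_pi p).
  rewrite !PhiD => /addIr e; apply/eqP; rewrite subr_eq addrAC eq_sym subr_eq.
  by rewrite e.
have FB : zmod_morphism F.
  elim/groth_ind => p; elim/groth_ind => q.
  rewrite -[- _]/(groth_opp _) groth_oppE -[_ + _]/(groth_add _ _) groth_addE !FE /=.
  by rewrite !PhiD opprB opprD addrACA [_ - Phi p.2]addrC.
pose Fa : {additive graph_pogroup E -> H} :=
  HB.pack_for {additive graph_pogroup E -> H} F
    (GRing.isZmodMorphism.Build (graph_pogroup E) H F FB).
have F_inj x : F (groth_inj x) = Phi x by rewrite FE /= Phi0 subr0.
exists Fa; split=> /=.
- apply: inj_surj_bijective => [|h].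
    elim/groth_ind => p; elim/groth_ind => q /=; rewrite !FE => /eqP.
    rewrite subr_eq addrAC eq_sym subr_eq -!PhiD => /eqP/Phi_inj pq.
    by apply/groth_piP; exists 0; rewrite !addr0 pq.
  have [x [y ->]] := Phi_gen h; exists (groth_pi (x, y)).
  by rewrite /= FE.
- move=> d; elim/groth_ind => p; rewrite groth_mapE; last exact: gm_actD.
  by rewrite !FE /= !Phi_act actB.
- rewrite -Phi_pos; apply/seteqP; split=> [_ [_ [x _ <-] <-]|_ [x _ <-]].
    by exists x => //; rewrite /= F_inj.
  by exists (groth_inj x); [exists x | rewrite /= F_inj].
- by have /= -> := @graph_unitE E; rewrite F_inj.
Qed.

Section GraphGroup.
Variable E : graph.
Implicit Types (v w : vertex E) (e : edge E).
Local Open Scope mset_scope.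

Hypothesis fV : finite_set [set: vertex E].
Hypothesis reg : forall v, regular v.
Hypothesis ne : no_exit E.
Variable nx : vertex E -> edge E.
Hypothesis nxP : forall v, src (nx v) = v.
Local Notation next := (next nx).

Let out_fin v : finite_set (out v). Proof. by case: (reg v). Qed.

Variables (n : nat) (base : 'I_n -> vertex E) (m : 'I_n -> nat).
Hypothesis baseP : forall i,
  exists c, [/\ is_cycle c, base i \in [seq src e | e <- c] & size c = m i].
Hypothesis base_ex : forall v, cyclic v ->
  exists i (r : nat), (r < m i)%N /\ iter r next v = base i.
Hypothesis base_uniq : forall v i j (r s : nat),
  iter r next v = base i -> iter s next v = base j -> i = j.

Let m_gt0 i : (0 < m i)%N.
Proof. by have [c [cc _ <-]] := baseP i; case: (c) cc. Qed.

Let cyclic_base i : cyclic (base i).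
Proof. by have [c [cc bc _]] := baseP i; exists c. Qed.

Let base_iter i r : (iter r next (base i) == base i) = (m i %| r)%N.
Proof. by have [c [cc bc <-]] := baseP i; exact: (cycle_iter ne nxP). Qed.

Let gm_at (d : int) v : gmonoid E := gm_pi [mset (d, inl v)].

Lemma gm_at_out d v : gm_at d v = \sum_(e <- outs v) gm_at (d + 1) (rng e).
Proof.
rewrite /gm_at.
rewrite -(big_map (fun e => (d + 1, inl (rng e) : gm_gen E)) xpredT (fun y => gm_pi [mset y])).
rewrite -gm_pi_seq; apply/gm_piP.
rewrite -[X in gm_eqv X]mset0D -[X in gm_eqv _ X]mset0D.
exact/rst_step/GM_A1.
Qed.

Lemma gm_at_paths l d v :
  gm_at d v = \sum_(s <- paths l v) gm_at (d + l%:Z) (path_end v s).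
Proof.
elim: l d v => [|l IH] d v; first by rewrite big_seq1 addr0.
rewrite gm_at_out big_allpairs_dep /=; apply: eq_bigr => e _.
rewrite (IH (d + 1)); apply: eq_bigr => s _; congr gm_at.
by rewrite -addrA -PoszD add1n.
Qed.

Lemma gm_at_next d v : cyclic v -> gm_at d v = gm_at (d + 1) (next v).
Proof.
move=> cv; rewrite gm_at_out.
have -> : outs v = [:: nx v]; last by rewrite big_seq1.
apply/perm_small_eq => //; apply: uniq_perm => // [|e]; first exact: uniq_outs.
rewrite mem_outs // inE; apply/eqP/eqP => [|->]; last exact: nxP.
exact: (cyclic_nx ne nxP cv).
Qed.

Lemma gm_at_iter k d v : cyclic v -> gm_at d v = gm_at (d + k%:Z) (iter k next v).
Proof.
move=> cv; elim: k => [|k IH]; first by rewrite addr0.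
rewrite IH gm_at_next; last exact: (cyclic_iter ne nxP).
by rewrite -addrA -PoszD addn1.
Qed.

(** Going round the cycle, [x^(m i)] fixes [base i]. *)
Lemma gm_at_mod d i : gm_at d (base i) = gm_at (d %% m i)%Z (base i).
Proof.
have per q d' : gm_at d' (base i) = gm_at (d' + (q * m i)%N%:Z) (base i).
  rewrite [LHS](gm_at_iter (q * m i)) //; congr gm_at; apply/eqP.
  by rewrite base_iter dvdn_mull.
have m0 : (m i)%:Z != 0 by have := m_gt0 i; lia.
have dE := divz_eq d (m i); move: dE; set q := (d %/ _)%Z => dE.
case: q dE => q dE.
  by rewrite [RHS](per q) {1}dE addrC PoszM.
by rewrite [LHS](per q.+1) {1}dE; congr gm_at; rewrite NegzE PoszM mulNr addrAC addNr add0r.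
Qed.

Definition base_combination (c : 'I_n -> nat -> nat) : gmonoid E :=
  \sum_(i < n) \sum_(r < m i) gm_at r%:Z (base i) *+ c i r.

(** As [x^(m i)] fixes [base i] and long paths end on cycles, the [x^r (base i)] with
    [r < m i] generate the monoid. *)
Lemma base_combination_ex x : exists c, x = base_combination c.
Proof.
have comb0 : base_combination (fun _ _ => 0%N) = 0.
  by rewrite /base_combination big1 // => i _; rewrite big1 // => r _; rewrite mulr0n.
have combD c d : base_combination (fun i r => c i r + d i r)%N =
    base_combination c + base_combination d.
  rewrite /base_combination -big_split; apply: eq_bigr => i _; rewrite -big_split.
  by apply: eq_bigr => r _; rewrite mulrnDr.
have comb_sum (I : Type) (s : seq I) (F : I -> gmonoid E) :
    (forall y, exists c, F y = base_combination c) ->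
    exists c, \sum_(y <- s) F y = base_combination c.
  move=> Fc; elim: s => [|y s [c cE]].
    by rewrite big_nil; exists (fun _ _ => 0%N).
  by have [d dE] := Fc y; rewrite big_cons cE dE; eexists; rewrite -combD.
have comb1 d i : exists c, gm_at d (base i) = base_combination c.
  rewrite gm_at_mod; set d' := (d %% _)%Z.
  have m0 : (m i)%:Z != 0 by have := m_gt0 i; lia.
  have [r rm rE] : exists2 r, (r < m i)%N & d' = r%:Z.
    have := modz_ge0 d m0; have := ltz_mod d m0; rewrite -/d'; case: d' => // r lr _.
    by exists r => //; move: lr; have := m_gt0 i; lia.
  exists (fun j s => (j == i) && (s == r) : nat); rewrite /base_combination (bigD1 i) //=.
  rewrite (bigD1 (Ordinal rm)) //= !eqxx mulr1n rE [X in _ + X]big1 ?addr0 => [|j nj]; last first.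
    by rewrite big1 // => s _; rewrite (negPf nj) mulr0n.
  by rewrite big1 ?addr0 // => s ns; rewrite -val_eqE /= in ns; rewrite (negPf ns) mulr0n.
elim/gm_ind: x => a; rewrite -(seq_mset_id a) gm_pi_seq; apply: (comb_sum _ _ _) => -[d [v|Z]].
  rewrite -/(gm_at d v) (gm_at_paths (size (vertices E))) big_seq_cond big_mkcond /=.
  apply: (comb_sum _ _ _) => s; case: ifP => [|_]; last by exists (fun _ _ => 0%N).
  rewrite andbT mem_paths // => /andP[ps /eqP zs].
  have cs : cyclic (path_end v s) by apply: (long_path_cyclic ne nxP fV); rewrite ?zs.
  have [i [r [_ rE]]] := base_ex cs.
  by rewrite (gm_at_iter r) // rE; exact: comb1.
have /asboolP[_ [v [iv _]]] := valP Z.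
by case: (reg v).
Qed.

Variable k : 'I_n -> nat.
Hypothesis size_paths_to_base : forall i N, (size (vertices E) + m i <= N)%N ->
  size (paths_to N (base i)) = k i.

Local Notation R i := {poly %/ ('X^(m i) - 1 : {poly int})}.

(** After [|E^0|] turns round the cycle every path ends on a cycle, and one more turn brings
    the length to where the numbers of paths are those of Condition (EDL). *)
Definition long i := ((size (vertices E)).+1 * m i)%N.

Lemma long_ge i r : (size (vertices E) + m i <= long i + r)%N.
Proof.
by rewrite /long mulSn addnC -addnA leq_add2l (leq_trans (leq_pmulr _ (m_gt0 i))) ?leq_addr.
Qed.

(** In the limit, [v] is the sum over [r] of [x^r (base i)] taken with the number of
    paths from [v] to [base i] of any large length congruent to [r]. *)
Definition gm_coord i v : R i :=
  \sum_(r < m i) 'qX ^+ r *+ path_count (long i + r) v (base i).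

(** Paths of length [long i + r + 1] from [v] are edges followed by paths of length
    [long i + r]; the sum over [r] closes up because lengths that differ by [m i] have
    equally many paths to [base i]. *)
Lemma gm_coord_out i v : gm_coord i v = 'qX * \sum_(e <- outs v) gm_coord i (rng e).
Proof.
pose F r : R i := 'qX ^+ r *+ path_count (long i + r) v (base i).
have -> : gm_coord i v = \sum_(r < m i) F r by [].
have -> : 'qX * \sum_(e <- outs v) gm_coord i (rng e) = \sum_(r < m i) F r.+1.
  rewrite exchange_big big_distrr /=; apply: eq_bigr => r _.
  by rewrite sumrMnr mulrnAr -exprS /F addnS path_countS.
have FM : F (m i) = F 0%N.
  rewrite /F qX_order // expr0 addn0; congr (_ *+ _).
  have /eqP bi : iter (m i) next (base i) == base i by rewrite base_iter.
  rewrite -[X in path_count _ _ X]bi addnC path_count_iter //.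
  by rewrite /long (leq_trans (leqnSn _)) // leq_pmulr.
have e1 : \sum_(r < (m i).+1) F r = \sum_(r < m i) F r + F (m i) by rewrite big_ord_recr.
have e2 : \sum_(r < (m i).+1) F r = F 0%N + \sum_(r < m i) F r.+1 by rewrite big_ord_recl.
by apply: (addIr (F 0%N)); rewrite -{1}FM -e1 e2; exact: addrC.
Qed.

Lemma gm_coord_base i j : gm_coord i (base j) = (i == j)%:R.
Proof.
rewrite /gm_coord; under eq_bigr do rewrite (path_count_cyclic ne nxP) //.
case: eqVneq => [<-|nij].
  rewrite (bigD1 (Ordinal (m_gt0 i))) //= addn0 base_iter /long dvdn_mull // expr0.
  rewrite big1 ?addr0 // => r nr; rewrite base_iter dvdn_addr ?dvdn_mull //.
  have r_gt0 : (0 < r)%N by rewrite lt0n; apply: contraNneq nr => r0; apply/eqP/val_inj.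
  by rewrite gtnNdvd // mulr0n.
rewrite big1 // => r _; case: eqP => // bij; case/eqP: nij.
exact: (base_uniq (v := base j) (s := 0) bij).
Qed.

Definition gm_eval i (y : int * gm_gen E) : R i :=
  if y.2 is inl v then qX_int (m i) y.1 * gm_coord i v else 0.

Lemma gm_eval_step i a b : gm_step a b -> weight (gm_eval i) a = weight (gm_eval i) b.
Proof.
have irreg v : ~ infinite_emitter v by move=> iv; case: (reg v).
case=> [d c v rv|d c v Z /irreg|d c v Z W /irreg] //.
rewrite !weightD weight1 weight_ranges; congr (_ + _).
rewrite /gm_eval /= gm_coord_out mulrA -[X in _ * X * _]expr1.
by rewrite -qX_int_nat // -qX_intD // mulr_sumr.
Qed.

Local Notation H := (pog_sum (fun i => cyclic_pogroup (m i) (k i))).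

Definition gm_coords (x : gmonoid E) : H := fun i => weight (gm_eval i) (repr x).

Lemma gm_coordsE a : gm_coords (gm_pi a) = fun i => weight (gm_eval i) a.
Proof.
apply: functional_extensionality_dep => i.
exact: (weight_eqv (@gm_eval_step i) (gm_piK a)).
Qed.

Lemma gm_coordsD : {morph gm_coords : x y / x + y}.
Proof.
elim/gm_ind => a; elim/gm_ind => b; rewrite -[_ + _]/(gm_add _ _) gm_addE !gm_coordsE.
by apply: functional_extensionality_dep => i; rewrite weightD.
Qed.

Lemma gm_coords_act d x : gm_coords (gm_act d x) = pog_act d (gm_coords x).
Proof.
elim/gm_ind: x => a; rewrite gm_actE !gm_coordsE; apply: functional_extensionality_dep => i.
rewrite weight_shift /= mulr_sumr; apply: eq_bigr => -[e [v|Z]] _; rewrite /gm_eval /=.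
  by rewrite qX_intD // mulrA.
by rewrite mulr0.
Qed.

Lemma gm_coords_combination c i :
  gm_coords (base_combination c) i = \sum_(r < m i) 'qX ^+ r *+ c i r :> R i.
Proof.
have sumE (I : Type) (s : seq I) (F : I -> gmonoid E) :
    gm_coords (\sum_(y <- s) F y) i = \sum_(y <- s) (gm_coords (F y) i : R i).
  apply: (big_morph (fun x => gm_coords x i : R i)) => [x y|]; first by rewrite gm_coordsD.
  by rewrite -[0]/(gm_pi mset0) gm_coordsE /weight enum_mset0 big_nil.
have mulnE x q : gm_coords (x *+ q) i = (gm_coords x i : R i) *+ q.
  elim: q => [|q IH]; last by rewrite !mulrS gm_coordsD -IH.
  by rewrite !mulr0n -[0]/(gm_pi mset0) gm_coordsE /weight enum_mset0 big_nil.
have oneE j (r : 'I_(m j)) : gm_coords (gm_at r (base j) *+ c j r) i =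
    'qX ^+ r * (i == j)%:R *+ c j r :> R i.
  by rewrite mulnE gm_coordsE weight1 /gm_eval /= gm_coord_base qX_int_nat.
have otherE : \sum_(j < n | j != i)
    (gm_coords (\sum_(r < m j) gm_at r (base j) *+ c j r) i : R i) = 0.
  rewrite big1 // => j nj; rewrite sumE big1 // => r _.
  by rewrite oneE eq_sym (negPf nj) mulr0 mul0rn.
rewrite /base_combination sumE (bigD1 i) //= otherE addr0 sumE; apply: eq_bigr => r _.
by rewrite oneE eqxx mulr1.
Qed.

(** The coordinates of the [x^r (base i)] are the standard basis, so the coordinates are
    injective on the graph monoid, with the nonnegative vectors as image. In particular
    the monoid is cancellative. *)
Lemma graph_pog_iso : pog_iso (graph_pogroup E) H.
Proof.
have combE c i : gm_coords (base_combination c) i =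
    \sum_(r < m i) 'qX ^+ r *~ (c i r)%:Z :> R i.
  by rewrite gm_coords_combination; apply: eq_bigr => r _; rewrite pmulrn.
apply: (@groth_pog_iso _ _ gm_coords).
- exact: gm_coordsD.
- move=> x y; have [c ->] := base_combination_ex x; have [d ->] := base_combination_ex y.
  move=> cd; rewrite /base_combination.
  apply: eq_bigr => i _; apply: eq_bigr => r _; congr (_ *+ _).
  have /(congr1 (fun g : R i => (g : {poly int})`_r)) := congr1 (fun h : H => h i : R i) cd.
  rewrite /= !combE (coef_qX_sum (m_gt0 i) (fun r => (c i r)%:Z)) //.
  by rewrite (coef_qX_sum (m_gt0 i) (fun r => (d i r)%:Z)) // => -[].
- move=> h; pose co i r : int := ((h i : R i) : {poly int})`_r.
  exists (base_combination (fun i r => if co i r is Posz q then q else 0%N)).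
  exists (base_combination (fun i r => if co i r is Negz q then q.+1 else 0%N)).
  apply: functional_extensionality_dep => i.
  rewrite -[RHS]/((gm_coords _ i : R i) - (gm_coords _ i : R i)) !combE -sumrB.
  rewrite [LHS](qX_sumE (m_gt0 i)); apply: eq_bigr => r _; rewrite -mulrzBr -/(co i r).
  by case: (co i r) => q; rewrite ?subr0 // sub0r.
- apply/seteqP; split=> [_ [x _ <-] i j|h hpos].
    have [c ->] := base_combination_ex x; rewrite combE.
    case: (ltnP j (m i)) => jm.
      by rewrite (coef_qX_sum (m_gt0 i) (fun r => (c i r)%:Z)).
    by rewrite big_coef_npoly // size_mk_monic_Xn1.
  exists (base_combination (fun i r => absz ((h i : R i) : {poly int})`_r)) => //.
  apply: functional_extensionality_dep => i; rewrite combE [RHS](qX_sumE (m_gt0 i)).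
  by apply: eq_bigr => r _; rewrite gez0_abs //; exact: hpos.
- move=> d g h; apply: functional_extensionality_dep => i.
  exact: mulrBr.
- exact: gm_coords_act.
rewrite gm_coordsE; apply: functional_extensionality_dep => i.
rewrite weight_seq big_map /gm_eval /=.
under eq_bigr do rewrite qX_int_nat // expr0 mul1r /gm_coord.
rewrite exchange_big; apply: eq_bigr => r _; rewrite sumrMnr -size_paths_to.
by rewrite size_paths_to_base // long_ge.
Qed.

End GraphGroup.

(** * Laurent polynomials *)

Section LaurentFacts.
Variables (K : fieldType) (m : nat).
Local Notation z := (ratfunX K).

Lemma ratfunX_neq0 : z != 0.
Proof. by rewrite tofrac_eq0 polyX_eq0. Qed.

Lemma ratfunX_expD (a b : int) : z ^ (a + b) = z ^ a * z ^ b.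
Proof. exact/expfzDr/ratfunX_neq0. Qed.

Lemma ratfunX_exp_neq0 (a : int) : z ^ a != 0.
Proof. exact/expfz_neq0/ratfunX_neq0. Qed.

Lemma ratfunX_exp_sub (a b : nat) : z ^+ a * z^-1 ^+ b = z ^ (a%:Z - b%:Z).
Proof. by rewrite ratfunX_expD exprVn; congr (_ * _); rewrite exprnN. Qed.

Lemma tofrac_scale (c : K) (p : {poly K}) :
  (tofrac (c *: p) : ratfun K) = c *: (tofrac p : ratfun K).
Proof. by rewrite ratfun_scaleE -mul_polyC tofracM. Qed.

Lemma laurentX (d : int) : (m%:Z %| d)%Z -> laurent_pred m (z ^ d).
Proof.
case/dvdzP => q ->; apply/asboolP; case: q => q.
  exists 'X^q, 0%N; rewrite muln0 expr0 mulr1 comp_Xn_poly -exprM tofracXn.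
  by rewrite -PoszM mulnC.
exists 1, q.+1; rewrite comp_polyC tofrac1 NegzE mulNr -PoszM -exprnN mulnC mulVf //.
by rewrite expf_neq0 // ratfunX_neq0.
Qed.

Lemma laurentD (f g : ratfun K) : laurent_pred m f -> laurent_pred m g -> laurent_pred m (f + g).
Proof.
by have [_ lin _] := laurent_subalg_closed K m => lf lg; rewrite -[f]scale1r; exact: lin.
Qed.

Lemma laurent0 : laurent_pred m (0 : ratfun K).
Proof. by apply/asboolP; exists 0, 0%N; rewrite mul0r comp_poly0 tofrac0. Qed.

Lemma laurentZ (c : K) (f : ratfun K) : laurent_pred m f -> laurent_pred m (c *: f).
Proof.
have [_ lin _] := laurent_subalg_closed K m => lf; rewrite -[c *: f]addr0.
exact: lin laurent0.
Qed.

Lemma laurentM (f g : ratfun K) : laurent_pred m f -> laurent_pred m g -> laurent_pred m (f * g).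
Proof. by have [_ _ mul] := laurent_subalg_closed K m; exact: mul. Qed.

(** Reduces what is linear in a Laurent polynomial to monomials. *)
Lemma laurent_expand (f : ratfun K) : laurent_pred m f ->
  exists s : seq (K * int), all (fun y => (m%:Z %| y.2)%Z) s /\
    f = \sum_(y <- s) y.1 *: z ^ y.2.
Proof.
case/asboolP => p [k fE].
exists [seq (p`_l, (m * l)%N%:Z - (m * k)%N%:Z) | l <- index_iota 0 (size p)]; split.
  apply/allP => _ /mapP[l _ ->] /=.
  by rewrite !PoszM -mulrBr dvdz_mulr.
rewrite big_map; apply: (mulIf (expf_neq0 (m * k)%N ratfunX_neq0)).
rewrite fE comp_polyE raddf_sum mulr_suml big_mkord; apply: eq_bigr => l _.
rewrite /= -exprM tofrac_scale tofracXn -scalerAl; congr (_ *: _).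
by rewrite [_ ^+ (m * k)]exprnP -ratfunX_expD subrK.
Qed.

End LaurentFacts.

(** * The branching system of long paths *)

(** The points are indexed by the rows of the matrices to come: [pth] enumerates the
    paths of length [N], blockwise according to the cycle on which they end, and
    [gam] is the distance from their end to the base vertex of that cycle. *)
Section LongPaths.
Variables (K : fieldType) (E : graph).
Implicit Types (v w u : vertex E) (e : edge E) (s t : seq (edge E)).

Hypothesis fV : finite_set [set: vertex E].
Hypothesis reg : forall v, regular v.
Hypothesis ne : no_exit E.
Variable nx : vertex E -> edge E.
Hypothesis nxP : forall v, src (nx v) = v.
Local Notation next := (next nx).
Local Notation walk := (walk nx).

Let out_fin v : finite_set (out v). Proof. by case: (reg v). Qed.

Variables (n : nat) (base : 'I_n -> vertex E) (m : 'I_n -> nat).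
Hypothesis baseP : forall i,
  exists c, [/\ is_cycle c, base i \in [seq src e | e <- c] & size c = m i].
Hypothesis base_uniq : forall v i j (r s : nat),
  iter r next v = base i -> iter s next v = base j -> i = j.

Variables (N : nat) (sz : 'I_n -> nat).
Local Notation X := {i : 'I_n & 'I_(sz i)}.
Variables (pth : X -> vertex E * seq (edge E)) (gam : forall i, 'I_(sz i) -> nat).
Hypothesis N_gt0 : (0 < N)%N.
Hypothesis N_long : (size (vertices E) <= N)%N.
Hypothesis pthP : forall x, is_path (pth x).1 (pth x).2 /\ size (pth x).2 = N.
Hypothesis pth_inj : injective pth.
Hypothesis pth_surj : forall p, is_path p.1 p.2 -> size p.2 = N -> exists x, pth x = p.
Let pt_end x := path_end (pth x).1 (pth x).2.
Hypothesis gamP : forall x, iter (gam (tagged x)) next (pt_end x) = base (tag x).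

Definition base_dist (x : X) : nat := gam (tagged x).
Definition pt_src (x : X) := (pth x).1.
Definition pt_head (x : X) : option (edge E) := ohead (pth x).2.
Definition find_pt (d : X) p : X := odflt d [pick x | pth x == p].
Definition pt_tail (x : X) : X :=
  if (pth x).2 is e :: s then find_pt x (rng e, rcons s (nx (pt_end x))) else x.
Definition pt_cons e (x : X) : X := find_pt x (src e, take N (e :: (pth x).2)).
Local Notation st := pt_src.
Local Notation hd := pt_head.
Local Notation tl := pt_tail.
Local Notation cs := pt_cons.

Lemma pth_find_pt d p : is_path p.1 p.2 -> size p.2 = N -> pth (find_pt d p) = p.
Proof.
move=> pp zp; rewrite /find_pt; case: pickP => [x /eqP //|none].
by have [x xp] := pth_surj pp zp; have := none x; rewrite xp eqxx.
Qed.

Lemma cyclic_pt_end x : cyclic (pt_end x).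
Proof.
have [px zx] := pthP x.
by apply: (long_path_cyclic ne nxP fV px); rewrite zx.
Qed.

Lemma pt_end_nx x e : src e = pt_end x -> e = nx (pt_end x).
Proof. exact: (cyclic_nx ne nxP (cyclic_pt_end x)). Qed.

Lemma pth_tail x e s : (pth x).2 = e :: s -> pth (tl x) = (rng e, rcons s (nx (pt_end x))).
Proof.
move=> xe; rewrite /pt_tail xe pth_find_pt //=.
  have [] := pthP x; rewrite xe /= => /andP[_ ps] _.
  by rewrite is_path_rcons ps nxP /pt_end xe eqxx.
by have [_] := pthP x; rewrite xe size_rcons.
Qed.

(** Past a long path there is only one way to go on, so dropping the first edge and adding
    the forced one at the end is undone by prepending the first edge again. *)
Lemma pt_headP x e : hd x = Some e -> [/\ st x = src e, st (tl x) = rng e & cs e (tl x) = x].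
Proof.
rewrite /pt_head; case xe: (pth x).2 => [//|f s] [fe]; subst f.
have [px zx] := pthP x; rewrite xe /= in px zx; case/andP: px => /eqP se ps.
have tE := pth_tail xe; split; first by rewrite /pt_src -se.
  by rewrite /pt_src tE.
apply: pth_inj; rewrite [in LHS]/pt_cons tE /=.
have -> : take N (e :: rcons s (nx (pt_end x))) = e :: s.
  by rewrite -rcons_cons -cats1 take_size_cat.
rewrite pth_find_pt //= ?eqxx ?ps //.
by rewrite -xe se -surjective_pairing.
Qed.

Lemma pth_cons x e : st x = rng e -> exists s g,
  [/\ pth x = (rng e, rcons s g), pth (cs e x) = (src e, e :: s)
    & g = nx (path_end (rng e) s)].
Proof.
rewrite /pt_src => sx; have [px zx] := pthP x.
move xs: (pth x).2 => l; case/lastP: l xs => [|s g] xs.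
  by move: zx N_gt0; rewrite xs => <-.
exists s, g; rewrite xs sx is_path_rcons size_rcons in px zx.
case/andP: px => ps /eqP sg.
have cE : pth (cs e x) = (src e, e :: s).
  rewrite /pt_cons xs -rcons_cons -cats1 take_size_cat //=.
  by rewrite pth_find_pt //= eqxx ps.
split=> //; first by rewrite -xs -sx -surjective_pairing.
have fE : pt_end (cs e x) = path_end (rng e) s by rewrite /pt_end cE.
by rewrite -fE; apply: pt_end_nx; rewrite fE.
Qed.

Lemma pt_consP x e : st x = rng e -> hd (cs e x) = Some e /\ tl (cs e x) = x.
Proof.
move=> /pth_cons[s [g [xE cE gE]]]; split; first by rewrite /pt_head cE.
apply: pth_inj; rewrite (@pth_tail _ e s) ?cE // xE gE; congr (_, rcons s (nx _)).
by rewrite /pt_end cE.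
Qed.

Lemma pt_head_some x : regular (st x) -> hd x != None.
Proof.
move=> _; rewrite /pt_head; have [_ zx] := pthP x.
by case: (pth x).2 zx N_gt0 => //= <-.
Qed.

Lemma pt_end_tail x : pt_end (tl x) = next (pt_end x).
Proof.
have [_ zx] := pthP x; case xe: (pth x).2 zx N_gt0 => [|e s]; first by move=> <-.
by move=> _ _; rewrite {1}/pt_end (pth_tail xe) /= path_end_rcons.
Qed.

Lemma base_modn i v a b : iter a next v = base i -> iter b next v = base i ->
  a = b %[mod m i].
Proof.
wlog ab : a b / (a <= b)%N => [hw|] va vb.
  by case/orP: (leq_total a b) => l; [exact: hw | symmetry; exact: hw].
apply/eqP; rewrite eq_sym eqn_mod_dvd //; have [c [cc bc <-]] := baseP i.
rewrite -(cycle_iter ne nxP _ cc bc); apply/eqP.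
by rewrite -{1}va -iterD subnK.
Qed.

(** The tail ends one step further on the same cycle. *)
Lemma tag_pt_tail x : tag (tl x) = tag x.
Proof.
apply: (@base_uniq (next (pt_end x)) _ _ (base_dist (tl x)) (base_dist x + (m (tag x)).-1)).
  by rewrite -pt_end_tail gamP.
have [c [cc bc zc]] := baseP (tag x).
have m_gt0 : (0 < m (tag x))%N by rewrite -zc; case: (c) cc.
rewrite -iterSr -addnS prednK // addnC iterD gamP; apply/eqP.
by rewrite (cycle_iter ne nxP _ cc bc) zc.
Qed.

Lemma base_dist_tail x :
  ((m (tag x))%:Z %| (base_dist x)%:Z - 1 - (base_dist (tl x))%:Z)%Z.
Proof.
have h1 : iter (base_dist (tl x)).+1 next (pt_end x) = base (tag x).
  by rewrite iterSr -pt_end_tail gamP tag_pt_tail.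
have := base_modn (gamP x) h1 => /eqP; rewrite -eqz_nat -!modz_nat eqz_mod_dvd.
by rewrite -addn1 PoszD opprD addrA addrAC.
Qed.

Local Notation L := (lpa K E).
Local Notation F := (ratfun K).
Local Notation z := (ratfunX K).
Local Notation "x ** y" := (lpa_mul x y) (at level 40, left associativity).
Local Notation V := (@lpa_vertex K E).
Local Notation Ed := (@lpa_edge K E).
Local Notation Gh := (@lpa_ghost K E).
Local Notation P := (@lpa_path K E).
Local Notation S := (@lpa_path_star K E).

Definition act : L -> (X -> F) -> X -> F := lpa_act st hd tl cs z.

Let z0 : z != 0 := ratfunX_neq0 K.

Lemma act_vertex v g x : act (V v) g x = if st x == v then g x else 0.
Proof. by rewrite /act (lpa_act_pi z0 pt_headP pt_consP pt_head_some). Qed.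

Lemma act_edge e g x : act (Ed e) g x = if hd x == Some e then z * g (tl x) else 0.
Proof. by rewrite /act (lpa_act_pi z0 pt_headP pt_consP pt_head_some). Qed.

Lemma act_ghost e g x : act (Gh e) g x = if st x == rng e then z^-1 * g (cs e x) else 0.
Proof. by rewrite /act (lpa_act_pi z0 pt_headP pt_consP pt_head_some). Qed.

Lemma act0 g x : act 0 g x = 0.
Proof. exact: (lpa_act0 z0 pt_headP pt_consP pt_head_some). Qed.

Lemma actD y y' g x : act (y + y') g x = act y g x + act y' g x.
Proof. exact: (lpa_actD z0 pt_headP pt_consP pt_head_some). Qed.

Lemma actZ c y g x : act (c *: y) g x = c *: act y g x.
Proof. exact: (lpa_actZ z0 pt_headP pt_consP pt_head_some). Qed.

Lemma actM y y' g : act (y ** y') g = act y (act y' g).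
Proof. exact: (lpa_actM z0 pt_headP pt_consP pt_head_some). Qed.

Lemma act_sum (I : Type) (r : seq I) (y : I -> L) g x :
  act (\sum_(i <- r) y i) g x = \sum_(i <- r) act (y i) g x.
Proof. exact: (lpa_act_sum z0 pt_headP pt_consP pt_head_some). Qed.

(** An edge multiplies by x and increases the distance to the base vertex by one modulo
    [m i], so these functions form a subrepresentation; this is why the conjugated
    matrices have their entries in K[x^m, x^-m]. *)
Definition homogeneous i (c : int) (g : X -> F) := forall x,
  (tag x <> i -> g x = 0) /\
  (tag x = i -> laurent_pred (m i) (g x * z ^ (c - (base_dist x)%:Z))).

Lemma act_homogeneous i c g y : homogeneous i c g -> homogeneous i c (act y g).
Proof.
have zero : homogeneous i c (fun _ => 0).
  by move=> x; split=> // _; rewrite mul0r; exact: laurent0.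
elim/lpa_gen_ind: y g => [v|e|e||y y' IH IH'|a y IH|y y' IH IH'] g hg x.
- by rewrite act_vertex; case: eqP => _; [exact: hg | exact: zero].
- rewrite act_edge; case: eqP => _; last exact: zero.
  have [h0 h1] := hg (tl x); rewrite tag_pt_tail in h0 h1.
  split=> [/h0->|xi]; first by rewrite mulr0.
  have -> : z * g (tl x) * z ^ (c - (base_dist x)%:Z) =
      g (tl x) * z ^ (c - (base_dist (tl x))%:Z) *
      z ^ - ((base_dist x)%:Z - 1 - (base_dist (tl x))%:Z).
    rewrite -[z in z * g _]expr1z mulrAC -ratfunX_expD mulrC -mulrA -ratfunX_expD.
    by congr (_ * z ^ _); lia.
  apply: laurentM; first exact: h1.
  by apply: laurentX; rewrite rpredN -xi base_dist_tail.
- rewrite act_ghost; case: eqP => [sx|_]; last exact: zero.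
  have [_ tc] := pt_consP sx; have := tag_pt_tail (cs e x); rewrite tc => tagE.
  have [h0 h1] := hg (cs e x); split=> xi.
    by rewrite h0 ?mulr0 // -tagE.
  have -> : z^-1 * g (cs e x) * z ^ (c - (base_dist x)%:Z) =
      g (cs e x) * z ^ (c - (base_dist (cs e x))%:Z) *
      z ^ ((base_dist (cs e x))%:Z - 1 - (base_dist x)%:Z).
    rewrite -[z^-1]/(z ^ (- 1)) mulrAC -ratfunX_expD mulrC -mulrA -ratfunX_expD.
    by congr (_ * z ^ _); lia.
  apply: laurentM; first by apply: h1; rewrite -tagE.
  by apply: laurentX; have := base_dist_tail (cs e x); rewrite tc -tagE xi.
- by rewrite act0; exact: zero.
- have [h0 h1] := IH _ hg x; have [h0' h1'] := IH' _ hg x; rewrite actD.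
  split=> xi; first by rewrite h0 // h0' // addr0.
  by rewrite mulrDl; apply: laurentD; [exact: h1 | exact: h1'].
- have [h0 h1] := IH _ hg x; rewrite actZ; split=> xi; first by rewrite h0 // scaler0.
  by rewrite -scalerAl; apply: laurentZ; exact: h1.
- by rewrite actM; apply: IH; exact: IH'.
Qed.

Definition delta (q p : X) : F := (p == q)%:R.

Definition entry (y : L) (p q : X) : F := act y (delta q) p.

Lemma homogeneous_delta q : homogeneous (tag q) (base_dist q)%:Z (delta q).
Proof.
move=> p; rewrite /delta; case: eqP => [->|_].
  by split=> // _; rewrite subrr expr0z mulr1; apply: (@laurentX K _ 0).
by split=> // _; rewrite mul0r; exact: laurent0.
Qed.

Lemma entry_tag y p q : tag p <> tag q -> entry y p q = 0.
Proof. by have [h _] := act_homogeneous y (homogeneous_delta q) p. Qed.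

Lemma entry_laurent y p q : tag p = tag q ->
  laurent_pred (m (tag q)) (entry y p q * z ^ ((base_dist q)%:Z - (base_dist p)%:Z)).
Proof. by have [_ h] := act_homogeneous y (homogeneous_delta q) p. Qed.

Lemma delta_sum (g : X -> F) : g = fun p => \sum_q g q * delta q p.
Proof.
apply/funext => p; rewrite (bigD1 p) //= /delta eqxx mulr1 big1 ?addr0 // => q nq.
by rewrite eq_sym (negPf nq) mulr0.
Qed.

Lemma act_entry y g p : act y g p = \sum_q g q * entry y p q.
Proof. by rewrite [in LHS](delta_sum g) /act lpa_act_sumr. Qed.

Lemma entryM y y' p q : entry (y ** y') p q = \sum_r entry y p r * entry y' r q.
Proof.
rewrite /entry actM act_entry; apply: eq_bigr => r _; exact: mulrC.
Qed.

(** * Faithfulness *)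

(** Combinations of paths to [w] of length at least [M]; as an inductive predicate it is
    closed under the linear operations by construction. *)
Inductive path_span (M : nat) (w : vertex E) : L -> Prop :=
| path_span0 : path_span M w 0
| path_spanD y y' : path_span M w y -> path_span M w y' -> path_span M w (y + y')
| path_spanZ c y : path_span M w y -> path_span M w (c *: y)
| path_spanP v s : is_path v s -> path_end v s = w -> (M <= size s)%N ->
    path_span M w (P v s).

(** Multiplied on the right by a long walk along a cycle, an element of [L] becomes a
    combination of paths: the walk absorbs all ghost edges. *)
Lemma mul_walk_span y v s M : is_path v s -> cyclic (path_end v s) ->
  exists B0, forall B, (B0 <= B)%N ->
    path_span M (iter B next (path_end v s)) (y ** P v (s ++ walk (path_end v s) B)).
Proof.
elim/lpa_gen_ind: y v s M => [w|e|e||y y' IH IH'|a y IH|y y' IH IH'] v s M ps cs.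
- exists M => B lB; set s' := s ++ _.
  have ps' : is_path v s' by rewrite is_path_cat ps is_path_walk.
  case: (eqVneq w v) => [->|nwv]; last first.
    by rewrite lpa_vertex_path_ne //; exact: path_span0.
  rewrite lpa_vertex_path //; apply: path_spanP => //.
    by rewrite path_end_cat path_end_walk.
  by rewrite size_cat size_walk (leq_trans lB) ?leq_addl.
- exists M => B lB; set s' := s ++ _.
  have ps' : is_path v s' by rewrite is_path_cat ps is_path_walk.
  case: (eqVneq (rng e) v) => [ev|nev]; last first.
    rewrite -(lpa_vertex_path K ps') lpa_mulA lpa_ev (negPf nev) lpa_mul0l.
    exact: path_span0.
  have -> : Ed e ** P v s' = P (src e) (e :: s') by rewrite /= ev.
  apply: path_spanP; first by rewrite /= eqxx ev.
    by rewrite -[path_end _ _]/(path_end (rng e) s') ev path_end_cat path_end_walk.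
  by rewrite /= size_cat size_walk (leq_trans lB) // -addSn leq_addl.
- exists M.+1 => B lB; set s' := s ++ _.
  have ps' : is_path v s' by rewrite is_path_cat ps is_path_walk.
  have es' : path_end v s' = iter B next (path_end v s).
    by rewrite path_end_cat path_end_walk.
  have zs' : (M < size s')%N by rewrite size_cat size_walk (leq_trans lB) ?leq_addl.
  case: s' ps' es' zs' => // f s' /= /andP[_ ps'] es' zs'.
  rewrite lpa_mulA lpa_ge; case: eqP => [ef|_]; last by rewrite lpa_mul0l; exact: path_span0.
  by subst f; rewrite lpa_vertex_path //; exact: path_spanP.
- by exists 0%N => B _; rewrite lpa_mul0l; exact: path_span0.
- have [B0 h] := IH v s M ps cs; have [B1 h'] := IH' v s M ps cs.
  exists (maxn B0 B1) => B; rewrite geq_max lpa_mulDl => /andP[/h hB /h' hB'].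
  exact: path_spanD.
- have [B0 h] := IH v s M ps cs; exists B0 => B /h hB.
  by rewrite -lpa_scaleAl; exact: path_spanZ.
have [B1 h'] := IH' v s 0%N ps cs; set u := path_end v s in cs h' *.
have cu1 : cyclic (iter B1 next u) by exact: cyclic_iter.
have span_mul x : path_span 0 (iter B1 next u) x -> exists B0, forall B, (B0 <= B)%N ->
    path_span M (iter B next (iter B1 next u))
      (y ** (x ** P (iter B1 next u) (walk (iter B1 next u) B))).
  elim=> {x} [|x x' _ [Bx hx] _ [Bx' hx']|a x _ [Bx hx]|v' s' ps' es' _].
  - by exists 0%N => B _; rewrite lpa_mul0l lpa_mul0r; exact: path_span0.
  - exists (maxn Bx Bx') => B; rewrite geq_max lpa_mulDl lpa_mulDr => /andP[/hx h1 /hx' h2].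
    exact: path_spanD.
  - exists Bx => B /hx h1; rewrite -lpa_scaleAl -lpa_scaleAr; exact: path_spanZ.
  - have [B0 h] := IH v' s' M ps' (eq_ind_r (@cyclic E) cu1 es').
    exists B0 => B /h; rewrite es' lpa_path_cat ?es' //.
    by rewrite is_path_cat ps' es' is_path_walk.
have [B0 h] := span_mul _ (h' B1 (leqnn _)); exists (B1 + B0)%N => B lB.
have lB1 : (B1 <= B)%N := leq_trans (leq_addr _ _) lB.
have -> : iter B next u = iter (B - B1) next (iter B1 next u) by rewrite -iterD subnK.
have -> : walk u B = walk u B1 ++ walk (iter B1 next u) (B - B1) by rewrite -walkD subnKC.
rewrite catA lpa_path_cat; last first.
  by rewrite !is_path_cat ps path_end_cat path_end_walk -/u !is_path_walk.
rewrite path_end_cat path_end_walk -/u -lpa_mulA (lpa_mulA y').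
by apply: h; rewrite leq_subRL.
Qed.

(** Walks out of a vertex on a cycle multiply like powers of x; [walk_poly] substitutes
    them in a polynomial. *)
Definition walk_poly v (A : {poly K}) : L :=
  \sum_(l < size A) A`_l *: P v (walk v l).

Lemma walk_poly_wide v (A : {poly K}) M : (size A <= M)%N ->
  walk_poly v A = \sum_(l < M) A`_l *: P v (walk v l).
Proof.
move=> AM; rewrite /walk_poly -(subnKC AM) big_split_ord /= [X in _ = _ + X]big1 ?addr0 //.
by move=> l _; rewrite nth_default ?leq_addr ?scale0r.
Qed.

Lemma walk_polyD v (A A' : {poly K}) : walk_poly v (A + A') = walk_poly v A + walk_poly v A'.
Proof.
have l1 := leq_maxl (size A) (size A'); have l2 := leq_maxr (size A) (size A').
rewrite (walk_poly_wide v (leq_trans (size_polyD _ _) (leqnn _))).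
rewrite (walk_poly_wide v l1) (walk_poly_wide v l2) -big_split; apply: eq_bigr => l _.
by rewrite coefD scalerDl.
Qed.

Lemma walk_polyZ v c (A : {poly K}) : walk_poly v (c *: A) = c *: walk_poly v A.
Proof.
rewrite (walk_poly_wide v (size_scale_leq _ _)) /walk_poly scaler_sumr.
by apply: eq_bigr => l _; rewrite coefZ scalerA.
Qed.

Lemma walk_polyX v l : walk_poly v 'X^l = P v (walk v l).
Proof.
rewrite /walk_poly size_polyXn big_ord_recr /= coefXn eqxx scale1r big1 ?add0r // => i _.
by rewrite coefXn ltn_eqF // scale0r.
Qed.

Lemma walk_poly0 v : walk_poly v 0 = 0.
Proof. by rewrite /walk_poly size_poly0 big_ord0. Qed.

Lemma follows_walk x l : cyclic (st x) -> follows hd tl x (walk (st x) l).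
Proof.
elim: l x => //= l IH x cx; have [px zx] := pthP x.
have hx : hd x = Some (nx (st x)).
  rewrite /pt_head (cyclic_path ne nxP cx px) zx.
  by case: (N) N_gt0.
have [_ tx _] := pt_headP hx; rewrite hx eqxx /=.
have {}tx : st (tl x) = next (st x) by [].
by rewrite -tx; apply: IH; rewrite tx; exact: (cyclic_next ne nxP).
Qed.

Lemma act_walk_poly v (A : {poly K}) x : cyclic v -> st x = v ->
  act (walk_poly v A) (fun=> 1) x = tofrac A.
Proof.
move=> cv sx; rewrite /walk_poly act_sum -[in RHS](coefK A) poly_def raddf_sum.
apply: eq_bigr => l _; rewrite actZ /act (lpa_act_path z0 pt_headP pt_consP pt_head_some) ?is_path_walk //.
rewrite sx eqxx -{1}sx follows_walk ?sx // mulr1 size_walk /=.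
by rewrite tofrac_scale tofracXn.
Qed.

(** What remains of a path after a long path is removed starts on a cycle, so it is a
    walk. *)
Lemma star_path_span p y w : path_span N w y ->
  exists A, S (pth p).1 (pth p).2 ** y = walk_poly (pt_end p) A.
Proof.
elim=> {y} [|y y' _ [A yA] _ [A' yA']|c y _ [A yA]|v s ps _ ls].
- by exists 0; rewrite lpa_mul0r walk_poly0.
- by exists (A + A'); rewrite lpa_mulDr yA yA' walk_polyD.
- by exists (c *: A); rewrite -lpa_scaleAr yA walk_polyZ.
have [pp zp] := pthP p; rewrite lpa_star_path ?zp //.
case: ifP => [/andP[/eqP vE /eqP sE]|_]; last by exists 0; rewrite walk_poly0.
exists 'X^(size (drop N s)); rewrite walk_polyX; congr lpa_path.
apply: (cyclic_path ne nxP); first exact: cyclic_pt_end.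
by move: ps; rewrite -{1}(cat_take_drop N s) sE is_path_cat -vE => /andP[].
Qed.

Lemma exists_st v : cyclic v -> exists x, st x = v.
Proof.
move=> cv; have [x xE] := @pth_surj (v, walk v N) (is_path_walk nxP v N) (size_walk nx v N).
by exists x; rewrite /pt_src xE.
Qed.

Lemma walk_star v B : cyclic v -> P v (walk v B) ** S v (walk v B) = V v.
Proof.
move=> cv; rewrite (lpa_vertex_paths K B v reg).
by rewrite (paths_cyclic ne nxP B out_fin cv) big_seq1.
Qed.

(** The corner of [L] cut out by two long paths consists of walks along a cycle, up to
    a long walk; on these the constant function 1 separates the polynomials. *)
Lemma act_faithful y : (forall g x, act y g x = 0) -> y = 0.
Proof.
move=> y0.
have corner p q : S (pth p).1 (pth p).2 ** (y ** P (pth q).1 (pth q).2) = 0.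
  have [pq zq] := pthP q; have cq : cyclic (pt_end q) := cyclic_pt_end q.
  have [B0 span] := mul_walk_span y N pq cq; have [A AE] := star_path_span p (span B0 (leqnn _)).
  have [x sx] := exists_st (cyclic_pt_end p).
  have A0 : A = 0.
    have := act_walk_poly A (cyclic_pt_end p) sx; rewrite -AE !actM.
    have act00 z1 : act z1 (fun=> 0) = fun=> 0.
      apply/funext => x'; rewrite act_entry big1 // => r _; exact: mul0r.
    have -> : forall g, act y g = fun=> 0 by move=> g; apply/funext.
    by rewrite act00 => /esym/eqP; rewrite tofrac_eq0 => /eqP.
  move: AE; rewrite A0 walk_poly0 lpa_path_cat; last by rewrite is_path_cat pq is_path_walk.
  move/(congr1 (fun z1 => z1 ** S (pt_end q) (walk (pt_end q) B0))).
  by rewrite lpa_mul0l -!lpa_mulA walk_star // lpa_path_end.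
have [one_l one_r] : (forall x, (\sum_(v <- vertices E) V v) ** x = x) /\
    (forall x, x ** (\sum_(v <- vertices E) V v) = x).
  by split=> x; have [] := lpa_one (K := K) fV x.
rewrite -[y]one_r (lpa_mul_paths N) // big1_seq // => w _; rewrite big1_seq // => s /andP[_].
rewrite mem_paths // => /andP[ps /eqP zs]; have [q /= qE] := @pth_surj (w, s) ps zs.
suff -> : y ** P w s = 0 by rewrite lpa_mul0l.
rewrite -[LHS]one_l (lpa_mul_paths N) // big1_seq // => v _; rewrite big1_seq // => t /andP[_].
rewrite mem_paths // => /andP[pt /eqP zt]; have [p /= pE] := @pth_surj (v, t) pt zt.
by have := corner p q; rewrite pE qE /= => ->; rewrite lpa_mul0r.
Qed.

(** * Matrix units *)

Lemma follows_take x s : follows hd tl x s -> (size s <= N)%N -> s = take (size s) (pth x).2.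
Proof.
elim: s x => [|e s IH] x; first by rewrite take0.
move=> /= /andP[/eqP hx /IH sE] ls; have {}sE := sE (ltnW ls).
move: hx; rewrite /pt_head; case xE: (pth x).2 => [//|f l] [fe]; subst f.
rewrite /= {1}sE (pth_tail xE) /= -cats1 takel_cat //.
by have [_] := pthP x; rewrite xE /= => zl; rewrite -zl in ls.
Qed.

(** Points are paths of length [N], so the first [N] edges that a point follows determine
    it. *)
Lemma follows_pth x v s : st x = v -> follows hd tl x s -> (N <= size s)%N ->
  pth x = (v, take N s).
Proof.
move=> sx fs ls; have [_ zx] := pthP x.
have ft : follows hd tl x (take N s).
  elim: (N) s x fs {ls sx zx} => [|k IH] [|e s] x //= /andP[-> fs] /=; exact: IH.
have := follows_take ft; rewrite size_takel // => /(_ (leqnn _)) ->.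
by rewrite -zx take_size -sx -surjective_pairing.
Qed.

Definition extend x l := (pth x).2 ++ walk (pt_end x) l.

Lemma is_path_extend x l : is_path (st x) (extend x l).
Proof. by have [px _] := pthP x; rewrite is_path_cat px is_path_walk. Qed.

Lemma path_end_extend x l : path_end (st x) (extend x l) = iter l next (pt_end x).
Proof. by rewrite path_end_cat path_end_walk. Qed.

Lemma size_extend x l : size (extend x l) = (N + l)%N.
Proof. by have [_ zx] := pthP x; rewrite size_cat zx size_walk. Qed.

Lemma cons_extend x l r : st r = iter l next (pt_end x) -> foldr cs r (extend x l) = x.
Proof.
move=> sr; have er : st r = path_end (st x) (extend x l) by rewrite path_end_extend.
have [s1 fs _] := follows_cs pt_headP pt_consP (is_path_extend x l) er.
apply: pth_inj; rewrite (follows_pth s1 fs) ?size_extend ?leq_addr //.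
by have [_ zx] := pthP x; rewrite /extend take_size_cat // -surjective_pairing.
Qed.

Lemma entry_monomial v s w t p q : is_path v s -> is_path w t ->
  let r := iter (size s) tl p in
  entry (P v s ** S w t) p q =
    if [&& st p == v, follows hd tl p s, st r == path_end w t & foldr cs r t == q]
    then z ^ ((size s)%:Z - (size t)%:Z) else 0.
Proof.
move=> ps pt r; rewrite /entry actM /act (lpa_act_path z0 pt_headP pt_consP pt_head_some) //.
rewrite (lpa_act_star z0 pt_headP pt_consP pt_head_some) // -/r /delta.
case: (st p == v) => //=; case: follows => //=.
case: (st r == _) => /=; last by rewrite mulr0.
case: (foldr cs r t == q) => /=; last by rewrite !mulr0.
by rewrite mulr1 ratfunX_exp_sub.
Qed.

(** Two points of a block are joined by paths to the base vertex, and going round its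
    cycle adds any multiple of its length to the degree. *)
Lemma matrix_unit p q d : tag p = tag q -> ((m (tag p))%:Z %| d)%Z ->
  exists2 y, lpa_comp (d + (base_dist p)%:Z - (base_dist q)%:Z) y
    & forall p' q', entry y p' q' = if (p' == p) && (q' == q)
        then z ^ (d + (base_dist p)%:Z - (base_dist q)%:Z) else 0.
Proof.
move=> pq /dvdzP[c dE]; set i := tag p in pq dE.
have [cy [cc bc zc]] := baseP i.
have per k : iter (k * m i) next (base i) = base i.
  by apply/eqP; rewrite (cycle_iter ne nxP _ cc bc) zc dvdn_mull.
(* [a] and [b] count the extra turns round the cycle made by the two paths. *)
pose a : nat := if c is Posz c' then c' else 0%N.
pose b : nat := if c is Negz c' then c'.+1 else 0%N.
have cE : c = a%:Z - b%:Z by rewrite /a /b; case: (c) => c'; rewrite ?subr0 // sub0r NegzE.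
pose s := extend p (a * m i + base_dist p); pose t := extend q (b * m i + base_dist q).
have ep : iter (a * m i + base_dist p) next (pt_end p) = base i by rewrite iterD gamP per.
have eq : iter (b * m i + base_dist q) next (pt_end q) = base i.
  by rewrite iterD gamP -pq per.
have [r sr] : exists r, st r = base i by apply: exists_st; exists cy.
have rs : foldr cs r s = p by apply: cons_extend; rewrite sr.
have rt : foldr cs r t = q by apply: cons_extend; rewrite sr.
have er : st r = path_end (st p) s by rewrite sr path_end_extend.
have [sps fps tps] := follows_cs pt_headP pt_consP (is_path_extend p _) er.
rewrite -/s rs in fps tps.
have deg : (size s)%:Z - (size t)%:Z = d + (base_dist p)%:Z - (base_dist q)%:Z.
  by rewrite !size_extend dE cE; lia.
exists (P (st p) s ** S (st q) t).
  exists [:: (1, P (st p) s ** S (st q) t)]; last by rewrite big_seq1 scale1r.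
  move=> y; rewrite inE => /eqP -> /=.
  by exists (st p), s, (st q), t; split=> //; exact: is_path_extend.
move=> p' q'; rewrite entry_monomial ?is_path_extend // deg.
congr (if _ then _ else _); apply/and4P/andP => [[/eqP sp' fs _ qE]|[/eqP -> /eqP ->]].
  have p'p : p' = p.
    apply: pth_inj; rewrite (follows_pth sp' fs) ?size_extend ?leq_addr //.
    by have [_ zx] := pthP p; rewrite /s /extend take_size_cat // -surjective_pairing.
  by move: qE; rewrite p'p tps rt eq_sym => /eqP ->.
by rewrite fps tps rt sr path_end_extend eq !eqxx.
Qed.

Local Notation blocks :=
  (zgalg_sum (fun i => laurent_matrix K (m i) (fun a : 'I_(sz i) => (gam a)%:Z))).
Local Notation pt a := (Tagged (fun i => 'I_(sz i)) a).

(** The conjugation by the powers of x of exponent [gam] makes the entries lie in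
    K[x^m, x^-m]. *)
Definition entries (y : L) : blocks := fun i =>
  \matrix_(a < sz i, b < sz i) insubd (0 : laurent K (m i))
    (entry y (pt a) (pt b) * z ^ ((gam b)%:Z - (gam a)%:Z)).

Lemma entriesE y i a b : laurent_val ((entries y i : 'M[laurent K (m i)]_(sz i)) a b) =
  entry y (pt a) (pt b) * z ^ ((gam b)%:Z - (gam a)%:Z).
Proof.
rewrite mxE [LHS](@insubdK _ _ (laurent K (m i))) //.
exact: (@entry_laurent y (pt a) (pt b)).
Qed.

Lemma entryD y y' p q : entry (y + y') p q = entry y p q + entry y' p q.
Proof. exact: actD. Qed.

Lemma entryZ c y p q : entry (c *: y) p q = c *: entry y p q.
Proof. exact: actZ. Qed.

Lemma entry_sum (I : Type) (r : seq I) (y : I -> L) p q :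
  entry (\sum_(i <- r) y i) p q = \sum_(i <- r) entry (y i) p q.
Proof. exact: act_sum. Qed.

Lemma entries_linear : linear (entries : LPA K E -> blocks).
Proof.
move=> c x y; apply: functional_extensionality_dep => i; apply/matrixP => a b.
apply/val_inj; rewrite [LHS]entriesE entryD entryZ mulrDl -scalerAl.
by rewrite -!entriesE !mxE.
Qed.

(** The exponents of the conjugation telescope, and entries between different blocks
    vanish, so the product of the big matrices is computed blockwise. *)
Lemma entriesM x y : entries (x ** y) = zg_mul (entries x) (entries y).
Proof.
apply: functional_extensionality_dep => i; apply/matrixP => a b; apply/val_inj.
rewrite [LHS]entriesE entryM /= [in RHS]mxE [RHS](raddf_sum (\val : laurent K (m i) -> F)) /=.
have sigE (G : X -> F) : \sum_r G r = \sum_j \sum_(c : 'I_(sz j)) G (pt c).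
  by rewrite sig_big_dep; apply: eq_bigr => -[j c] _.
rewrite sigE (bigD1 i) //= [X in _ + X]big1 ?addr0 => [|j nj]; last first.
  rewrite big1 // => c _; rewrite entry_tag ?mul0r //= => ij.
  by rewrite ij eqxx in nj.
rewrite mulr_suml; apply: eq_bigr => c _.
rewrite !entriesE mulrACA -ratfunX_expD.
by congr (_ * z ^ _); lia.
Qed.

Lemma entries_inj : injective entries.
Proof.
move=> x y xy; apply/eqP; rewrite -subr_eq0 -scaleN1r; apply/eqP/act_faithful => g p.
rewrite act_entry big1 // => q _; rewrite entryD entryZ scaleN1r.
case: (eqVneq (tag p) (tag q)) => [pq|/eqP npq]; last first.
  by rewrite !entry_tag // subrr mulr0.
suff -> : entry x p q = entry y p q by rewrite subrr mulr0.
case: p q pq => [i a] [j b] /= ij; subst j.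
apply: (mulIf (ratfunX_exp_neq0 K ((gam b)%:Z - (gam a)%:Z))).
by rewrite -!(entriesE _ a b) xy.
Qed.

Lemma entries_onto (Q : set L) (M : blocks) :
  (forall (I : Type) (r : seq I) (y : I -> L), (forall i, Q (y i)) -> Q (\sum_(i <- r) y i)) ->
  (forall i (a b : 'I_(sz i)), exists y, Q y /\ forall p q, entry y p q =
     if (p == pt a) && (q == pt b)
     then laurent_val ((M i : 'M[laurent K (m i)]_(sz i)) a b) * z ^ ((gam a)%:Z - (gam b)%:Z)
     else 0) ->
  exists2 y, Q y & entries y = M.
Proof.
move=> Qsum unit.
pose T := {i : 'I_n & ('I_(sz i) * 'I_(sz i))%type}.
have /boolp.choice[y yP] (t : T) : exists y, Q y /\ forall p q, entry y p q =
    if (p == pt (tagged t).1) && (q == pt (tagged t).2)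
    then laurent_val ((M (tag t) : 'M[laurent K (m (tag t))]_(sz (tag t))) (tagged t).1 (tagged t).2)
         * z ^ ((gam (tagged t).1)%:Z - (gam (tagged t).2)%:Z)
    else 0 by apply: unit.
exists (\sum_t y t); first by apply: Qsum => t; have [] := yP t.
apply: functional_extensionality_dep => i; apply/matrixP => a b; apply/val_inj.
rewrite [LHS]entriesE entry_sum.
rewrite (bigD1 (Tagged (fun i => ('I_(sz i) * 'I_(sz i))%type) (a, b))) //= big1 => [|t nt].
  rewrite addr0 (yP _).2 /= !eqxx /= -mulrA -ratfunX_expD.
  by rewrite addrA subrK subrr expr0z mulr1.
rewrite (yP _).2; case: ifP => // /andP[/eqP pa /eqP pb].
case/eqP: nt; case: t pa pb => j [a' b'] /= pa.
have ij : i = j := congr1 tag pa; subst j.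
by move: pa => /eqP; rewrite eq_Tagged /= => /eqP <- /eqP; rewrite eq_Tagged /= => /eqP <-.
Qed.

Lemma entries_surj (M : blocks) : exists y, entries y = M.
Proof.
have [y _ yM] : exists2 y, [set: L] y & entries y = M; last by exists y.
apply: entries_onto => // i a b; set f := laurent_val _.
have fl : laurent_pred (m i) f by exact: (valP ((M i : 'M[laurent K (m i)]_(sz i)) a b)).
have [s [/allP ms ->]] := laurent_expand fl.
have /boolp.choice[u uP] (c : K * int) : exists u : L, forall p q, c \in s -> entry u p q =
    if (p == pt a) && (q == pt b)
    then c.1 *: z ^ c.2 * z ^ ((gam a)%:Z - (gam b)%:Z) else 0.
  case cs: (c \in s); last by exists 0.
  have [u _ uE] := @matrix_unit (pt a) (pt b) _ erefl (ms c cs).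
  exists (c.1 *: u) => p q _; rewrite entryZ uE.
  by case: ifP; rewrite ?scaler0 // -scalerAl -ratfunX_expD addrA.
exists (\sum_(c <- s) u c); split=> // p q.
rewrite entry_sum (eq_big_seq _ (fun c cs => uP c p q cs)).
by case: ifP; rewrite ?mulr_suml // big1.
Qed.

(** A monomial [s t^*] contributes to the entry (a, b) only if dropping [s] from [a] and
    [t] from [b] leaves the same path; comparing the distances to the base vertex then
    shows that the exponent is a multiple of [m i]. *)
Lemma entry_comp d y i (a b : 'I_(sz i)) : lpa_comp d y ->
  laurent_comp (- (gam a)%:Z + d + (gam b)%:Z)
    ((entries y i : 'M[laurent K (m i)]_(sz i)) a b).
Proof.
set e := - _ + _ + _; pose C : set L := [set y | if ((m i)%:Z %| e)%Z
  then exists c : K, entry y (pt a) (pt b) * z ^ ((gam b)%:Z - (gam a)%:Z) = c *: z ^ e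
  else entry y (pt a) (pt b) = 0].
suff Cd : lpa_comp d y -> C y.
  move=> /Cd; rewrite /C /laurent_comp /=; case: ifP => _; first by rewrite entriesE.
  by move=> e0; apply/val_inj; rewrite /= entriesE e0 mul0r.
elim/lpa_comp_ind.
- rewrite /C /= /entry act0; case: ifP => // _; exists 0.
  by rewrite mul0r scale0r.
- move=> x x'; rewrite /C /= entryD; case: (_ %| _)%Z => [[c cE] [c' cE']|-> ->].
    by exists (c + c'); rewrite mulrDl cE cE' scalerDl.
  exact: addr0.
- move=> c x; rewrite /C /= entryZ; case: (_ %| _)%Z => [[c' cE]|->].
    by exists (c * c'); rewrite -scalerAl cE scalerA.
  exact: scaler0.
move=> _ [v [s [w [t [ps pt' st ->]]]]]; rewrite /C /= entry_monomial // st.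
case: (boolP [&& _, _, _ & _]) => [/and4P[sp fs sr qE]|_]; last first.
  by rewrite mul0r; case: (_ %| _)%Z => //; exists 0; rewrite scale0r.
have tail_dist k x : tag x = i ->
    tag (iter k tl x) = i /\ ((m i)%:Z %| (base_dist x)%:Z - k%:Z - (base_dist (iter k tl x))%:Z)%Z.
  move=> xi; elim: k => [|k [IHi IHd]]; first by rewrite subr0 subrr dvdz0.
  rewrite iterS tag_pt_tail; split=> //; have := base_dist_tail (iter k tl x); rewrite IHi => h.
  rewrite -[X in (_ %| X)%Z](_ : ((base_dist x)%:Z - k%:Z - (base_dist (iter k tl x))%:Z) +
    ((base_dist (iter k tl x))%:Z - 1 - (base_dist (tl (iter k tl x)))%:Z) = _); last by lia.
  exact: rpredD.
have [_ da] := tail_dist (size s) (pt a) erefl.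
have [_ _ tE] := follows_cs pt_headP pt_consP pt' (eqP sr); rewrite (eqP qE) in tE.
have [_ db] := tail_dist (size t) (pt b) erefl; rewrite tE in db.
have -> : ((m i)%:Z %| e)%Z.
  rewrite -[e](_ : - ((base_dist (pt a))%:Z - (size s)%:Z - (base_dist (iter (size s) tl (pt a)))%:Z)
    + ((base_dist (pt b))%:Z - (size t)%:Z - (base_dist (iter (size s) tl (pt a)))%:Z) = _).
    by rewrite rpredD ?rpredN.
  by rewrite /e -st /base_dist /=; lia.
by exists 1; rewrite scale1r -ratfunX_expD /e; congr (z ^ _); lia.
Qed.

Lemma entries_comp d (M : blocks) : zg_comp d M -> exists2 y, lpa_comp d y & entries y = M.
Proof.
move=> Md; apply: entries_onto => [I r y|i a b]; first exact: lpa_comp_sum.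
have /= := Md i a b; rewrite /laurent_comp /=; set e := - _ + _ + _.
case: ifP => [me [c ->]|_ ->]; last first.
  exists 0; split=> [|p q]; first by exists [::]; rewrite ?big_nil.
  by rewrite /entry act0 mul0r if_same.
have [u ud uE] := @matrix_unit (pt a) (pt b) e erefl me.
exists (c *: u); split=> [|p q].
  apply: lpa_compZ; rewrite -[d](_ : e + (base_dist (pt a))%:Z - (base_dist (pt b))%:Z = _) //.
  by rewrite /e /base_dist /=; lia.
rewrite entryZ uE; case: ifP; rewrite ?scaler0 // -scalerAl -ratfunX_expD.
by rewrite addrA.
Qed.

Lemma lpa_blocks_iso : graded_iso (LPA K E) blocks.
Proof.
pose f : {linear LPA K E -> blocks} :=
  HB.pack_for {linear LPA K E -> blocks} (entries : LPA K E -> blocks)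
    (GRing.isLinear.Build K (LPA K E) blocks *:%R entries entries_linear).
exists f; split=> /=.
- exact: inj_surj_bijective entries_inj entries_surj.
- exact: entriesM.
- move=> d; apply/seteqP; split=> [_ [y yd <-] i a b|M /entries_comp[y yd <-]].
    exact: entry_comp.
  by exists y.
Qed.

End LongPaths.

(** * Splittings *)

Section Splittings.
Variable K : fieldType.

Lemma skew_of_splitting (A : zgalg K) (u : A) (sigma : int -> A) :
  is_one u -> splitting u sigma -> skew_group_ring A.
Proof.
move=> u1 ss; split; last by exists u, sigma.
by exists u => // d; exists (sigma d); have [] := ss.1 d.
Qed.

(** Only the multiplication and the components matter, so a splitting, its unit and its
    centrality over the degree 0 component all transport. *)
Lemma splitting_iso (A B : zgalg K) (u : B) (sigma : int -> B) : graded_iso A B ->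
  is_one u -> splitting u sigma -> exists (u' : A) (sigma' : int -> A),
  [/\ is_one u', splitting u' sigma' &
    (forall d b r, inverse_wrt u (sigma d) b -> zg_comp 0 r ->
      zg_mul (zg_mul (sigma d) r) b = r) ->
    forall d b r, inverse_wrt u' (sigma' d) b -> zg_comp 0 r ->
      zg_mul (zg_mul (sigma' d) r) b = r].
Proof.
case=> f [[g fK gK] fM fcomp] u1 [ss sM].
have gM x y : g (zg_mul x y) = zg_mul (g x) (g y).
  by apply: (can_inj fK); rewrite fM !gK.
have fcomp_in d a : zg_comp d a -> zg_comp d (f a) by move=> ad; rewrite -fcomp; exists a.
have gcomp d b : zg_comp d b -> zg_comp d (g b).
  by rewrite -fcomp => -[a ad <-]; rewrite fK.
exists (g u), (g \o sigma); split.
- by move=> a; have [l r] := u1 (f a); split; apply: (can_inj fK); rewrite fM gK.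
- split=> [d|d e] /=; last by rewrite sM gM.
  have [sd [b [sb bs]]] := ss d; split; first exact: gcomp.
  by exists (g b); split; rewrite -gM ?sb ?bs.
move=> central d b r [sb bs] r0; apply: (can_inj fK); rewrite !fM gK.
apply: central; last exact: fcomp_in.
by split; rewrite -[sigma d]gK -fM ?sb ?bs gK.
Qed.

Lemma splitting_sum n (A : 'I_n -> zgalg K) (u : forall i, A i) (sigma : forall i, int -> A i) :
  (forall i, is_one (u i)) -> (forall i, splitting (u i) (sigma i)) ->
  is_one (A := zgalg_sum A) u /\ splitting (A := zgalg_sum A) u (fun d i => sigma i d).
Proof.
move=> u1 ss; split=> [a|].
  by split; apply: functional_extensionality_dep => i; have [] := u1 i (a i).
split=> [d|d e]; last first.
  by apply: functional_extensionality_dep => i; exact: (ss i).2.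
split=> [i|]; first by have [] := (ss i).1 d.
pose b i := sval (cid ((ss i).1 d).2).
exists b; split; apply: functional_extensionality_dep => i;
  by have [] := svalP (cid ((ss i).1 d).2).
Qed.

Lemma splitting_of_morph (A : zgalg K) (sigma : int -> A) :
  (forall d, zg_comp d (sigma d)) -> (forall d e, sigma (d + e) = zg_mul (sigma d) (sigma e)) ->
  splitting (sigma 0) sigma.
Proof.
move=> sd sM; split=> // d; split=> //.
by exists (sigma (- d)); split; rewrite -sM ?subrr ?addNr.
Qed.

Section Block.
Variables (k m : nat).
Hypotheses (k_gt0 : (0 < k)%N) (m_gt0 : (0 < m)%N).
Local Notation z := (ratfunX K).
Local Notation R := (laurent K m).
Local Notation I := 'I_(k * m).
Local Notation g := (fun i : I => (i %/ k)%N%:Z).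

(** Position [i] carries the degree [i %/ k], so moving by [d * k] positions, cyclically,
    changes the degree by [d] modulo [m]. *)
Definition cong (d : int) (i j : I) : bool := ((k * m)%N%:Z %| i%:Z - j%:Z - d * k%:Z)%Z.

Lemma cong_dvd d i j : cong d i j -> (m%:Z %| d + g j - g i)%Z.
Proof.
rewrite /cong => /dvdzP[q qE].
have := divn_eq i k; have := divn_eq j k.
have := ltn_pmod i k_gt0; have := ltn_pmod j k_gt0.
set a := (i %/ k)%N; set a' := (i %% k)%N; set b := (j %/ k)%N; set b' := (j %% k)%N.
move=> lb la jE iE.
have ab : (a%:Z - b%:Z - d - q * m%:Z) * k%:Z = b'%:Z - a'%:Z.
  by move: qE; rewrite iE jE !PoszD !PoszM; lia.
(* Two remainders modulo [k] that differ by a multiple of [k] are equal. *)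
have small (x : int) : x * k%:Z = b'%:Z - a'%:Z -> x = 0.
  case: x => [[|x]|x] // xk; exfalso; have : (k <= x.+1 * k)%N by rewrite leq_pmull.
    by move: xk; rewrite -PoszM; lia.
  by move: xk; rewrite NegzE mulNr -PoszM; lia.
have x0 := small _ ab.
by apply/dvdzP; exists (- q); lia.
Qed.

Lemma cong_eq d i j : cong d i j = (i%:Z == ((j%:Z + d * k%:Z) %% (k * m)%N)%Z).
Proof.
rewrite /cong -addrA -opprD -eqz_mod_dvd; congr (_ == _).
by rewrite modz_small // ltz_nat ltn_ord.
Qed.

Lemma cong_target d j : exists i, forall i', cong d i' j = (i' == i).
Proof.
have km : (k * m)%N%:Z != 0 by rewrite eqz_nat -lt0n muln_gt0 k_gt0.
set r := ((j%:Z + d * k%:Z) %% (k * m)%N)%Z.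
have r0 : 0 <= r by exact: modz_ge0.
have rlt : (absz r < k * m)%N by rewrite -ltz_nat gez0_abs // ltz_pmod // ltz_nat muln_gt0 k_gt0.
exists (Ordinal rlt) => i'; rewrite cong_eq -/r -val_eqE /= -eqz_nat.
by rewrite gez0_abs.
Qed.

Lemma cong_trans d e i j l : cong e j l -> cong d i j = cong (d + e) i l.
Proof.
rewrite /cong => ejl.
have -> : i%:Z - l%:Z - (d + e) * k%:Z =
  (j%:Z - l%:Z - e * k%:Z) + (i%:Z - j%:Z - d * k%:Z) by lia.
by rewrite [RHS]rpredDl.
Qed.

(** The weights make the cyclic shift homogeneous; they are 1 or a power of x^m
    according to how often the shift wraps around. *)
Definition shift_matrix (d : int) : crossed_block K k m :=
  \matrix_(i < k * m, j < k * m)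
    insubd (0 : R) (if cong d i j then z ^ (d + g j - g i) else 0).

Lemma shift_matrixE d i j : laurent_val ((shift_matrix d : 'M[R]_(k * m)) i j) =
  if cong d i j then z ^ (d + g j - g i) else 0.
Proof.
rewrite mxE [LHS](@insubdK _ _ R) //.
by case: ifP => [/cong_dvd dv|_]; [exact: laurentX | exact: laurent0].
Qed.

Lemma shift_matrixD d e : shift_matrix (d + e) = zg_mul (shift_matrix d) (shift_matrix e).
Proof.
apply/matrixP => i l; apply/val_inj; rewrite [LHS]shift_matrixE /= [in RHS]mxE.
rewrite [RHS](raddf_sum (\val : R -> ratfun K)) /=.
have [j0 jE] := cong_target e l.
have j0l : cong e j0 l by rewrite jE.
rewrite (bigD1 j0) //= big1 ?addr0 => [|j nj]; last first.
  by rewrite !shift_matrixE jE (negPf nj) mulr0.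
rewrite !shift_matrixE j0l (cong_trans _ _ j0l); case: ifP => _; last by rewrite mul0r.
by rewrite -ratfunX_expD; congr (z ^ _); lia.
Qed.

Lemma shift_matrix0 : shift_matrix 0 = (1%:M : 'M[R]_(k * m)).
Proof.
apply/matrixP => i j; apply/val_inj; rewrite [LHS]shift_matrixE !mxE cong_eq mul0r addr0.
rewrite modz_small ?ltz_nat ?ltn_ord // eqz_nat val_eqE.
by case: eqVneq => [->|_] /=; rewrite ?add0r ?subrr.
Qed.

Lemma crossed_block_splitting : is_one (shift_matrix 0) /\
  splitting (shift_matrix 0) shift_matrix.
Proof.
split; first by move=> A; rewrite shift_matrix0 /= mul1mx mulmx1.
apply: splitting_of_morph => [d i j|d e]; last exact: shift_matrixD.
rewrite /= /laurent_comp /= shift_matrixE.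
have -> : - g i + d + g j = d + g j - g i by lia.
case: ifP => [_|nd]; first by case: ifP => _; [exists 1|exists 0]; rewrite ?scale1r ?scale0r.
apply/val_inj; rewrite /= shift_matrixE; case: ifP => // /cong_dvd dv.
by rewrite dv in nd.
Qed.

End Block.

Section GroupBlock.
Variable k : nat.
Local Notation z := (ratfunX K).
Local Notation R := (laurent K 1).

Definition laurent_power (d : int) : R := insubd 0 (z ^ d).

Lemma laurent_powerE d : laurent_val (laurent_power d) = z ^ d.
Proof. by rewrite [LHS](@insubdK _ _ R) //; exact: laurentX (dvd1z d). Qed.

Lemma laurent_powerD d e : laurent_power (d + e) = laurent_power d * laurent_power e.
Proof. by apply/val_inj; rewrite /= !laurent_powerE ratfunX_expD. Qed.

Definition power_matrix (d : int) : group_block K k := ((laurent_power d)%:M : 'M[R]_k).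

Lemma group_block_splitting : is_one (power_matrix 0) /\
  splitting (power_matrix 0) power_matrix.
Proof.
have one : laurent_power 0 = 1 by apply/val_inj; rewrite /= laurent_powerE.
split; first by move=> A; rewrite /power_matrix one /= mul1mx mulmx1.
apply: splitting_of_morph => [d i j|d e] /=.
  rewrite /laurent_comp /= oppr0 add0r addr0 dvd1z mxE.
  case: (i == j) => /=; first by exists 1; rewrite mulr1n laurent_powerE scale1r.
  by exists 0; rewrite scale0r.
by rewrite /power_matrix laurent_powerD -scalar_mxM.
Qed.

Lemma power_matrix_central d (A : 'M[R]_k) :
  zg_mul (z := group_block K k) (power_matrix d) A =
  zg_mul (z := group_block K k) A (power_matrix d).
Proof.
apply/matrixP => i j; rewrite /= /power_matrix mul_scalar_mx !mxE (bigD1 j) //= big1.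
  rewrite addr0 mxE eqxx mulr1n; apply/val_inj; exact: mulrC.
by move=> l nl; rewrite mxE (negPf nl) mulr0n mulr0.
Qed.

End GroupBlock.

Lemma crossed_blocks_skew n (k m : 'I_n -> nat) (A : zgalg K) :
  (forall i, (0 < k i)%N) -> (forall i, (0 < m i)%N) ->
  graded_iso A (zgalg_sum (fun i => crossed_block K (k i) (m i))) -> skew_group_ring A.
Proof.
move=> k_gt0 m_gt0 iso.
pose s i := crossed_block_splitting (k_gt0 i) (m_gt0 i).
have [u1 ss] := splitting_sum (fun i => (s i).1) (fun i => (s i).2).
have [u' [s' [u1' ss' _]]] := splitting_iso iso u1 ss.
exact: skew_of_splitting u1' ss'.
Qed.

Lemma group_blocks_group n (k : 'I_n -> nat) (A : zgalg K) :
  graded_iso A (zgalg_sum (fun i => group_block K (k i))) -> group_ring A.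
Proof.
move=> iso; pose s i := group_block_splitting (k i).
have [u1 ss] := splitting_sum (fun i => (s i).1) (fun i => (s i).2).
have [u' [s' [u1' ss' central]]] := splitting_iso iso u1 ss.
split; first by have [] := skew_of_splitting u1' ss'.
exists u', s'; split=> //; apply: central => d b r [sb bs] _.
apply: functional_extensionality_dep => i.
have /= ui := congr1 (fun h => h i) sb.
rewrite -[LHS]/(zg_mul (zg_mul (power_matrix (k i) d) (r i)) (b i)).
rewrite power_matrix_central -[LHS]/((r i : 'M_(k i)) *m power_matrix (k i) d *m b i).
rewrite -mulmxA ui.
exact: ((s i).1 (r i)).2.
Qed.

End Splittings.

(** * The structure of finite graphs with Condition (EDL) *)

Section Structure.
Variable E : graph.
Hypothesis E_nonempty : inhabited (vertex E).
Implicit Types (v w : vertex E) (c : seq (edge E)).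

Lemma finite_graph_regular : finite_graph E -> (forall v, ~ sink v) -> forall v, regular v.
Proof.
move=> [_ fE] ns v; split; first exact: sub_finite_set fE.
by apply/set0P/negP => /eqP; exact: ns.
Qed.

Lemma regular_next : (forall v, regular v) ->
  exists nx : vertex E -> edge E, forall v, src (nx v) = v.
Proof.
move=> reg; have /boolp.choice[nx nxP] v : exists e : edge E, src e = v.
  by have [_ [e ev]] := reg v; exists e.
by exists nx.
Qed.

Lemma regular_finite_graph : finite_set [set: vertex E] -> (forall v, regular v) ->
  finite_graph E.
Proof.
move=> fV reg; split=> //.
apply: (@sub_finite_set _ _ [set` flatten [seq outs v | v <- vertices E]]); last exact: finite_seq.
move=> e _ /=; apply/flattenP; exists (outs (src e)); first by rewrite map_f ?mem_vertices.
by rewrite mem_outs // => v; case: (reg v).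
Qed.

(** The parameters of the blocks. [cd_mult] counts the long paths to a vertex of a cycle:
    under Condition (EDL) all vertices of the cycle have equally many. *)
Record cycle_data := CycleData {
  cd_next : vertex E -> edge E;
  cd_num : nat;
  cd_base : 'I_cd_num -> vertex E;
  cd_len : 'I_cd_num -> nat;
  cd_mult : 'I_cd_num -> nat;
  cd_nextP : forall v, src (cd_next v) = v;
  cd_num_gt0 : (0 < cd_num)%N;
  cd_mult_gt0 : forall i, (0 < cd_mult i)%N;
  cd_baseP : forall i,
    exists c, [/\ is_cycle c, cd_base i \in [seq src e | e <- c] & size c = cd_len i];
  cd_base_ex : forall v, cyclic v ->
    exists i (r : nat), (r < cd_len i)%N /\ iter r (next cd_next) v = cd_base i;
  cd_base_uniq : forall v i j (r s : nat),
    iter r (next cd_next) v = cd_base i -> iter s (next cd_next) v = cd_base j -> i = j;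
  cd_size : forall i (r : nat) N, (size (vertices E) + cd_len i <= N)%N ->
    size (paths_to N (iter r (next cd_next) (cd_base i))) = cd_mult i }.

Lemma cycle_data_exists :
  [/\ finite_graph E, no_exit E, forall v, ~ sink v & EDL E] -> inhabited cycle_data.
Proof.
move=> [fg ne ns edl]; have reg := finite_graph_regular fg ns.
have [fV _] := fg; have [nx nxP] := regular_next reg.
have out_fin v : finite_set (out v) := (reg v).1.
have [n [base [m [baseP base_ex base_uniq]]]] := cycle_bases fV nxP ne.
have /boolp.choice[k kP] (i : 'I_n) : exists k, (0 < k)%N /\
    forall (r N : nat), (size (vertices E) + m i <= N)%N ->
      size (paths_to N (iter r (next nx) (base i))) = k.
  have [c [cc bc <-]] := baseP i.
  have [k k_gt0 kP] := EDL_size fV out_fin nxP ne edl cc.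
  exists k; split=> // r N lN; apply: kP => //.
  exact: (cycle_mem_iter ne nxP).
have n_gt0 : (0 < n)%N.
  case: E_nonempty => v; set s := walk nx v (size (vertices E)).
  have cs : cyclic (path_end v s).
    by apply: (long_path_cyclic ne nxP fV); rewrite ?is_path_walk ?size_walk.
  by have [i _] := base_ex _ cs; apply: leq_ltn_trans (ltn_ord i).
constructor; apply: (@CycleData nx n base m k) => // [i|i r N lN].
  by case: (kP i).
by have [_] := kP i; exact.
Qed.

(** The paths of a large length [N], enumerated by the distance [gam] from their end to
    a base vertex and their rank [idx] among the paths with the same end. *)
Lemma lpa_iso_of_index (K : fieldType) (D : cycle_data) (sz : 'I_(cd_num D) -> nat)
    (gam idx : forall i, 'I_(sz i) -> nat) :
  finite_set [set: vertex E] -> (forall v, regular v) -> no_exit E ->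
  (forall i (a : 'I_(sz i)), (gam i a < cd_len i)%N /\ (idx i a < cd_mult i)%N) ->
  (forall i (a b : 'I_(sz i)), gam i a = gam i b -> idx i a = idx i b -> a = b) ->
  (forall i r t, (r < cd_len i)%N -> (t < cd_mult i)%N ->
    exists a : 'I_(sz i), gam i a = r /\ idx i a = t) ->
  graded_iso (LPA K E)
    (zgalg_sum (fun i => laurent_matrix K (cd_len i) (fun a : 'I_(sz i) => (gam i a)%:Z))).
Proof.
move=> fV reg ne; case: D sz gam idx => nx n base m k nxP n_gt0 k_gt0 baseP base_ex base_uniq sizeP.
move=> /= sz gam idx lt inj surj.
have out_fin v : finite_set (out v) := (reg v).1.
pose N := (size (vertices E) + \sum_i m i).+1.
have lN i : (size (vertices E) + m i <= N)%N.
  by rewrite /N leqW // leq_add2l (bigD1 i) //= leq_addr.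
pose X := {i : 'I_n & 'I_(sz i)}.
have per i : iter (m i) (next nx) (base i) = base i.
  have [c [cc bc <-]] := baseP i.
  by apply/eqP; rewrite (cycle_iter ne nxP _ cc bc).
pose end_of (x : X) := iter (m (tag x) - gam _ (tagged x)) (next nx) (base (tag x)).
have end_ofP x : iter (gam _ (tagged x)) (next nx) (end_of x) = base (tag x).
  by rewrite -iterD subnKC // ltnW // (lt _ (tagged x)).1.
pose pth (x : X) := nth (end_of x, [::]) (paths_to N (end_of x)) (idx _ (tagged x)).
have idx_lt x : (idx _ (tagged x) < size (paths_to N (end_of x)))%N.
  by rewrite sizeP // (lt _ (tagged x)).2.
have pth_in x : pth x \in paths_to N (end_of x) by exact: mem_nth.
have pthE x : [/\ is_path (pth x).1 (pth x).2, size (pth x).2 = N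
    & path_end (pth x).1 (pth x).2 = end_of x].
  by have := pth_in x; rewrite mem_paths_to // => /and3P[? /eqP ? /eqP].
have base_cyclic i : cyclic (base i) by have [c [cc bc _]] := baseP i; exists c.
apply: (@lpa_blocks_iso K E fV reg ne nx nxP n base m baseP base_uniq N sz pth gam) => //.
- by rewrite /N; apply: leqW; exact: leq_addr.
- by move=> x; have [] := pthE x.
- move=> x y xy; have [_ _ ex] := pthE x; have [_ _ ey] := pthE y.
  have exy : end_of x = end_of y by rewrite -ex -ey xy.
  have hx := end_ofP x; have hy := end_ofP y; rewrite -exy in hy.
  have ij := base_uniq _ _ _ _ _ hx hy.
  case: x y xy ij {ex ey} exy hx hy => [i a] [j b] /= xy ij; subst j => /= exy hx hy.
  have [la ia] := lt i a; have [lb ib] := lt i b.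
  have gE : gam i a = gam i b.
    by have := base_modn ne nxP baseP hx hy; rewrite !modn_small.
  congr existT; apply: inj => //; apply/eqP.
  rewrite -(nth_uniq (end_of (existT _ i a), [::]) (idx_lt (existT _ i a)) _ (uniq_paths_to _ _)).
    by move: xy; rewrite /pth /= -exy => ->.
  by rewrite exy; exact: (idx_lt (existT _ i b)).
- move=> p pp zp; have cp : cyclic (path_end p.1 p.2).
    by apply: (long_path_cyclic ne nxP fV pp); rewrite zp /N leqW // leq_addr.
  have [i [r [rm rE]]] := base_ex _ cp.
  have eE : path_end p.1 p.2 = iter (m i - r) (next nx) (base i).
    apply: (iter_next_inj ne nxP (n := r)) => //; first exact: (cyclic_iter ne nxP).
    by rewrite rE -iterD subnKC ?per // ltnW.
  have pin : p \in paths_to N (iter (m i - r) (next nx) (base i)).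
    by rewrite mem_paths_to // pp zp eE !eqxx.
  have lt' : (index p (paths_to N (iter (m i - r) (next nx) (base i))) < k i)%N.
    by rewrite -(sizeP i (m i - r)%N N (lN i)) index_mem.
  have [a [ga ia]] := surj i r _ rm lt'.
  exists (existT _ i a); rewrite /pth /end_of /= ga ia nth_index //.
- by move=> x; have [_ _ ->] := pthE x.
Qed.

End Structure.

(** * Comparison of pre-ordered groups *)

Lemma pog_iso_trans G1 G2 G3 : pog_iso G1 G2 -> pog_iso G2 G3 -> pog_iso G1 G3.
Proof.
case=> f [bf fa fp fu] [h [bh ha hp hu]]; exists (h \o f : {additive G1 -> G3}).
split=> /=; first exact: bij_comp.
- by move=> d g; rewrite fa ha.
- by rewrite -hp -fp image_comp.
- by rewrite fu hu.
Qed.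

Lemma unit_fixed_of_iso G H : pog_iso G H ->
  pog_act 1 (pog_unit H) = pog_unit H -> pog_act 1 (pog_unit G) = pog_unit G.
Proof.
by case=> f [/bij_inj fI fa _ fu] h1; apply: fI; rewrite fa fu.
Qed.

(** All coefficients of the order-unit are equal, and x permutes them cyclically. *)
Lemma cyclic_unit_fixed n (k m : 'I_n -> nat) : (forall i, (0 < m i)%N) ->
  let H := pog_sum (fun i => cyclic_pogroup (m i) (k i)) in
  pog_act 1 (pog_unit H) = pog_unit H.
Proof.
move=> m_gt0 H; apply: functional_extensionality_dep => i /=.
pose R := {poly %/ ('X^(m i) - 1 : {poly int})}.
pose S : R := \sum_(j < m i) 'qX ^+ j *+ k i.
rewrite -/S -[LHS]/(qX_int (m i) 1 * S) (qX_int_nat (m_gt0 i) 1) expr1 /S.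
pose F r : {poly %/ ('X^(m i) - 1 : {poly int})} := 'qX ^+ r *+ k i.
have -> : 'qX * \sum_(j < m i) 'qX ^+ j *+ k i = \sum_(j < m i) F j.+1.
  by rewrite mulr_sumr; apply: eq_bigr => j _; rewrite mulrnAr -exprS.
have FM : F (m i) = F 0%N by rewrite /F qX_order.
have e1 : \sum_(r < (m i).+1) F r = \sum_(r < m i) F r + F (m i) by rewrite big_ord_recr.
have e2 : \sum_(r < (m i).+1) F r = F 0%N + \sum_(r < m i) F r.+1 by rewrite big_ord_recl.
by apply: (addrI (F 0%N)); rewrite -e2 e1 FM; exact: addrC.
Qed.

Lemma cyclic1_int_iso n (k : 'I_n -> nat) :
  pog_iso (pog_sum (fun i => cyclic_pogroup 1 (k i))) (pog_sum (fun i => int_pogroup (k i))).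
Proof.
set G := pog_sum _; set H := pog_sum _.
pose R := {poly %/ ('X^1 - 1 : {poly int})}.
pose h (g : G) : H := fun i => ((g i : R) : {poly int})`_0.
have hB : zmod_morphism h.
  by move=> x y; apply: functional_extensionality_dep => i; exact: coefB.
have RE (a : R) : a = 1 *~ (a : {poly int})`_0.
  by rewrite {1}(@qX_sumE 1 isT a) big_ord1.
have coef1 (a : int) : ((1 *~ a : R) : {poly int})`_0 = a.
  have := @coef_qX_sum 1 isT (fun=> a) 0 isT.
  by rewrite big_ord1 expr0.
pose l (b : H) : G := fun i => (1 : R) *~ b i.
pose f : {additive G -> H} :=
  HB.pack_for {additive G -> H} h (GRing.isZmodMorphism.Build G H h hB).
have lK : cancel l h by move=> b; apply: functional_extensionality_dep => i; exact: coef1.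
have hK : cancel h l.
  by move=> g; apply: functional_extensionality_dep => i; rewrite /l /h -(RE (g i)).
exists f; split=> /=.
- by exists l.
- move=> d g; apply: functional_extensionality_dep => i.
  have gi : pog_act (p := cyclic_pogroup 1 (k i)) d (g i) = g i :> R.
    by rewrite /= modz1 expr0 mul1r.
  exact: (congr1 (fun a : R => (a : {poly int})`_0) gi).
- apply/seteqP; split=> [_ [g gpos <-] i|b bpos]; first exact: gpos.
  exists (l b); last exact: lK.
  move=> i [|j]; first by rewrite coef1; exact: bpos.
  by rewrite big_coef_npoly // size_mk_monic_Xn1.
- apply: functional_extensionality_dep => i; rewrite /h /= big_ord1 expr0.
  by rewrite -[(1 : R) *+ k i]/((1 : R) *~ (k i)%:Z) coef1.
Qed.

(** * The equivalences *)

Section Equivalences.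
Variables (E : graph) (K : fieldType).
Hypothesis E_nonempty : inhabited (vertex E).

Lemma constant_conditions : finite_set [set: vertex E] -> (forall v : vertex E, regular v) ->
  (exists n0, forall n v, (n0 <= n)%N -> size (paths_to n.+1 v) = size (@paths_to E n v)) ->
  [/\ finite_graph E, no_exit E, forall v : vertex E, ~ sink v & EDL E].
Proof.
move=> fV reg [n0 const]; have out_fin v : finite_set (out v) := (reg v).1.
have [nx nxP] := regular_next reg; split.
- exact: regular_finite_graph.
- exact: (constant_no_exit fV out_fin nxP const).
- by move=> v sv; have [_ [e ve]] := reg v; rewrite /sink in sv; rewrite sv in ve.
- exact: (constant_EDL fV out_fin nxP const).
Qed.

Lemma unit_fixed_conditions : finite_set [set: vertex E] ->
  pog_act (p := graph_pogroup E) 1 (pog_unit (graph_pogroup E)) = pog_unit (graph_pogroup E) ->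
  [/\ finite_graph E, no_exit E, forall v : vertex E, ~ sink v & EDL E].
Proof.
move=> fV fix1; have reg := unit_fixed_regular fV fix1.
apply: constant_conditions => //; exact: unit_fixed_constant.
Qed.

Lemma crossed_conditions : crossed_product (LPA K E) ->
  [/\ finite_graph E, no_exit E, forall v : vertex E, ~ sink v & EDL E].
Proof.
move=> cp; have [fV reg] := crossed_finite_regular cp.
apply: constant_conditions => //; exact: crossed_constant cp.
Qed.

Lemma conditions_blocks :
  [/\ finite_graph E, no_exit E, forall v : vertex E, ~ sink v & EDL E] ->
  exists (n : nat) (k m : 'I_n -> nat),
    [/\ (0 < n)%N, forall i, (0 < k i)%N, forall i, (0 < m i)%N
      & graded_iso (LPA K E) (zgalg_sum (fun i => crossed_block K (k i) (m i)))].
Proof.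
move=> h; have [D] := cycle_data_exists E_nonempty h; have [[fV fE] ne ns _] := h.
have reg := finite_graph_regular (conj fV fE) ns.
have m_gt0 i : (0 < @cd_len E D i)%N.
  by have [c [cc _ <-]] := cd_baseP i; case: (c) cc.
exists (cd_num D), (@cd_mult E D), (@cd_len E D); split=> //.
- exact: cd_num_gt0.
- exact: cd_mult_gt0.
apply: (@lpa_iso_of_index E K D (fun i => (cd_mult i * cd_len i)%N)
  (fun i a => (a %/ cd_mult i)%N) (fun i a => (a %% cd_mult i)%N)) => //.
- move=> i a; rewrite ltn_divLR ?cd_mult_gt0 // ltn_mod cd_mult_gt0.
  by split=> //; apply: leq_trans (ltn_ord a) _; rewrite mulnC.
- move=> i a b ab1 ab2; apply/val_inj => /=.
  by rewrite (divn_eq a (cd_mult i)) (divn_eq b (cd_mult i)) ab1 ab2.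
move=> i r t rm tk; have lt : (r * cd_mult i + t < cd_mult i * cd_len i)%N.
  apply: (@leq_trans (r.+1 * cd_mult i)); first by rewrite mulSn addnC ltn_add2r.
  by rewrite mulnC leq_mul2l rm orbT.
exists (Ordinal lt) => /=; rewrite divnMDl ?cd_mult_gt0 // modnMDl.
by rewrite divn_small // modn_small // addn0.
Qed.

Lemma conditions_pog :
  [/\ finite_graph E, no_exit E, forall v : vertex E, ~ sink v & EDL E] ->
  exists (n : nat) (k m : 'I_n -> nat),
    [/\ (0 < n)%N, forall i, (0 < k i)%N,
        forall i, exists2 c : seq (edge E), is_cycle c & size c = m i
      & pog_iso (graph_pogroup E) (pog_sum (fun i => cyclic_pogroup (m i) (k i)))].
Proof.
move=> h; have [D] := cycle_data_exists E_nonempty h; have [[fV fE] ne ns _] := h.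
have reg := finite_graph_regular (conj fV fE) ns.
exists (cd_num D), (@cd_mult E D), (@cd_len E D); split=> //.
- exact: cd_num_gt0.
- exact: cd_mult_gt0.
- by move=> i; have [c [cc _ <-]] := cd_baseP i; exists c.
apply: (graph_pog_iso fV reg ne (@cd_nextP E D) (@cd_baseP E D) (@cd_base_ex E D)
  (@cd_base_uniq E D)).
by move=> i N; exact: (@cd_size E D i 0).
Qed.

(** A vertex on a loop is its own successor, so extension by the loop shows that the
    numbers of long paths to it are constant; long paths end nowhere else. *)
Lemma loops_conditions :
  [/\ finite_graph E, no_exit E, forall v : vertex E, ~ sink v
    & forall c : seq (edge E), is_cycle c -> size c = 1%N] ->
  [/\ finite_graph E, no_exit E, forall v : vertex E, ~ sink v & EDL E].
Proof.
move=> [fg ne ns loops]; have reg := finite_graph_regular fg ns; have [fV _] := fg.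
have out_fin v : finite_set (out v) := (reg v).1.
have [nx nxP] := regular_next reg; apply: constant_conditions => //.
exists (size (vertices E)) => n v ln; case: (pselect (cyclic v)) => [cv|ncv].
  have [c cc vc] := cv; have vv : next nx v = v.
    by apply/eqP; rewrite -[next nx v]/(iter 1 (next nx) v) (cycle_iter ne nxP _ cc vc) (loops c cc).
  by rewrite -{1}vv (size_paths_to_next ne nxP fV out_fin).
have none k : (size (vertices E) <= k)%N -> paths_to k v = [::].
  move=> lk; case pE: (paths_to k v) => [//|p s].
  have : p \in paths_to k v by rewrite pE mem_head.
  rewrite mem_paths_to // => /and3P[pp /eqP zp /eqP ep]; case: ncv.
  by rewrite -ep; apply: (long_path_cyclic ne nxP fV pp); rewrite zp.
by rewrite !none // leqW.
Qed.

Lemma loops_blocks :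
  [/\ finite_graph E, no_exit E, forall v : vertex E, ~ sink v
    & forall c : seq (edge E), is_cycle c -> size c = 1%N] ->
  exists (n : nat) (k : 'I_n -> nat),
    [/\ (0 < n)%N, forall i, (0 < k i)%N
      & graded_iso (LPA K E) (zgalg_sum (fun i => group_block K (k i)))].
Proof.
move=> h1; have h := loops_conditions h1; have [[fV fE] ne ns loops] := h1.
have reg := finite_graph_regular (conj fV fE) ns.
have [D] := cycle_data_exists E_nonempty h.
have m1 : @cd_len E D = fun=> 1%N.
  by apply/funext => i; have [c [cc _ <-]] := cd_baseP i; exact: loops.
exists (cd_num D), (@cd_mult E D); split; [exact: cd_num_gt0|exact: cd_mult_gt0|].
have := @lpa_iso_of_index E K D (@cd_mult E D) (fun i a => 0%N) (fun i a => a) fV reg ne.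
rewrite m1; apply.
- by move=> i a; rewrite ltn_ord.
- by move=> i a b _ ab; exact/val_inj.
by move=> i [|r] t // _ tk; exists (Ordinal tk).
Qed.

End Equivalences.

Theorem theorem4p1 (E : graph) (E_nonempty : inhabited (vertex E)) (K : fieldType) :
  ([<-> crossed_product (LPA K E);
        [/\ finite_graph E, no_exit E, forall v : vertex E, ~ sink v & EDL E];
        exists (n : nat) (k m : 'I_n -> nat),
                [/\ (0 < n)%N, forall i, (0 < k i)%N, forall i, (0 < m i)%N
                  & graded_iso (LPA K E)
                      (zgalg_sum (fun i => crossed_block K (k i) (m i)))];
        skew_group_ring (LPA K E);
        finite_set [set: vertex E] /\
              exists (n : nat) (k m : 'I_n -> nat),
                [/\ (0 < n)%N, forall i, (0 < k i)%N, forall i, (0 < m i)%N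
                  & pog_iso (graph_pogroup E)
                      (pog_sum (fun i => cyclic_pogroup (m i) (k i)))] ])
  /\
  ([<-> group_ring (LPA K E);
        [/\ finite_graph E, no_exit E, forall v : vertex E, ~ sink v
                & forall c : seq (edge E), is_cycle c -> size c = 1%N];
        exists (n : nat) (k : 'I_n -> nat),
                [/\ (0 < n)%N, forall i, (0 < k i)%N
                  & graded_iso (LPA K E)
                      (zgalg_sum (fun i => group_block K (k i)))];
        finite_set [set: vertex E] /\
              exists (n : nat) (k : 'I_n -> nat),
                [/\ (0 < n)%N, forall i, (0 < k i)%N
                  & pog_iso (graph_pogroup E)
                      (pog_sum (fun i => int_pogroup (k i)))] ]).
Proof.
have blocks_skew :
    (exists (n : nat) (k m : 'I_n -> nat),
      [/\ (0 < n)%N, forall i, (0 < k i)%N, forall i, (0 < m i)%N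
        & graded_iso (LPA K E) (zgalg_sum (fun i => crossed_block K (k i) (m i)))]) ->
    skew_group_ring (LPA K E).
  by case=> n [k [m [_ k0 m0 iso]]]; exact: crossed_blocks_skew k0 m0 iso.
have conditions_crossed :
    [/\ finite_graph E, no_exit E, forall v : vertex E, ~ sink v & EDL E] ->
    crossed_product (LPA K E).
  by case/(conditions_blocks K E_nonempty)/blocks_skew.
split; tfae.
- exact: crossed_conditions.
- exact: conditions_blocks.
- exact: blocks_skew.
- case=> /crossed_conditions h _; have [[fV _] _ _ _] := h; split=> //.
  have [n [k [m [n0 k0 mc iso]]]] := conditions_pog E_nonempty h.
  exists n, k, m; split=> // i; have [c cc <-] := mc i.
  by case: (c) cc.
- case=> fV [n [k [m [_ _ m0 iso]]]]; apply: conditions_crossed.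
  apply: unit_fixed_conditions => //.
  exact: unit_fixed_of_iso iso (cyclic_unit_fixed k m0).
- move=> gr; have [fg ne ns edl] := crossed_conditions gr.1; split=> // c cc.
  have [nx nxP] := regular_next (finite_graph_regular fg ns).
  exact: (group_ring_loops ne nxP gr).
- exact: loops_blocks.
- case=> n [k [_ _ /group_blocks_group gr]].
  have [fg ne ns edl] := crossed_conditions gr.1; have [fV _] := fg; split=> //.
  have loops (c : seq (edge E)) : is_cycle c -> size c = 1%N.
    have [nx nxP] := regular_next (finite_graph_regular fg ns).
    exact: (group_ring_loops ne nxP gr).
  have [n' [k' [m' [n0 k0 mc iso]]]] := conditions_pog E_nonempty (And4 fg ne ns edl).
  have m1 : m' = fun=> 1%N by apply/funext => i; have [c /loops + <-] := mc i.
  exists n', k'; split=> //; rewrite m1 in iso.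
  exact: pog_iso_trans iso (cyclic1_int_iso k').
case=> fV [n [k [_ _ iso]]].
have fixed (g : graph_pogroup E) : pog_act 1 g = g.
  by case: iso => f [/bij_inj fI fa _ _]; apply: fI; rewrite fa.
have h := unit_fixed_conditions fV (fixed _); have [fg ne ns _] := h.
have reg := finite_graph_regular fg ns; have [nx nxP] := regular_next reg.
have loops (c : seq (edge E)) : is_cycle c -> size c = 1%N.
  move=> cc; case cE: (c) (cc) => [//|e c'] _; rewrite -cE.
  apply: (vertex_fixed_loop ne nxP (v := src e)) => //.
  by rewrite cE mem_head.
have [n' [k' [_ _ iso']]] := loops_blocks K E_nonempty (And4 fg ne ns loops).
exact: group_blocks_group iso'.
Qed.
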